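(* There exists an analytic self-map $\phi\colon\mathbb{D}\to\mathbb{D}$ with $m(\{\xi\in\mathbb{T}: |\phi^\ast(\xi)|=1\})=0$ such that, for every $w\in H^2$, $w\not\equiv0$, for which $M_wC_\phi\colon f\mapsto w\,(f\circ\phi)$ is bounded on $H^2$, the operator $M_wC_\phi$ belongs to no Schatten class $S_p(H^2)$ with $p<\infty$.
   Context: $\mathbb{D}$ is the open unit disk, $\mathbb{T}=\partial\mathbb{D}$, $m$ the normalized Lebesgue measure on $\mathbb{T}$, $H^2$ the Hardy space, $\phi^\ast$ the radial limit function of $\phi$. $S_p(H^2)$, $p>0$, is the Schatten class of compact operators $T$ on $H^2$ with $\sum_n s_n(T)^p<\infty$. *)

(* Defs.v *)
From HB Require Import structures.
From mathcomp Require Import all_boot all_order all_algebra.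
From mathcomp Require Import all_classical all_reals all_analysis.
From mathcomp Require Import complex.
Import Order.TTheory GRing.Theory Num.Theory.
Import numFieldNormedType.Exports.

Set Implicit Arguments.
Unset Strict Implicit.
Unset Printing Implicit Defensive.

Local Open Scope ring_scope.
Local Open Scope classical_set_scope.

Section HardyDefs.
Variable R : realType.

Definition cmod (z : R[i]) : R :=
  Num.sqrt (complex.Re z ^+ 2 + complex.Im z ^+ 2).

Definition analytic_on_disk (f : R[i] -> R[i]) : Prop :=
  forall z : R[i], cmod z < 1 -> derivable (f : R[i]^o -> R[i]^o) z 1.

Definition analytic_selfmap (phi : R[i] -> R[i]) : Prop :=
  analytic_on_disk phi /\ (forall z, cmod z < 1 -> cmod (phi z) < 1).

Definition expi (t : R) : R[i] := (cos t +i* sin t)%C.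

Definition radial_limit (phi : R[i] -> R[i]) (t : R) (l : R[i]) : Prop :=
  (fun r : R => (phi ((r +i* 0)%C * expi t) : R[i]^o)) @ (1:R)^'- --> (l : R[i]^o).

Definition unimodular_boundary_set (phi : R[i] -> R[i]) : set R :=
  [set t | 0 <= t < 2 * pi /\ exists l, radial_limit phi t l /\ cmod l = 1].

Definition integral_mean2 (f : R[i] -> R[i]) (r : R) : \bar R :=
  (\int[@lebesgue_measure R]_(t in `[0%R, (2 * pi)%R[)
      ((cmod (f ((r +i* 0)%C * expi t))) ^+ 2)%:E
   * ((2 * pi)^-1)%:E)%E.

Definition H2norm2 (f : R[i] -> R[i]) : \bar R :=
  ereal_sup [set integral_mean2 f r | r in `[0, 1[].

(* the Hardy space H^2 (functions are only relevant on the disk) *)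
Definition H2 (f : R[i] -> R[i]) : Prop :=
  analytic_on_disk f /\ (H2norm2 f < +oo)%E.

Definition Op := (R[i] -> R[i]) -> (R[i] -> R[i]).

Definition wcomp (w phi : R[i] -> R[i]) : Op :=
  fun f z => w z * f (phi z).

Definition bounded_on_H2 (T : Op) : Prop :=
  (forall f, H2 f -> H2 (T f)) /\
  exists K : R, forall f, H2 f -> (H2norm2 (T f) <= K%:E * H2norm2 f)%E.

Definition linear_rank_le (F : Op) (k : nat) : Prop :=
  (forall f g, H2 f -> H2 g ->
     F (fun z => f z + g z) = (fun z => F f z + F g z)) /\
  (forall (c : R[i]) f, H2 f -> F (fun z => c * f z) = (fun z => c * F f z)) /\
  exists v : 'I_k -> (R[i] -> R[i]), (forall i, H2 (v i)) /\
    forall f, H2 f -> exists c : 'I_k -> R[i],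
      F f = (fun z => \sum_(i < k) c i * v i z).

Definition opnorm2_diff (T F : Op) : \bar R :=
  ereal_sup [set H2norm2 (fun z => T f z - F f z)
            | f in [set f | H2 f /\ (H2norm2 f <= 1)%E]].

(* squared singular (approximation) numbers:
   s_{k+1}(T)^2 = inf { ||T - F||^2 : rank F <= k } *)
Definition sing_num2 (T : Op) (k : nat) : \bar R :=
  ereal_inf [set opnorm2_diff T F | F in [set F | linear_rank_le F k]].

Definition schatten (p : R) (T : Op) : Prop :=
  (\sum_(0 <= k <oo) (sing_num2 T k) `^ (p / 2) < +oo)%E.

End HardyDefs.

(* Main.v *)
Require Import Defs.
From HB Require Import structures.
From mathcomp Require Import all_boot all_order all_algebra.
From mathcomp Require Import all_classical all_reals all_analysis.
From mathcomp Require Import measurable_realfun complex ring lra zify.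
Import Order.TTheory GRing.Theory Num.Theory.
Import numFieldNormedType.Exports.
Import ComplexField.Normc.
Local Open Scope ring_scope.
Local Open Scope classical_set_scope.
Set Implicit Arguments.
Unset Strict Implicit.
Unset Printing Implicit Defensive.

(* The symbol is [phi = (G - 1) / (G + 1)], where [s = (1 + z) / (1 - z)] and
   [G s = s + sum_k 2^(-k^4) A (s - i k)], [A] being a square-root branch mapping
   the right half-plane to the first quadrant. At [s = i y] the terms with
   [k > y] have positive real part, so [|phi*| < 1] away from [z = 1]; but this
   real part is so tiny for [K < y < K + 1] that the curve [G (i y)] follows the
   imaginary axis up to [2^(-K^4)].

   A nonzero [w] in [H^2] has [ln |w|] integrable on circles, hence
   [|w| >= exp (- C K^2)] on most of the arc of length about [K^-2] which
   corresponds to [K < y < K + 1]. Cut this arc into small cells and keep at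
   least [2^(K^3) / 2] well-separated cells on half of which [w] is not small;
   the functions [(eta / (s + eta - i v))^2] peaking at the images [i v] of
   these cells are almost orthogonal, and so are their images under the
   weighted composition operator, whose norms drop by a factor at most
   [exp (- C' K^2)]. Therefore at least [2^(K^3) / 2] singular numbers are
   at least [exp (- C'' K^2)], and the sum of their [p]-th powers is unbounded as
   [K] grows, for every [p].

   The log-integrability is obtained from a Goursat-type mean value property,
   applied to products of rotations of [w] composed with disk automorphisms. *)

(** Three scales are kept apart: K^2, K^3 and K^4. The window of index K has angular length of order
    K^-2, while the bound for the set where |w| < exp (- L) is C / L; fitting it into a quarter of
    the window forces L of order K^2, which is the loss. The gain is the count 2^(K^3), since
    2^(K^3) exp (- C p K^2) is unbounded for every fixed p. Packing that many separated cells needs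
    an angular step [tau] of order K^-4 2^(-2 K^3), and the curve has to follow the axis at this
    resolution: hence the weights 2^(-k^4). The step itself is harmless. The squared norms of the
    test functions and of their images are both proportional to [tau], so it cancels in the quotient
    and only exp (- 2 L) and a power of K remain. Boundary values of w never occur: [H2norm2] is a
    supremum over circles, so one circle of radius at least 1 - [tau] is enough, provided that the
    control of the small values of w is uniform in the radius near 1. *)

Section ComplexBasics.
Variable R : realType.
Local Notation C := R[i].
Local Notation Re := (@complex.Re R).
Local Notation Im := (@complex.Im R).
Implicit Types (z u v c d df dg : C) (f g : C -> C).

(** * Modulus and complex derivative on [R[i]] *)

Lemma cmodE z : cmod z = normc z.
Proof. by case: z. Qed.

Lemma normr_cmod z : `|z| = ((cmod z)%:C)%C.
Proof. by rewrite cmodE. Qed.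

Lemma cmod_ge0 z : 0 <= cmod z.
Proof. exact: sqrtr_ge0. Qed.
Hint Resolve cmod_ge0 : core.

Lemma cmodM u v : cmod (u * v) = cmod u * cmod v.
Proof. by rewrite !cmodE normcM. Qed.

Lemma cmodD u v : cmod (u + v) <= cmod u + cmod v.
Proof. by rewrite !cmodE le_normcD. Qed.

Lemma cmodN z : cmod (- z) = cmod z.
Proof. by rewrite !cmodE normcN. Qed.

Lemma cmodB u v : cmod (u - v) <= cmod u + cmod v.
Proof. by rewrite -(cmodN v) cmodD. Qed.

Lemma cmod_distC u v : cmod (u - v) = cmod (v - u).
Proof. by rewrite -cmodN opprB. Qed.

Lemma cmod_subl u v : cmod u - cmod v <= cmod (u - v).
Proof. by rewrite lerBlDr -{1}(subrK v u) cmodD. Qed.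

Lemma cmod0 : cmod (0 : C) = 0.
Proof. by rewrite cmodE normc0. Qed.

Lemma cmod1 : cmod (1 : C) = 1.
Proof. by rewrite cmodE normc1. Qed.

Lemma cmodV z : cmod z^-1 = (cmod z)^-1.
Proof. by rewrite !cmodE normcV. Qed.

Lemma cmodX z n : cmod (z ^+ n) = cmod z ^+ n.
Proof. by elim: n => [|n IH]; rewrite ?expr0 ?cmod1// !exprS cmodM IH. Qed.

Lemma cmod_eq0 z : (cmod z == 0) = (z == 0).
Proof.
apply/eqP/eqP => [|->]; last exact: cmod0.
by rewrite cmodE => /eq0_normc.
Qed.

Lemma cmod_gt0 z : (0 < cmod z) = (z != 0).
Proof. by rewrite lt_def cmod_eq0 cmod_ge0 andbT. Qed.

Lemma cmod_sqr z : cmod z ^+ 2 = Re z ^+ 2 + Im z ^+ 2.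
Proof. by rewrite /cmod sqr_sqrtr// addr_ge0// sqr_ge0. Qed.

Lemma ler_Re_cmod z : `|Re z| <= cmod z.
Proof.
rewrite -(@ler_pXn2r _ 2)// ?nnegrE// cmod_sqr real_normK ?num_real//.
by rewrite lerDl sqr_ge0.
Qed.

Lemma ler_Im_cmod z : `|Im z| <= cmod z.
Proof.
rewrite -(@ler_pXn2r _ 2)// ?nnegrE// cmod_sqr real_normK ?num_real//.
by rewrite lerDr sqr_ge0.
Qed.

Lemma Re_le_cmod z : Re z <= cmod z.
Proof. exact: le_trans (ler_norm _) (ler_Re_cmod z). Qed.

Lemma cmod_le_ReIm z : cmod z <= `|Re z| + `|Im z|.
Proof.
rewrite -(@ler_pXn2r _ 2)// ?nnegrE ?addr_ge0// cmod_sqr.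
rewrite -(real_normK (num_real (Re z))) -(real_normK (num_real (Im z))).
by rewrite sqrrD -addrA lerD2l lerDr mulrn_wge0// mulr_ge0.
Qed.

Lemma cmod_real (x : R) : cmod (x%:C)%C = `|x|.
Proof. by rewrite /cmod /= expr0n addr0 sqrtr_sqr. Qed.

Lemma cmod_prod (I : finType) (F : I -> C) :
  cmod (\prod_i F i) = \prod_i cmod (F i).
Proof. by apply: (big_morph _ cmodM cmod1). Qed.

Lemma cmod_sum (I : finType) (P : pred I) (F : I -> C) :
  cmod (\sum_(i | P i) F i) <= \sum_(i | P i) cmod (F i).
Proof.
elim/big_ind2: _ => [|x1 x2 y1 y2 h1 h2|//]; first by rewrite cmod0.
exact: le_trans (cmodD _ _) (lerD h1 h2).
Qed.

Lemma complex_eqP u v : Re u = Re v -> Im u = Im v -> u = v.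
Proof. by case: u => a b; case: v => c d /= -> ->. Qed.

Lemma ReD u v : Re (u + v) = Re u + Re v. Proof. by case: u; case: v. Qed.
Lemma ImD u v : Im (u + v) = Im u + Im v. Proof. by case: u; case: v. Qed.
Lemma ReN u : Re (- u) = - Re u. Proof. by case: u. Qed.
Lemma ImN u : Im (- u) = - Im u. Proof. by case: u. Qed.
Lemma ReM u v : Re (u * v) = Re u * Re v - Im u * Im v.
Proof. by case: u; case: v. Qed.
Lemma ImM u v : Im (u * v) = Re u * Im v + Im u * Re v.
Proof. by case: u; case: v. Qed.

Lemma conjcM_cmod z : z^*%C * z = ((cmod z ^+ 2)%:C)%C.
Proof. by apply: complex_eqP; rewrite cmod_sqr; case: z => a b /=; ring. Qed.

Lemma cmod_conjc z : cmod z^*%C = cmod z.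
Proof. by case: z => a b; rewrite /cmod /= sqrrN. Qed.

Lemma expiD (s t : R) : expi (s + t) = expi s * expi t.
Proof. by apply: complex_eqP; rewrite /= ?cosD ?sinD //; ring. Qed.

Lemma cmod_expi (t : R) : cmod (expi t) = 1.
Proof. by rewrite /cmod /= cos2Dsin2 sqrtr1. Qed.

Lemma expi_periodic (t : R) : expi (t + 2 * pi) = expi t.
Proof. by rewrite /expi mulr_natl cosD2pi sinD2pi. Qed.

Lemma cmod_polar (r t : R) : 0 <= r -> cmod ((r +i* 0)%C * expi t) = r.
Proof. by move=> r0; rewrite cmodM cmod_expi mulr1 cmod_real ger0_norm. Qed.

(* Complex derivative in epsilon-delta form: the topology of [R[i]] is
   reached through a complex-valued norm, which is awkward to use directly. *)
Definition cdiff f z d : Prop := forall e : R, 0 < e -> exists2 r : R, 0 < r &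
  forall h, cmod h < r -> cmod (f (z + h) - f z - d * h) <= e * cmod h.

Definition ccont f z : Prop := forall e : R, 0 < e -> exists2 r : R, 0 < r &
  forall h, cmod h < r -> cmod (f (z + h) - f z) < e.

Lemma normr_lt_cmod z (e : R) : (`|z| < (e%:C)%C) = (cmod z < e).
Proof. by rewrite normr_cmod ltcR. Qed.

(** A positive element of [R[i]] is real, so each complex radius of the topology can be traded for
    its real part. *)
Lemma derivable_cdiff f z :
  derivable (f : C^o -> C^o) z 1 <-> exists d, cdiff f z d.
Proof.
split=> [/cvg_ex[/= d /cvgrPdist_lt H]|[d H]].
  exists d => e e0; have : (0 : C) < (e%:C)%C by rewrite ltcR.
  move=> /H /nbhs_ballP[r /= r0 Hr].
  have rE : (((Re r)%:C)%C : C) = r by rewrite RRe_real// gtr0_real.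
  have r0' : 0 < Re r by rewrite -ltcR rE.
  exists (Re r) => // h hr; have [->|h0] := eqVneq h 0.
    by rewrite addr0 subrr mulr0 subr0 cmod0 mulr0.
  have := Hr h; rewrite /ball /= sub0r normrN -rE normr_lt_cmod => /(_ hr h0).
  rewrite normr_lt_cmod scaler1 [_ *: _]/(_ * _) /shift /= => /ltW Hd.
  have -> : f (z + h) - f z - d * h = - (d - h^-1 * (f (h + z) - f z)) * h.
    by rewrite (addrC z); field.
  by rewrite cmodM cmodN ler_wpM2r.
apply/cvg_ex; exists d; apply/cvgrPdist_lt => e e0.
have eE : (((Re e)%:C)%C : C) = e by rewrite RRe_real// gtr0_real.
have e0' : 0 < Re e by rewrite -ltcR eE.
have [r r0 Hr] := H (Re e / 2) (divr_gt0 e0' (ltr0Sn _ 1)).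
apply/nbhs_ballP; exists ((r%:C)%C); first by rewrite /= ltcR.
move=> h /=; rewrite /ball /= sub0r normrN normr_lt_cmod => /Hr hr h0.
rewrite -eE normr_lt_cmod scaler1 [_ *: _]/(_ * _) /shift /=.
have h0' : 0 < cmod h by rewrite cmod_gt0.
rewrite -(ltr_pM2r h0') -cmodM.
have -> : (d - h^-1 * (f (h + z) - f z)) * h = - (f (z + h) - f z - d * h).
  by rewrite (addrC z); field.
by rewrite cmodN; apply: le_lt_trans hr _; rewrite ltr_pM2r//; lra.
Qed.

Lemma cdiff_ccont f z d : cdiff f z d -> ccont f z.
Proof.
move=> H e e0; have [r r0 Hr] := H 1 ltr01.
have K0 : 0 < 1 + cmod d by rewrite ltr_pwDl.
exists (Num.min r (e / (1 + cmod d))); first by rewrite lt_min r0 divr_gt0.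
move=> h; rewrite lt_min => /andP[/Hr hr he].
rewrite -(subrK (d * h) (_ - _)); apply: le_lt_trans (cmodD _ _) _.
rewrite cmodM; apply: le_lt_trans (lerD hr (lexx _)) _.
by rewrite -mulrDl mulrC -ltr_pdivlMr.
Qed.

Lemma cdiff_eq f g z d : (forall x, f x = g x) -> cdiff f z d -> cdiff g z d.
Proof. by move=> /funext ->. Qed.

Lemma cdiff_cst c z : cdiff (fun=> c) z 0.
Proof.
move=> e e0; exists 1 => // h _.
by rewrite subrr mul0r subr0 cmod0 mulr_ge0// ltW.
Qed.

Lemma cdiff_id z : cdiff id z 1.
Proof.
move=> e e0; exists 1 => // h _.
by rewrite mul1r (addrC z) addrK subrr cmod0 mulr_ge0// ltW.
Qed.

Lemma cdiffD f g z df dg :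
  cdiff f z df -> cdiff g z dg -> cdiff (fun x => f x + g x) z (df + dg).
Proof.
move=> Hf Hg e e0; have e2 : 0 < e / 2 by rewrite divr_gt0.
have [r1 r10 H1] := Hf _ e2; have [r2 r20 H2] := Hg _ e2.
exists (Num.min r1 r2); first by rewrite lt_min r10.
move=> h; rewrite lt_min => /andP[/H1 a1 /H2 a2].
have -> : f (z + h) + g (z + h) - (f z + g z) - (df + dg) * h =
  (f (z + h) - f z - df * h) + (g (z + h) - g z - dg * h) by ring.
by apply: le_trans (cmodD _ _) _; lra.
Qed.

Lemma cdiffM f g z df dg : cdiff f z df -> cdiff g z dg ->
  cdiff (fun x => f x * g x) z (df * g z + f z * dg).
Proof.
move=> Hf Hg e e0.
have K0 : 0 < 1 + cmod (f z) + cmod (g z) + cmod dg.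
  by rewrite -!addrA ltr_pwDl// !addr_ge0.
set K := (1 + _ + _ + _) in K0.
have eK : 0 < e / K by rewrite divr_gt0.
have m0 : 0 < Num.min 1 (e / K) by rewrite lt_min ltr01 eK.
have [r1 r10 H1] := Hf _ eK; have [r2 r20 H2] := Hg _ eK.
have [r3 r30 H3] := cdiff_ccont Hf m0.
have [r4 r40 H4] := Hg _ m0.
exists (Num.min (Num.min r1 r2) (Num.min r3 r4)); first by rewrite !lt_min r10 r20 r30.
move=> h; rewrite !lt_min => /andP[/andP[/H1 a1 /H2 a2] /andP[/H3 a3 /H4 a4]].
set u := f (z + h) - f z - df * h in a1.
set v := g (z + h) - g z - dg * h in a2 a4.
set w := f (z + h) - f z in a3.
have -> : f (z + h) * g (z + h) - f z * g z - (df * g z + f z * dg) * h =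
  u * g z + f z * v + w * v + w * dg * h by rewrite /u /v /w; ring.
move: a3; rewrite lt_min => /andP[w1 we].
have -> : e * cmod h = (e / K * cmod h) * cmod (g z) +
  cmod (f z) * (e / K * cmod h) + 1 * (e / K * cmod h) + e / K * cmod dg * cmod h.
  by rewrite /K; field; rewrite gt_eqF.
apply: le_trans (cmodD _ _) _; rewrite !cmodM; apply: lerD; last first.
  by rewrite ler_wpM2r// ler_wpM2r// ltW.
apply: le_trans (cmodD _ _) _; rewrite !cmodM; apply: lerD; last first.
  by apply: ler_pM => //; rewrite ltW.
apply: le_trans (cmodD _ _) _; rewrite !cmodM; apply: lerD.
  by rewrite ler_wpM2r.
by rewrite ler_wpM2l.
Qed.

Lemma cdiff_comp f g z df dg : cdiff f z df -> cdiff g (f z) dg ->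
  cdiff (fun x => g (f x)) z (dg * df).
Proof.
move=> Hf Hg e e0.
have K0 : 0 < 1 + cmod df + cmod dg by rewrite -addrA ltr_pwDl// addr_ge0.
set K := (1 + _ + _) in K0.
have eK : 0 < e / K by rewrite divr_gt0.
have m0 : 0 < Num.min 1 (e / K) by rewrite lt_min ltr01 eK.
have [r1 r10 H1] := Hg _ eK.
have [r2 r20 H2] := Hf _ m0.
have [r3 r30 H3] := cdiff_ccont Hf r10.
exists (Num.min r2 r3); first by rewrite lt_min r20.
move=> h; rewrite lt_min => /andP[/H2 a2 /H3 a3].
set k := f (z + h) - f z in a3.
have kE : f (z + h) = f z + k by rewrite /k; ring.
have := H1 _ a3; rewrite kE => a1.
set u := _ - _ - _ in a1.
have -> : g (f z + k) - g (f z) - dg * df * h = u + dg * (k - df * h).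
  by rewrite /u; ring.
set v := k - df * h in a2 *.
have kh : cmod k <= (1 + cmod df) * cmod h.
  have -> : k = v + df * h by rewrite /v; ring.
  apply: le_trans (cmodD _ _) _; rewrite cmodM mulrDl lerD2r mul1r.
  apply: le_trans a2 _; rewrite -[leRHS]mul1r ler_wpM2r//.
  by rewrite ge_min lexx.
have -> : e * cmod h = e / K * ((1 + cmod df) * cmod h) + cmod dg * (e / K * cmod h).
  by rewrite /K; field; rewrite gt_eqF.
apply: le_trans (cmodD _ _) _; rewrite cmodM; apply: lerD.
  by apply: le_trans a1 _; rewrite ler_wpM2l// ltW.
rewrite ler_wpM2l//; apply: le_trans a2 _; rewrite ler_wpM2r//.
by rewrite ge_min lexx orbT.
Qed.

Lemma cdiffV z : z != 0 -> cdiff (fun x => x^-1) z (- z^-2).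
Proof.
move=> z0 e e0; have m0 : 0 < cmod z by rewrite cmod_gt0.
have K0 : 0 < e * cmod z ^+ 3 / 2 by rewrite divr_gt0// mulr_gt0// exprn_gt0.
exists (Num.min (cmod z / 2) (e * cmod z ^+ 3 / 2)).
  by rewrite lt_min K0 divr_gt0.
move=> h; rewrite lt_min => /andP[h1 h2].
have zh : cmod z / 2 <= cmod (z + h).
  by have := cmod_subl z (- h); rewrite opprK cmodN; lra.
have zh0 : z + h != 0 by rewrite -cmod_gt0; apply: lt_le_trans zh; rewrite divr_gt0.
have -> : (z + h)^-1 - z^-1 - - z^-2 * h = h * (h / (z ^+ 2 * (z + h))).
  by field; rewrite z0 zh0.
rewrite cmodM mulrC ler_wpM2r// cmodM cmodV cmodM cmodX.
rewrite ler_pdivrMr; last by rewrite mulr_gt0 ?exprn_gt0// cmod_gt0.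
apply: le_trans (ltW h2) _.
rewrite -!mulrA ler_wpM2l//; first exact: ltW.
by rewrite !ler_wpM2l.
Qed.

Lemma cdiff_prod n (F : 'I_n -> C -> C) z : (forall i, exists d, cdiff (F i) z d) ->
  exists d, cdiff (fun x => \prod_(i < n) F i x) z d.
Proof.
elim: n F => [|n IH] F HF.
  by exists 0; apply: cdiff_eq (cdiff_cst 1 z) => x; rewrite big_ord0.
have [d1 H1] := IH _ (fun i => HF (widen_ord (leqnSn n) i)).
have [d2 H2] := HF ord_max.
eexists; apply: cdiff_eq (cdiffM H1 H2) => x; rewrite big_ord_recr//.
Qed.

Lemma cdiff_sum n (F : 'I_n -> C -> C) z : (forall i, exists d, cdiff (F i) z d) ->
  exists d, cdiff (fun x => \sum_(i < n) F i x) z d.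
Proof.
elim: n F => [|n IH] F HF.
  by exists 0; apply: cdiff_eq (cdiff_cst 0 z) => x; rewrite big_ord0.
have [d1 H1] := IH _ (fun i => HF (widen_ord (leqnSn n) i)).
have [d2 H2] := HF ord_max.
eexists; apply: cdiff_eq (cdiffD H1 H2) => x; rewrite big_ord_recr//.
Qed.

End ComplexBasics.
#[global] Hint Resolve cmod_ge0 : core.

(** * Primitives, mean value estimates and Goursat's bisection *)

Section RealCalculus.
Variable R : realType.
Implicit Types (f F dF : R -> R) (a b x : R).

Definition prim a f x : R := (\int[@lebesgue_measure R]_(t in `[a, x]) f t)%R.

(** A two-sided derivative needs [x] strictly to the right of the base point; primitives used on an
    interval starting at 0 are therefore based at a negative point such as -1. *)
Lemma is_derive_prim a f x : continuous f -> a < x ->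
  is_derive x 1 (prim a f) (f x).
Proof.
move=> cf ax.
have xx1 : x < x + 1 by rewrite ltrDl.
have fint : (@lebesgue_measure R).-integrable `[a, x + 1] (EFin \o f).
  apply: continuous_compact_integrable; first exact: segment_compact.
  exact: continuous_subspaceT.
have [d1 d2] := @continuous_FTC1_closed _ f a x (x + 1) xx1 fint ax (cf x).
by apply: DeriveDef; [exact: d1|rewrite -derive1E; exact: d2].
Qed.

Lemma MVT_le F dF a b : a <= b ->
  (forall x, a <= x <= b -> is_derive x 1 F (dF x)) ->
  exists2 c, a <= c <= b & F b - F a = dF c * (b - a).
Proof.
move=> ab H; have [||c] := @MVT_segment R F dF a b ab.
- by move=> x; rewrite in_itv /= => /andP[xa xb]; apply: H; rewrite !ltW.
- apply: derivable_within_continuous => x; rewrite in_itv /= => xab.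
  by have [] := H _ xab.
by rewrite in_itv /=; exists c.
Qed.

Lemma lip_of_derive F dF a b M : a <= b ->
  (forall x, a <= x <= b -> is_derive x 1 F (dF x)) ->
  (forall x, a <= x <= b -> `|dF x| <= M) -> `|F b - F a| <= M * (b - a).
Proof.
move=> ab H HM; have [c cab ->] := MVT_le ab H.
by rewrite normrM (ger0_norm (_ : 0 <= b - a)) ?subr_ge0// ler_wpM2r ?subr_ge0// HM.
Qed.

Lemma lip_of_derive_sym F dF M :
  (forall x, is_derive x 1 F (dF x)) -> (forall x, `|dF x| <= M) ->
  forall x y, `|F x - F y| <= M * `|x - y|.
Proof.
move=> H HM x y; wlog xy : x y / y <= x.
  move=> W; have [/W//|/ltW/W] := leP y x.
  by rewrite distrC (distrC x).
rewrite (ger0_norm (_ : 0 <= x - y)) ?subr_ge0//.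
exact: (@lip_of_derive F dF).
Qed.

Lemma nested_segments (u l : nat -> R) :
  (forall n, u n <= u n.+1) -> (forall n, u n.+1 + l n.+1 <= u n + l n) ->
  (forall n, 0 <= l n) -> exists x, forall n, u n <= x <= u n + l n.
Proof.
move=> inc dec l0.
have monou : {homo u : m n / (m <= n)%N >-> m <= n} by apply/nondecreasing_seqP.
have monol : {homo (fun n => - (u n + l n)) : m n / (m <= n)%N >-> m <= n}.
  by apply/nondecreasing_seqP => n; rewrite lerN2.
have ub m n : u m <= u n + l n.
  have h1 := monou m _ (leq_maxl m n); have := monol n _ (leq_maxr m n).
  rewrite lerN2; have := l0 (maxn m n); lra.
have hs : has_sup [set u n | n in [set: nat]].
  by split; [exists (u 0%N), 0%N | exists (u 0%N + l 0%N) => _ [m _ <-]].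
exists (sup [set u n | n in [set: nat]]) => n; apply/andP; split.
  by apply: sup_upper_bound => //; exists n.
by apply: ge_sup => [|_ [m _ <-]//]; exists (u 0%N), 0%N.
Qed.

(* Goursat's bisection: a mixed second difference which is [o(area)] on small
   cells around every point vanishes. *)
Lemma second_difference_eq0 (D : R -> R -> R) (X T : R) : 0 <= X -> 0 <= T ->
  let Delta x t s := D (x + X * s) (t + T * s) - D (x + X * s) t
                     - D x (t + T * s) + D x t in
  (forall x0 t0, 0 <= x0 <= X -> 0 <= t0 <= T -> forall e, 0 < e ->
    exists2 r, 0 < r & forall x t s, 0 < s < r -> 0 <= x -> x + X * s <= X ->
      0 <= t -> t + T * s <= T ->
      x <= x0 <= x + X * s -> t <= t0 <= t + T * s ->
      `|Delta x t s| <= e * s ^+ 2) ->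
  Delta 0 0 1 = 0.
Proof.
move=> X0 T0 Delta H; apply/eqP; rewrite -normr_le0 leNgt; apply/negP => c0.
set c := `|_| in c0.
(* [Delta] of a cell is the sum over its four quarters, so one quarter carries at least a fourth of
   its modulus; the two booleans of [q] tell which one. *)
have step (p : R * R) (s : R) : exists q : bool * bool,
    `|Delta p.1 p.2 s| / 4 <=
    `|Delta (p.1 + q.1%:R * (X * (s / 2))) (p.2 + q.2%:R * (T * (s / 2))) (s / 2)|.
  case: p => x t /=; apply: contrapT => /forallNP N.
  have n1 := N (false, false); have n2 := N (false, true).
  have n3 := N (true, false); have n4 := N (true, true).
  move: n1 n2 n3 n4 => /negP + /negP + /negP + /negP.
  rewrite -!ltNge /= !mul0r !addr0 !mul1r => n1 n2 n3 n4.
  have E : Delta x t s = Delta x t (s / 2) + Delta x (t + T * (s / 2)) (s / 2) +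
     Delta (x + X * (s / 2)) t (s / 2) +
     Delta (x + X * (s / 2)) (t + T * (s / 2)) (s / 2).
    have hX : x + X * (s / 2) + X * (s / 2) = x + X * s by lra.
    have hT : t + T * (s / 2) + T * (s / 2) = t + T * s by lra.
    by rewrite /Delta hX hT; ring.
  have := ler_normD (Delta x t (s / 2) + Delta x (t + T * (s / 2)) (s / 2) +
     Delta (x + X * (s / 2)) t (s / 2)) (Delta (x + X * (s / 2)) (t + T * (s / 2)) (s / 2)).
  have := ler_normD (Delta x t (s / 2) + Delta x (t + T * (s / 2)) (s / 2))
     (Delta (x + X * (s / 2)) t (s / 2)).
  have := ler_normD (Delta x t (s / 2)) (Delta x (t + T * (s / 2)) (s / 2)).
  rewrite -E; lra.
have [q Hq] := choice (fun ps : (R * R) * R => step ps.1 ps.2).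
pose S (n : nat) : R := (2 ^+ n)^-1.
pose p := fix p n : R * R := if n is m.+1 then
  ((p m).1 + (q (p m, S m)).1%:R * (X * (S m / 2)),
   (p m).2 + (q (p m, S m)).2%:R * (T * (S m / 2))) else (0, 0).
have S0 n : 0 < S n by rewrite /S invr_gt0 exprn_gt0.
have SS n : S n.+1 = S n / 2.
  by rewrite /S exprS; field; rewrite expf_neq0.
have big n : c * S n ^+ 2 <= `|Delta (p n).1 (p n).2 (S n)|.
  elim: n => [|n IH]; first by rewrite /S expr0 invr1 expr1n mulr1.
  have := Hq (p n, S n); rewrite /= -/(p n) SS => h; apply: le_trans h.
  by apply: le_trans (_ : _ <= c * S n ^+ 2 / 4) _; [lra|rewrite ler_pM2r].
have b01 (b : bool) (z : R) : 0 <= z -> 0 <= b%:R * z <= z.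
  by move=> z0; case: b; rewrite ?mul1r ?mul0r ?lexx z0.
have [x0 Hx0] : exists x, forall n, (p n).1 <= x <= (p n).1 + X * S n.
  apply: nested_segments => n; last by rewrite mulr_ge0// ltW.
    have /b01 /= := mulr_ge0 X0 (ltW (S0 n.+1)).
    by move=> /(_ (q (p n, S n)).1); rewrite SS; lra.
  have /b01 /= := mulr_ge0 X0 (ltW (S0 n.+1)).
  by move=> /(_ (q (p n, S n)).1); rewrite SS; lra.
have [t0 Ht0] : exists x, forall n, (p n).2 <= x <= (p n).2 + T * S n.
  apply: nested_segments => n; last by rewrite mulr_ge0// ltW.
    have /b01 /= := mulr_ge0 T0 (ltW (S0 n.+1)).
    by move=> /(_ (q (p n, S n)).2); rewrite SS; lra.
  have /b01 /= := mulr_ge0 T0 (ltW (S0 n.+1)).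
  by move=> /(_ (q (p n, S n)).2); rewrite SS; lra.
have px n : 0 <= (p n).1 /\ (p n).1 + X * S n <= X.
  elim: n => [|n [IH1 IH2]]; first by rewrite /= /S expr0 invr1; lra.
  have /b01 /= := mulr_ge0 X0 (ltW (S0 n.+1)).
  by move=> /(_ (q (p n, S n)).1); rewrite SS; lra.
have pt n : 0 <= (p n).2 /\ (p n).2 + T * S n <= T.
  elim: n => [|n [IH1 IH2]]; first by rewrite /= /S expr0 invr1; lra.
  have /b01 /= := mulr_ge0 T0 (ltW (S0 n.+1)).
  by move=> /(_ (q (p n, S n)).2); rewrite SS; lra.
have x0X : 0 <= x0 <= X by have := Hx0 0%N; rewrite /= /S expr0 invr1; lra.
have t0T : 0 <= t0 <= T by have := Ht0 0%N; rewrite /= /S expr0 invr1; lra.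
(* The selected cells shrink to ([x0], [t0]) with [Delta] at least [c * S n ^+ 2]; tolerance [c / 2]
   contradicts this as soon as [S n < r]. *)
have [r r0 Hr] := H x0 t0 x0X t0T (c / 2) (divr_gt0 c0 (ltr0Sn _ 1)).
have [n Sn] : exists n, S n < r.
  have := near_infty_natSinv_expn_lt (PosNum r0).
  move=> [n _ /(_ n (leqnn n))] /=; rewrite mul1r => h; exists n; exact: h.
have := Hr (p n).1 (p n).2 (S n).
rewrite S0 Sn => /(_ isT (px n).1 (px n).2 (pt n).1 (pt n).2 (Hx0 n) (Ht0 n)).
have := big n; have : 0 < c * S n ^+ 2 by rewrite mulr_gt0// exprn_gt0.
lra.
Qed.

Lemma expi_lip (s t : R) : cmod (expi s - expi t) <= 2 * `|s - t|.
Proof.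
have hc := @lip_of_derive_sym cos (fun x => - sin x) 1 (@is_derive_cos R).
have hs := @lip_of_derive_sym sin cos 1 (@is_derive_sin R).
apply: le_trans (cmod_le_ReIm _) _; rewrite /= mulr2n mulrDl !mul1r; apply: lerD.
  by rewrite -[leRHS]mul1r; apply: hc => x; rewrite normrN sin_max.
by rewrite -[leRHS]mul1r; apply: hs => x; exact: cos_max.
Qed.

End RealCalculus.

(** * The mean value property by Goursat's argument in polar coordinates *)

Section MeanValue.
Variable R : realType.
Local Notation C := R[i].
Local Notation Re := (@complex.Re R).
Local Notation Im := (@complex.Im R).
Implicit Types (f : C -> C) (r x y s t u X : R).

(* Polar coordinates with radius [r exp(-x^2)], so that every real [x] stays in
   the closed disk of radius [r]. *)
Definition gpolar r x t : C := ((r * expR (- x ^+ 2))%:C)%C * expi t.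

Lemma cmod_gpolar r x t : 0 <= r -> cmod (gpolar r x t) = r * expR (- x ^+ 2).
Proof.
by move=> r0; rewrite cmodM cmod_expi mulr1 cmod_real ger0_norm// mulr_ge0// expR_ge0.
Qed.

Lemma cmod_gpolar_le r x t : 0 <= r -> cmod (gpolar r x t) <= r.
Proof.
move=> r0; rewrite cmod_gpolar// ler_piMr// -expR0 ler_expR.
by rewrite oppr_le0 sqr_ge0.
Qed.

Lemma is_derive_gauss x :
  is_derive x 1 (fun x : R => expR (- x ^+ 2)) (- (2 * x) * expR (- x ^+ 2)).
Proof.
have h : is_derive x 1 (fun x : R => - x ^+ 2) (- (2 * x)).
  by apply: is_derive_eq; rewrite /GRing.scale /=; ring.
have := @is_derive1_comp R expR (fun x : R => - x ^+ 2) x _ _ (is_derive_expR _) h.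
by move=> H; apply: (is_derive_eq H); ring.
Qed.

Lemma gpolar_lip r X x y s t : 0 <= r -> 0 <= x <= X -> 0 <= y <= X ->
  cmod (gpolar r x s - gpolar r y t) <= r * (2 * X * `|x - y| + 2 * `|s - t|).
Proof.
move=> r0 xX yX.
have gl : `|expR (- x ^+ 2) - expR (- y ^+ 2)| <= 2 * X * `|x - y|.
  wlog xy : x y xX yX / y <= x.
    move=> W; have [h|/ltW h] := leP y x; first exact: W.
    by rewrite distrC (distrC x); exact: W.
  rewrite (ger0_norm (_ : 0 <= x - y)) ?subr_ge0//.
  apply: lip_of_derive xy (fun z _ => is_derive_gauss z) _ => z zxy.
  have z0 : 0 <= z by lra.
  rewrite normrM normrN (ger0_norm (_ : 0 <= 2 * z)); last by rewrite mulr_ge0.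
  rewrite (ger0_norm (expR_ge0 _)).
  have : expR (- z ^+ 2) <= 1 by rewrite -expR0 ler_expR oppr_le0 sqr_ge0.
  have := expR_ge0 (- z ^+ 2); nra.
have -> : gpolar r x s - gpolar r y t =
   (r%:C)%C * ((((expR (- x ^+ 2) - expR (- y ^+ 2))%:C)%C * expi s) +
   ((expR (- y ^+ 2))%:C)%C * (expi s - expi t)).
  by rewrite /gpolar !rmorphM rmorphB /=; ring.
rewrite cmodM cmod_real (ger0_norm r0) ler_wpM2l//.
apply: le_trans (cmodD _ _) _; rewrite !cmodM cmod_expi mulr1 !cmod_real.
apply: lerD => //; apply: le_trans (_ : _ <= 1 * (2 * `|s - t|)) _; last by rewrite mul1r.
apply: ler_pM => //; [exact: cmod_ge0| |exact: expi_lip].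
by rewrite ger0_norm ?expR_ge0// -expR0 ler_expR oppr_le0 sqr_ge0.
Qed.

Lemma Re_gpolar r x t : Re (gpolar r x t) = r * expR (- x ^+ 2) * cos t.
Proof. by rewrite ReM /=; ring. Qed.

Lemma Im_gpolar r x t : Im (gpolar r x t) = r * expR (- x ^+ 2) * sin t.
Proof. by rewrite ImM /=; ring. Qed.

Lemma gpolar_periodic r x t : gpolar r x (t + 2 * pi) = gpolar r x t.
Proof. by rewrite /gpolar expi_periodic. Qed.

Lemma ccont_real_comp f (g : R -> C) t : ccont f (g t) ->
  (forall e : R, 0 < e -> \forall s \near t, cmod (g s - g t) < e) ->
  {for t, continuous (fun s => Re (f (g s)))} /\
  {for t, continuous (fun s => Im (f (g s)))}.
Proof.
move=> cf cg.
have near_f e : 0 < e -> \forall s \near t, cmod (f (g s) - f (g t)) < e.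
  move=> /cf[r /cg + Hr]; apply: filterS => s /Hr.
  by rewrite (addrC (g t)) subrK.
split; apply/cvgrPdist_lt => e /near_f; apply: filterS => s; apply: le_lt_trans.
  by rewrite distrC -ReN -ReD ler_Re_cmod.
by rewrite distrC -ImN -ImD ler_Im_cmod.
Qed.

Lemma lip_near (g : R -> C) t (K : R) : 0 <= K ->
  (forall s, cmod (g s - g t) <= K * `|s - t|) ->
  forall e : R, 0 < e -> \forall s \near t, cmod (g s - g t) < e.
Proof.
move=> K0 H e e0; have K1 : 0 < K + 1 by rewrite ltr_wpDl.
apply/nbhs_ballP; exists (e / (K + 1)); first exact: divr_gt0.
move=> s; rewrite /ball /= => h2; apply: le_lt_trans (H s) _.
move: h2; rewrite distrC ltr_pdivlMr// mulrC mulrDl mul1r.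
by have := normr_ge0 (s - t); lra.
Qed.

Lemma gpolar_near_t r x t : 0 <= r ->
  forall e : R, 0 < e -> \forall s \near t, cmod (gpolar r x s - gpolar r x t) < e.
Proof.
move=> r0; apply: (@lip_near _ _ (r * 2)); first by rewrite mulr_ge0.
move=> s; rewrite /gpolar -mulrBr cmodM cmod_real.
rewrite -mulrA; apply: ler_pM => //; [exact: cmod_ge0| |exact: expi_lip].
rewrite ger0_norm ?mulr_ge0 ?expR_ge0// ler_piMr// -expR0 ler_expR.
by rewrite oppr_le0 sqr_ge0.
Qed.

Lemma gpolar_near_x r x t : 0 <= r ->
  forall e : R, 0 < e -> \forall y \near x, cmod (gpolar r y t - gpolar r x t) < e.
Proof.
move=> r0 e e0; have r1 : 0 < r + 1 by rewrite ltr_wpDl.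
have c : {for x, continuous (fun x : R => expR (- x ^+ 2))}.
  have [/derivable1_diffP/differentiable_continuous] := is_derive_gauss x; exact.
have : \forall y \near x, `|expR (- x ^+ 2) - expR (- y ^+ 2)| < e / (r + 1).
  by move/cvgrPdist_lt : c; apply; exact: divr_gt0.
apply: filterS => y; rewrite ltr_pdivlMr// => h.
rewrite /gpolar -mulrBl cmodM cmod_expi mulr1 -rmorphB cmod_real -mulrBr normrM.
rewrite (ger0_norm r0) distrC; apply: le_lt_trans h.
by rewrite mulrC ler_wpM2l// lerDl.
Qed.

(** With z = [gpolar r x t], the form Re (f dz / (i z)) reads Re f dt - 2 x Im f dx. For f z = b z
    it is Re (- i b dz), hence exact, and [IZ] is a potential. *)
Lemma gpolar_affine_potential r (b : C) : exists IZ : R -> R -> R,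
  (forall y u, is_derive u 1 (IZ y) (Re (b * gpolar r y u))) /\
  (forall u y, is_derive y 1 (IZ ^~ u) (- (2 * y) * Im (b * gpolar r y u))).
Proof.
pose b1 : R := Re b; pose b2 : R := Im b.
exists (fun x t => r * expR (- x ^+ 2) * (b1 * sin t + b2 * cos t)); split => [y u|u y].
  apply: is_derive_eq; rewrite /GRing.scale /= ReM Re_gpolar Im_gpolar -/b1 -/b2.
  by ring.
have -> : (fun y0 : R => r * expR (- y0 ^+ 2) * (b1 * sin u + b2 * cos u)) =
   (fun y0 : R => (r * (b1 * sin u + b2 * cos u)) *: expR (- y0 ^+ 2)).
  by apply/funext => v; rewrite /GRing.scale /=; ring.
apply: (is_derive_eq (is_deriveZ _ (is_derive_gauss y))).
by rewrite /GRing.scale /= ImM Re_gpolar Im_gpolar -/b1 -/b2; ring.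
Qed.

(** [P] and [Q] integrate the two components of the form Re (f dz / (i z)), so the mixed difference
    of [P - Q] is its circulation around a cell. Near each point f is affine up to a small error:
    the affine part contributes nothing, the error contributes o(area), and bisection kills the
    total circulation. By [QE] the sides t = 0 and t = 2 pi cancel, which leaves equal integrals
    over the two circles. *)
Lemma gpolar_circulation_const f r X (P Q : R -> R -> R) : 0 <= r -> 0 <= X ->
  (forall z, cmod z <= r -> exists d, cdiff f z d) ->
  (forall x t, 0 <= t -> is_derive t 1 (P x) (Re (f (gpolar r x t)))) ->
  (forall t x, 0 <= x ->
     is_derive x 1 (Q t) (Im (f (gpolar r x t)) * (- (2 * x)))) ->
  Q (2 * pi) = Q 0 ->
  P X (2 * pi) - P X 0 = P 0 (2 * pi) - P 0 0.
Proof.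
move=> r0 X0 Hf dP dQ QE.
have pi2 : 0 <= 2 * pi :> R by rewrite mulr_ge0// pi_ge0.
pose T : R := 2 * pi; pose D x t := P x t - Q t x.
have /= := @second_difference_eq0 R D X T X0 pi2.
rewrite !mulr1 !add0r => H.
suff: D X T - D X 0 - D 0 T + D 0 0 = 0.
  have -> : D X T - D X 0 - D 0 T + D 0 0 = (P X T - P X 0) - (P 0 T - P 0 0) -
    ((Q T X - Q T 0) - (Q 0 X - Q 0 0)) by rewrite /D; ring.
  rewrite /T QE.
  by rewrite subrr subr0 => /eqP; rewrite subr_eq0 => /eqP.
apply: H => x0 t0 x0X t0T e e0.
have [b Hb] := Hf _ (cmod_gpolar_le x0 t0 r0).
set z0 := gpolar r x0 t0 in Hb.
(* [L * s] bounds the distance to [z0] on the image of a cell of size [s], by [gpolar_lip]; [K]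
   below also absorbs the lengths of the four sides. *)
pose L := r * (2 * X * X + 2 * T).
have T0 : 0 <= T by [].
have XX := mulr_ge0 X0 X0.
have L0 : 0 <= L by rewrite mulr_ge0//; lra.
pose K := (L + 1) * (2 * T + 4 * X * X + 1).
have K0 : 0 < K by rewrite mulr_gt0//; lra.
have [eta eta0 Heta] := Hb _ (divr_gt0 e0 K0).
have L1 : 0 < L + 1 by rewrite ltr_wpDl.
exists (eta / (L + 1)); first by rewrite divr_gt0.
move=> x t s /andP[s0 sr] xge xle tge tle xx tt.
pose a : C := f z0 - b * z0.
pose err x t : C := f (gpolar r x t) - (a + b * gpolar r x t).
have Herr y u : x <= y <= x + X * s -> t <= u <= t + T * s ->
    cmod (err y u) <= e / K * (L * s).
  move=> hy hu; have hZ : cmod (gpolar r y u - z0) <= L * s.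
    apply: le_trans (gpolar_lip u t0 r0 (_ : 0 <= y <= X) x0X) _; first lra.
    rewrite /L -[leRHS]mulrA ler_wpM2l//.
    have a1 : `|y - x0| <= X * s by rewrite ler_norml; lra.
    have a2 : `|u - t0| <= T * s by rewrite ler_norml; lra.
    by have := ler_wpM2l X0 a1; lra.
  have -> : err y u = f (z0 + (gpolar r y u - z0)) - f z0 - b * (gpolar r y u - z0).
    by rewrite (addrC z0) subrK /err /a; ring.
  apply: le_trans (Heta _ _) _; last by rewrite ler_wpM2l// divr_ge0 ?ltW.
  apply: le_lt_trans hZ _; move: sr; rewrite ltr_pdivlMr//; lra.
pose E := e / K * (L * s).
have [IZ [dI1 dI2]] := gpolar_affine_potential r b.
(* Subtracting the potentials of the affine part from [P] and [Q] leaves the mixed difference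
   unchanged, but the derivatives become components of [err], which are small. *)
pose Pt (y u : R) : R := P y u - (Re a * u + IZ y u).
have dPt (y u : R) : 0 <= u -> is_derive u 1 (Pt y) (Re (err y u)).
  move=> u0; have h1 := dP y u u0; have h3 := dI1 y u.
  have h2 : is_derive u 1 (fun u : R => Re a * u + IZ y u) (Re a + Re (b * gpolar r y u)).
    by apply: is_derive_eq; rewrite /GRing.scale /=; ring.
  apply: (is_derive_eq (is_deriveB h1 h2)).
  by rewrite /err ReD ReN ReD.
pose Qt (u y : R) : R := Q u y - (- Im a * y ^+ 2 + IZ y u).
have dQt (u y : R) : 0 <= y -> is_derive y 1 (Qt u) (Im (err y u) * (- (2 * y))).
  move=> y0; have h1 := dQ u y y0; have h3 := dI2 u y.
  have h2 : is_derive y 1 (fun y : R => - Im a * y ^+ 2 + IZ y u) (- Im a * (2 * y) +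
      - (2 * y) * Im (b * gpolar r y u)).
    by apply: is_derive_eq; rewrite /GRing.scale /=; ring.
  apply: (is_derive_eq (is_deriveB h1 h2)).
  by rewrite /err ImD ImN ImD; ring.
have xs : x <= x + X * s by rewrite lerDl mulr_ge0// ltW.
have ts : t <= t + T * s by rewrite lerDl mulr_ge0// ltW.
have tE : t + T * s - t = T * s by ring.
have xE : x + X * s - x = X * s by ring.
have lP y : x <= y <= x + X * s -> `|Pt y (t + T * s) - Pt y t| <= E * (T * s).
  move=> hy; rewrite -[in leRHS]tE.
  apply: (@lip_of_derive R (Pt y) (fun u => Re (err y u)) t (t + T * s) E ts) => u hu.
    by apply: dPt; lra.
  by apply: le_trans (ler_Re_cmod _) _; exact: Herr.
have lQ u : t <= u <= t + T * s -> `|Qt u (x + X * s) - Qt u x| <= (E * (2 * X)) * (X * s).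
  move=> hu; rewrite -[in leRHS]xE.
  apply: (@lip_of_derive R (Qt u) (fun y => Im (err y u) * (- (2 * y))) x (x + X * s) (E * (2 * X)) xs) => y hy.
    by apply: dQt; lra.
  rewrite normrM; apply: ler_pM => //.
    apply: le_trans (ler_Im_cmod _) _; exact: Herr.
  by rewrite normrN ger0_norm; lra.
have -> : D (x + X * s) (t + T * s) - D (x + X * s) t - D x (t + T * s) + D x t =
    (Pt (x + X * s) (t + T * s) - Pt (x + X * s) t) - (Pt x (t + T * s) - Pt x t)
    - ((Qt (t + T * s) (x + X * s) - Qt (t + T * s) x) - (Qt t (x + X * s) - Qt t x)).
  by rewrite /D /Pt /Qt; ring.
have := lP x; have := lP (x + X * s); have := lQ t; have := lQ (t + T * s).
rewrite !lexx xs ts => /(_ isT) q1 /(_ isT) q2 /(_ isT) p1 /(_ isT) p2.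
apply: le_trans (_ : 2 * (E * (T * s)) + 2 * (E * (2 * X) * (X * s)) <= _); last first.
  have -> : 2 * (E * (T * s)) + 2 * (E * (2 * X) * (X * s)) =
    (L * (2 * T + 4 * X * X)) / K * (e * s ^+ 2) by rewrite /E; field; rewrite gt_eqF.
  have hK : L * (2 * T + 4 * X * X) <= K by apply: ler_pM => //; lra.
  have es : 0 <= e * s ^+ 2 by rewrite mulr_ge0 ?sqr_ge0// ltW.
  by rewrite ler_piMl// ler_pdivrMr// mul1r.
have -> : 2 * (E * (T * s)) + 2 * (E * (2 * X) * (X * s)) =
  (E * (T * s) + E * (T * s)) + (E * (2 * X) * (X * s) + E * (2 * X) * (X * s)) by ring.
apply: le_trans (ler_normB _ _) _.
by apply: lerD; apply: le_trans (ler_normB _ _) _; apply: lerD.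
Qed.

(** All the circles of radius r exp (- X^2) give the same integral of Re f. Each integral is 2 pi
    times a value taken on its circle, and for large X that value is close to Re (f 0). Attaining
    the mean is all that the maximum principle requires. *)
Lemma mean_value_attained f r : 0 <= r ->
  (forall z, cmod z <= r -> exists d, cdiff f z d) ->
  exists2 t, 0 <= t <= 2 * pi & Re (f ((r%:C)%C * expi t)) = Re (f 0).
Proof.
move=> r0 Hf.
have cf z : cmod z <= r -> ccont f z by move=> /Hf[d /cdiff_ccont].
have cUV_t x t := ccont_real_comp (cf _ (cmod_gpolar_le x t r0))
                                  (gpolar_near_t x t r0).
have cUV_x t x := @ccont_real_comp f (fun y => gpolar r y t) x (cf _ (cmod_gpolar_le x t r0))
                                  (gpolar_near_x x t r0).
pose U x t := Re (f (gpolar r x t)).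
have [P [Q [dP dQ QE]]] : exists P Q : R -> R -> R,
    [/\ forall x t, 0 <= t -> is_derive t 1 (P x) (Re (f (gpolar r x t))),
        forall t x, 0 <= x ->
          is_derive x 1 (Q t) (Im (f (gpolar r x t)) * (- (2 * x))) &
        Q (2 * pi) = Q 0].
  pose W t x := Im (f (gpolar r x t)) * (- (2 * x)).
  exists (fun x => prim (-1) (U x)), (fun t => prim (-1) (W t)); split.
  - move=> x t t0; apply: is_derive_prim; last exact: lt_le_trans t0.
    by move=> s; exact: (cUV_t x s).1.
  - move=> t x x0; apply: (@is_derive_prim _ _ (W t)); last exact: lt_le_trans x0.
    move=> y; apply: cvgM; first exact: (cUV_x t y).2.
    by apply: cvgN; apply: cvgM; [exact: cvg_cst|exact: cvg_id].
  - congr (prim _ _); apply/funext => x.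
    by rewrite /W -[2 * pi]add0r gpolar_periodic.
have const X (X0 : 0 <= X) := gpolar_circulation_const r0 X0 Hf dP dQ QE.
have pi2 : 0 <= 2 * pi :> R by rewrite mulr_ge0// pi_ge0.
have mvt X : exists2 t, 0 <= t <= 2 * pi & P X (2 * pi) - P X 0 = U X t * (2 * pi).
  have [t ht] := @MVT_le R (P X) (U X) 0 (2 * pi) pi2 (fun t ht =>
    dP X t (proj1 (andP ht))).
  by rewrite subr0; exists t.
have pi2' : 0 < 2 * pi :> R by rewrite mulr_gt0// pi_gt0.
have [t ht Ht] := mvt 0.
have Z0 : gpolar r 0 t = (r%:C)%C * expi t by rewrite /gpolar expr0n oppr0 expR0 mulr1.
exists t => //; rewrite -Z0 -/(U 0 t).
apply/eqP; rewrite -subr_eq0 -normr_le0; apply/ler_addgt0Pr => e e0; rewrite add0r.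
have [eta eta0 Heta] := cf 0 (eq_ind_r (fun x => x <= r) r0 (cmod0 R)) e e0.
have [X X0 HX] : exists2 X : R, 0 <= X & r * expR (- X ^+ 2) < eta.
  exists (r / eta + 1); first by rewrite addr_ge0// divr_ge0// ltW.
  set X := _ + 1; have X1 : 1 <= X by rewrite lerDr divr_ge0// ltW.
  rewrite expRN ltr_pdivrMr ?expR_gt0//.
  have : X <= expR (X ^+ 2).
    apply: le_trans (_ : X ^+ 2 <= _); first by rewrite expr2 ler_peMl//; lra.
    by have := expR_ge1Dx (X ^+ 2); lra.
  move=> /(ler_wpM2l (ltW eta0)); apply: lt_le_trans.
  have -> : eta * X = r + eta by rewrite /X; field; rewrite gt_eqF.
  by rewrite ltrDl.
have [t' ht' Ht'] := mvt X.
have -> : U 0 t = U X t'.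
  by apply/eqP; rewrite -(inj_eq (mulIf (lt0r_neq0 pi2'))) -Ht -Ht' const.
have := Heta (gpolar r X t'); rewrite add0r cmod_gpolar// => /(_ HX) /ltW.
by apply: le_trans; rewrite /U -ReN -ReD ler_Re_cmod.
Qed.

End MeanValue.

(** * Disk automorphisms on the circle, the Poisson kernel and Riemann sums *)

Section MobiusAngle.
Variable R : realType.
Local Notation C := R[i].
Local Notation Re := (@complex.Re R).
Local Notation Im := (@complex.Im R).
Implicit Types (a u : C) (s t q x y : R).

Lemma cos_sin_atan q :
  (cos (atan q) ^+ 2 = (1 + q ^+ 2)^-1) * (cos (atan q) * sin (atan q) = q / (1 + q ^+ 2)).
Proof.
have q1 : 0 < 1 + q ^+ 2 by rewrite ltr_pwDl// sqr_ge0.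
have c2 : cos (atan q) ^+ 2 = (1 + q ^+ 2)^-1.
  by rewrite cos_atan exprVn sqr_sqrtr// ltW.
have c0 : cos (atan q) != 0.
  by rewrite cos_atan invr_eq0 gt_eqF// sqrtr_gt0.
split=> //; have sE : sin (atan q) = q * cos (atan q).
  by rewrite -{2}(atanK q) /tan; field.
by rewrite sE mulrCA -expr2 c2.
Qed.

Lemma expi_2atan q : expi (2 * atan q) =
  ((1 - q ^+ 2) / (1 + q ^+ 2) +i* (2 * q / (1 + q ^+ 2)))%C.
Proof.
have q1 : 1 + q ^+ 2 != 0 by rewrite gt_eqF// ltr_pwDl// sqr_ge0.
apply: complex_eqP => /=; rewrite mulr_natl.
  by rewrite cos_mulr2n cos_sin_atan; field.
by rewrite sin_mulr2n cos_sin_atan -mulr_natl; field.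
Qed.

Lemma expiN t : expi (- t) = (expi t)^*%C.
Proof. by rewrite /expi cosN sinN. Qed.

Definition mden a t : C := 1 + a^*%C * expi t.

Lemma Re_mden a t : Re (mden a t) = 1 + Re a * cos t + Im a * sin t.
Proof. by rewrite /mden; case: a => a1 a2 /=; ring. Qed.

Lemma Im_mden a t : Im (mden a t) = Re a * sin t - Im a * cos t.
Proof. by rewrite /mden; case: a => a1 a2 /=; ring. Qed.

Lemma Re_mden_gt0 a t : cmod a < 1 -> 0 < Re (mden a t).
Proof.
move=> a1; rewrite ReD /=.
have := ler_Re_cmod (a^*%C * expi t); rewrite cmodM cmod_expi mulr1 cmod_conjc.
by rewrite ler_norml => /andP[h _]; lra.
Qed.

Lemma mden_neq0 a t : cmod a < 1 -> mden a t != 0.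
Proof. by move=> /(Re_mden_gt0 t) h; apply/eqP => m0; rewrite m0 ltxx in h. Qed.

(** The Poisson kernel of the point [- a]; it is the derivative of [mangle a]. *)
Definition poisson a t : R := (1 - cmod a ^+ 2) / cmod (mden a t) ^+ 2.

(** A continuous argument of (u + a) / (1 + conj a u) at u = e^(it). The numerator is e^(it) times
    the conjugate of [mden a t], so the argument of the denominator counts twice, and it is an
    arctangent because the real part of [mden] is positive. *)
Definition mangle a t : R := t - 2 * atan (Im (mden a t) / Re (mden a t)).

Lemma mden_periodic a t : mden a (t + 2 * pi) = mden a t.
Proof. by rewrite /mden expi_periodic. Qed.

Lemma mangle_periodic a t : mangle a (t + 2 * pi) = mangle a t + 2 * pi.
Proof. by rewrite /mangle mden_periodic addrAC. Qed.

Lemma is_derive_mangle a t : cmod a < 1 -> is_derive t 1 (mangle a) (poisson a t).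
Proof.
move=> a1; pose a_1 : R := Re a; pose a_2 : R := Im a.
pose N t : R := a_1 * sin t - a_2 * cos t.
pose D t : R := 1 + a_1 * cos t + a_2 * sin t.
have D0 : 0 < D t by rewrite /D -Re_mden Re_mden_gt0.
have dN : is_derive t 1 N (a_1 * cos t + a_2 * sin t).
  by apply: is_derive_eq; rewrite /GRing.scale /=; ring.
have dD : is_derive t 1 D (- a_1 * sin t + a_2 * cos t).
  by apply: is_derive_eq; rewrite /GRing.scale /=; ring.
have dDV := is_deriveV (lt0r_neq0 D0) dD.
have dq := is_deriveM dN dDV.
have dA := is_derive1_comp (is_derive1_atan _) dq.
have dA2 := is_deriveB (is_derive_id t 1) (is_deriveZ 2 dA).
have -> : mangle a = (id - 2 *: (atan \o (N * (fun y => (D y)^-1))))%R.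
  by apply/funext => s; rewrite /mangle Im_mden Re_mden.
apply: (is_derive_eq dA2).
rewrite /poisson !cmod_sqr Re_mden Im_mden -/a_1 -/a_2 -/(N t) -/(D t).
have ND : 0 < D t ^+ 2 + N t ^+ 2 by rewrite ltr_pwDl ?sqr_ge0// exprn_gt0.
rewrite /GRing.scale /= [(N * _) t]/(N t * (D t)^-1).
have cs := cos2Dsin2 t.
have h : 1 + (N t * (D t)^-1) ^+ 2 = (D t ^+ 2 + N t ^+ 2) / D t ^+ 2.
  by field; rewrite gt_eqF.
rewrite h invf_div.
have key : a_1 ^+ 2 + a_2 ^+ 2 = (a_1 ^+ 2 + a_2 ^+ 2) * (cos t ^+ 2 + sin t ^+ 2).
  by rewrite cs mulr1.
have DNE : D t ^+ 2 + N t ^+ 2 = 1 + 2 * (a_1 * cos t + a_2 * sin t) + (a_1 ^+ 2 + a_2 ^+ 2).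
  by rewrite [X in _ = _ + X]key /D /N; ring.
have NE : N t ^+ 2 = a_1 ^+ 2 + a_2 ^+ 2 - (a_1 * cos t + a_2 * sin t) ^+ 2.
  by rewrite [X in _ = X - _]key /N; ring.
have -> : - a_1 * sin t + a_2 * cos t = - N t by rewrite /N; ring.
have DE : a_1 * cos t + a_2 * sin t = D t - 1 by rewrite /D; ring.
rewrite DE in DNE NE *.
have -> : a_1 ^+ 2 + a_2 ^+ 2 = D t ^+ 2 + N t ^+ 2 - 1 - 2 * (D t - 1) by rewrite DNE; ring.
move: (D t) (N t) D0 ND => d n d0 nd.
by field; rewrite !gt_eqF.
Qed.

Lemma expi_mangle a t : cmod a < 1 -> expi (mangle a t) = (expi t + a) / mden a t.
Proof.
move=> a1; have m0 := mden_neq0 t a1; apply: (mulIf m0); rewrite divfK//.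
rewrite /mangle expiD expiN expi_2atan.
have := Re_mden_gt0 t a1; set D := Re _; set N := Im _ => D0.
have mE : mden a t = (D +i* N)%C by apply: complex_eqP.
have conjE : expi t + a = expi t * (mden a t)^*%C.
  rewrite /mden rmorphD rmorph1 rmorphM /= conjcK mulrDr mulr1 mulrCA.
  have -> : expi t * (expi t)^*%C = 1.
    by rewrite mulrC conjcM_cmod cmod_expi expr1n.
  by rewrite mulr1.
rewrite conjE mE -[LHS]mulrA; congr (_ * _).
have ND : D ^+ 2 + N ^+ 2 != 0 by rewrite gt_eqF// ltr_pwDl ?sqr_ge0// exprn_gt0.
by apply: complex_eqP => /=; field; rewrite ND gt_eqF.
Qed.

Lemma poisson_bounds a t (q : R) : cmod a <= q -> q < 1 ->
  (1 - q ^+ 2) / 4 <= poisson a t <= (1 - q)^-2.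
Proof.
move=> aq q1; have a0 := cmod_ge0 a.
have up : cmod (mden a t) <= 2.
  apply: le_trans (cmodD _ _) _; rewrite cmod1 cmodM cmod_expi mulr1 cmod_conjc; lra.
have lo : 1 - q <= cmod (mden a t).
  have := cmod_subl 1 (- (a^*%C * expi t)).
  by rewrite opprK cmodN cmod1 cmodM cmod_expi mulr1 cmod_conjc -/(mden a t); lra.
have m0 : 0 < cmod (mden a t) by lra.
rewrite /poisson; apply/andP; split.
  apply: ler_pM.
  - by rewrite subr_ge0 expr_le1//; lra.
  - by rewrite invr_ge0.
  - by rewrite lerD2l lerN2 ler_pXn2r// nnegrE; lra.
  - rewrite lef_pV2 ?posrE ?exprn_gt0// (_ : 4 = 2 ^+ 2); last by ring.
    by rewrite ler_pXn2r// nnegrE ltW.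
rewrite -exprVn -[leRHS]mul1r; apply: ler_pM.
- by rewrite subr_ge0 expr_le1//; lra.
- by rewrite exprn_ge0// invr_ge0 cmod_ge0.
- by rewrite gerBl exprn_ge0.
- rewrite -exprVn ler_pXn2r ?nnegrE ?invr_ge0 ?cmod_ge0//; last by lra.
  by rewrite lef_pV2 ?posrE//; lra.
Qed.

Lemma mobius_le1 a u : cmod a < 1 -> cmod u <= 1 ->
  (1 + a^*%C * u != 0) /\ cmod ((u + a) / (1 + a^*%C * u)) <= 1.
Proof.
move=> a1 u1.
have n0 : 1 + a^*%C * u != 0.
  have := cmod_subl 1 (- (a^*%C * u)); rewrite opprK cmodN cmod1 cmodM cmod_conjc.
  rewrite -cmod_gt0 => h; apply: lt_le_trans h.
  by rewrite subr_gt0; apply: le_lt_trans a1; rewrite ler_piMr ?cmod_ge0.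
split=> //; rewrite cmodM cmodV ler_pdivrMr ?cmod_gt0// mul1r.
rewrite -(@ler_pXn2r _ 2)// ?nnegrE ?cmod_ge0//.
(* This product equals |1 + conj a u|^2 - |u + a|^2. *)
have h : 0 <= (1 - cmod a ^+ 2) * (1 - cmod u ^+ 2).
  by rewrite mulr_ge0// subr_ge0 expr_le1 ?cmod_ge0// ltW.
move: h; rewrite !cmod_sqr; case: a {a1 n0} => a1 a2; case: u {u1} => u1 u2 /=.
move=> h; rewrite -subr_ge0; apply: le_trans h _.
by rewrite le_eqVlt; apply/orP; left; apply/eqP; ring.
Qed.

Lemma segment_unif_continuous (h : R -> R) (B e : R) : continuous h -> 0 < e ->
  exists2 eta : R, 0 < eta & forall x y, 0 <= x <= B -> `|x - y| < eta ->
    `|h x - h y| < e.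
Proof.
move=> ch e0.
have e2 : 0 < e / 2 by rewrite divr_gt0.
have := @segment_compact R 0 B; move=> /compact_near_coveringP.
move=> /(_ R (0 : R)^'+ (fun eta x => forall y, `|x - y| < eta -> `|h x - h y| < e)).
have H x : `[0, B]%classic x -> \forall x' \near x & eta \near 0^'+,
    forall y, `|x' - y| < eta -> `|h x' - h y| < e.
  move=> _; have /cvgrPdist_lt/(_ _ e2)/nbhs_ballP[rho /= rho0 Hrho] := ch x.
  have rho2 : 0 < rho / 2 by rewrite divr_gt0.
  exists (ball x (rho / 2), [set eta | eta < rho / 2]).
    split; first exact: nbhsx_ballx.
    exact: nbhs_right_lt.
  move=> [x' eta] /= [bx eta2] y xy; rewrite /ball /= in bx.
  have h1 : `|h x - h x'| < e / 2 by apply: Hrho; rewrite /ball /=; lra.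
  have h2 : `|h x - h y| < e / 2.
    apply: Hrho; rewrite /ball /=.
    by have := ler_distD x' x y; lra.
  by have := ler_distD (h x) (h x') (h y); rewrite (distrC (h x') (h x)); lra.
move=> /(_ _ H) Hn.
have [eta] : exists eta : R, 0 < eta /\
    `[0, B]%classic `<=` (fun x => forall y, `|x - y| < eta -> `|h x - h y| < e).
  near (0 : R)^'+ => eta; exists eta; split; near: eta; last exact: Hn.
  exact: nbhs_right_gt.
move=> [eta0 Heta]; exists eta => // x y xB; apply: Heta.
by rewrite /= in_itv.
Unshelve. all: by end_near.
Qed.

Lemma primitive_period (h H : R -> R) (b T x y : R) : 0 <= T ->
  (forall x, b < x -> is_derive x 1 H (h x)) -> (forall x, h (x + T) = h x) ->
  b < x -> b < y -> H (x + T) - H x = H (y + T) - H y.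
Proof.
move=> T0 dH per; wlog xy : x y / x <= y.
  move=> W bx bY; have [/W|/ltW/W] := leP x y; first exact.
  by move=> ->.
move=> bx _; apply/eqP; rewrite eq_sym -subr_eq0 -normr_le0.
have h0 : 0 = 0 * (y - x) by rewrite mul0r.
rewrite [leRHS]h0.
apply: (@lip_of_derive R (fun x => H (x + T) - H x) (fun=> 0) x y 0 xy); last first.
  by move=> *; rewrite normr0.
move=> z xz.
have d1 : is_derive z 1 (fun z => H (z + T)) (h z).
  have dzT : is_derive (z + T) 1 H (h (z + T)) by apply: dH; lra.
  have dshift : is_derive z 1 (fun z : R => z + T) 1.
    by apply: is_derive_eq; rewrite addr0.
  have := @is_derive1_comp R H (fun z : R => z + T) z _ _ dzT dshift.
  by rewrite mulr1 per.
have d2 : is_derive z 1 H (h z) by apply: dH; lra.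
by apply: (is_derive_eq (is_deriveB d1 d2)); rewrite subrr.
Qed.

(** The starting angle of the equally spaced points may vary with N: by periodicity the integral
    over a period starting there is the same, and uniform continuity makes the Riemann sums converge
    uniformly in the starting angle. *)
Lemma riemann_sum_period (h H : R -> R) (c : R) : continuous h ->
  (forall x, h (x + 2 * pi) = h x) ->
  (forall x, -1 < x -> is_derive x 1 H (h x)) ->
  (forall N : nat, exists2 t, 0 <= t <= 2 * pi &
     c * N.+1%:R <= \sum_(j < N.+1) h (t + 2 * pi * j%:R / N.+1%:R)) ->
  2 * pi * c <= H (2 * pi) - H 0.
Proof.
move=> ch per dH HN.
have p0 : 0 < 2 * pi :> R by rewrite mulr_gt0// pi_gt0.
set p : R := 2 * pi in p0 per HN *.
apply/ler_addgt0Pr => e e0.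
have [eta eta0 Heta] := segment_unif_continuous (3 * p) ch (divr_gt0 e0 p0).
have [N HNe] : exists N : nat, p / N.+1%:R < eta.
  have [N] := near_infty_natSinv_lt (PosNum (divr_gt0 eta0 p0)).
  move=> _ /(_ N (leqnn N)) /=; rewrite ltr_pdivlMr// mulrC => hN.
  by exists N.
have [t tp Ht] := HN N.
have N0 : 0 < N.+1%:R :> R by rewrite ltr0n.
pose x (j : nat) : R := t + p * j%:R / N.+1%:R.
have xS j : x j.+1 - x j = p / N.+1%:R.
  by rewrite /x -natr1; field; rewrite gt_eqF.
have xlt j : x j < x j.+1 by rewrite -subr_gt0 xS divr_gt0.
have xge j : 0 <= x j.
  rewrite /x addr_ge0//; first by case/andP: tp.
  by apply: divr_ge0 => //; apply: mulr_ge0 => //; exact: ltW.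
have xle (j : nat) : (j <= N.+1)%N -> x j <= 2 * p.
  move=> jN; rewrite /x mulr2n mulrDl mul1r; apply: lerD; first by case/andP: tp.
  by rewrite ler_pdivrMr// ler_pM2l// ler_nat.
have step (j : nat) : (j < N.+1)%N ->
    p / N.+1%:R * (h (x j) - e / p) <= H (x j.+1) - H (x j).
  move=> jN; have [|xi /andP[xi1 xi2] ->] := @MVT_le R H h _ _ (ltW (xlt j)).
    by move=> y /andP[y1 y2]; apply: dH; have := xge j; lra.
  rewrite xS mulrC ler_wpM2r//; first by rewrite divr_ge0// ltW.
  have : `|h (x j) - h xi| < e / p.
    apply: Heta; first by rewrite xge; have := xle _ (ltnW jN); lra.
    rewrite distrC ger0_norm ?subr_ge0//; apply: le_lt_trans HNe.
    by rewrite -(xS j) lerD2r.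
  by rewrite ltr_norml => /andP[_]; lra.
have tel : H (t + p) - H t = \sum_(j < N.+1) (H (x j.+1) - H (x j)).
  rewrite -(big_mkord predT (fun j => H (x j.+1) - H (x j))) telescope_sumr//.
  by rewrite /x mulfK ?gt_eqF// mulr0 mul0r addr0.
have -> : H p - H 0 = H (t + p) - H t.
  rewrite -{1}[p]add0r; apply: (primitive_period (ltW p0) dH per) => //.
  by case/andP: tp => tp _; exact: lt_le_trans tp.
rewrite tel; apply: le_trans (_ : \sum_(j < N.+1) (p / N.+1%:R * (h (x j) - e / p)) + e <= _).
  rewrite -mulr_sumr big_split /= sumr_const card_ord.
  rewrite -(ler_pM2l (divr_gt0 p0 N0)) in Ht.
  have e1 : p / N.+1%:R * (c * N.+1%:R) = p * c by field; rewrite gt_eqF.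
  rewrite e1 in Ht; apply: le_trans Ht _.
  rewrite mulrDr -addrA lerDl -[- (e / p) *+ _]mulr_natl.
  have -> : p / N.+1%:R * (N.+1%:R * - (e / p)) + e = 0 by field; rewrite !gt_eqF.
  exact: lexx.
by rewrite lerD2r; apply: ler_sum => j _; apply: step.
Qed.

End MobiusAngle.

(** * Jensen's inequality and the measure of the set where w is small *)

Section SmallValues.
Variable R : realType.
Local Notation C := R[i].
Local Notation Re := (@complex.Re R).
Local Notation Im := (@complex.Im R).
Local Notation mu := (@lebesgue_measure R).
Implicit Types (w : C -> C) (a z : C) (r s t : R).

Lemma analytic_cdiff w z : analytic_on_disk w -> cmod z < 1 -> exists d, cdiff w z d.
Proof. by move=> h z1; apply/derivable_cdiff/h. Qed.

(* Jensen's inequality through the maximum principle: rotating the point by the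
   roots of unity turns the mean of [ln |w|] into the modulus of a product of
   analytic functions. *)
Lemma jensen_discrete w a r N : analytic_on_disk w -> cmod a < 1 -> 0 <= r < 1 ->
  exists2 t, 0 <= t <= 2 * pi &
    cmod (w ((r%:C)%C * a)) ^+ N.+1 <=
    \prod_(j < N.+1) cmod (w ((r%:C)%C * expi (mangle a (t + 2 * pi * j%:R / N.+1%:R)))).
Proof.
move=> hw a1 /andP[r0 r1].
(* All the factors of [P] agree at u = 0, so [P 0] is a pure power of w (r a), while on the circle
   [P] samples w at equally spaced parameters of the automorphism. *)
pose om (j : nat) : C := expi (2 * pi * j%:R / N.+1%:R).
pose mob u : C := (u + a) / (1 + a^*%C * u).
pose P u : C := \prod_(j < N.+1) w ((r%:C)%C * mob (om j * u)).
have dmob u : cmod u <= 1 -> exists d, cdiff mob u d.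
  move=> u1; have [n0 _] := mobius_le1 a1 u1.
  have d1 := cdiffD (cdiff_id u) (cdiff_cst a u).
  have d2 := cdiffD (cdiff_cst 1 u) (cdiffM (cdiff_cst a^*%C u) (cdiff_id u)).
  have d3 := cdiff_comp d2 (cdiffV n0).
  by eexists; exact: (cdiffM d1 d3).
have dP u : cmod u <= 1 -> exists d, cdiff P u d.
  move=> u1; apply: cdiff_prod => j.
  have omu : cmod (om j * u) <= 1 by rewrite cmodM cmod_expi mul1r.
  have [d1 H1] := dmob _ omu.
  have [n0 m1] := mobius_le1 a1 omu.
  have [|d2 H2] := @analytic_cdiff w ((r%:C)%C * mob (om j * u)) hw.
    rewrite cmodM cmod_real ger0_norm//; apply: le_lt_trans r1.
    by rewrite ler_piMr.
  have H3 := cdiffM (cdiff_cst (om j) u) (cdiff_id u).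
  have H4 := cdiffM (cdiff_cst (r%:C)%C u) (cdiff_comp H3 H1).
  by eexists; exact: (cdiff_comp H4 H2).
have P0 : P 0 = w ((r%:C)%C * a) ^+ N.+1.
  rewrite /P (eq_bigr (fun=> w ((r%:C)%C * a))) ?prodr_const ?card_ord//.
  by move=> j _; rewrite /mob !mulr0 add0r addr0 divr1.
(* The factor conj (P 0) makes the value at 0 equal to |P 0|^2; attaining this real part on the
   circle forces |P| >= |P 0| there. *)
have [//|u u1|t tp] := @mean_value_attained R (fun u => (P 0)^*%C * P u) 1.
  by have [d Hd] := dP u u1; eexists; exact: (cdiffM (cdiff_cst _ _) Hd).
rewrite mul1r conjcM_cmod /= => Ht; exists t => //.
have [->|nz] := eqVneq (w ((r%:C)%C * a)) 0.
  by rewrite cmod0 expr0n /= prodr_ge0// => j _; exact: cmod_ge0.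
have PE : cmod (P (expi t)) =
    \prod_(j < N.+1) cmod (w ((r%:C)%C * expi (mangle a (t + 2 * pi * j%:R / N.+1%:R)))).
  rewrite /P cmod_prod; apply: eq_bigr => j _; congr (cmod (w (_ * _))).
  by rewrite expi_mangle// /mden (addrC t) expiD.
rewrite -PE -cmodX -P0.
have P00 : 0 < cmod (P 0) by rewrite P0 cmodX exprn_gt0// cmod_gt0.
rewrite -(ler_pM2l P00) -expr2 -Ht; apply: le_trans (Re_le_cmod _) _.
by rewrite cmodM cmod_conjc.
Qed.

Lemma cmod_continuous (g : R -> C) t :
  (forall e : R, 0 < e -> \forall s \near t, cmod (g s - g t) < e) ->
  {for t, continuous (fun s => cmod (g s))}.
Proof.
move=> H; apply/cvgrPdist_lt => e /H; apply: filterS => s; apply: le_lt_trans.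
rewrite ler_norml; apply/andP; split.
  by have := cmod_subl (g s) (g t); lra.
by have := cmod_subl (g t) (g s); rewrite (cmod_distC (g t)).
Qed.

Lemma ccont_near_comp (f : C -> C) (g : R -> C) t : ccont f (g t) ->
  (forall e : R, 0 < e -> \forall s \near t, cmod (g s - g t) < e) ->
  forall e : R, 0 < e -> \forall s \near t, cmod (f (g s) - f (g t)) < e.
Proof.
move=> cf cg e /cf[d /cg + Hr]; apply: filterS => s /Hr.
by rewrite (addrC (g t)) subrK.
Qed.

Lemma polar_near r t (e : R) : 0 < e ->
  \forall s \near t, cmod ((r%:C)%C * expi s - (r%:C)%C * expi t) < e.
Proof.
move: e; apply: (@lip_near _ _ _ (`|r| * 2)); first by rewrite mulr_ge0.
move=> s; rewrite -mulrBr cmodM cmod_real -mulrA ler_wpM2l//; exact: expi_lip.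
Qed.

Lemma analytic_circle_continuous w r : analytic_on_disk w -> 0 <= r < 1 ->
  continuous (fun t => cmod (w ((r%:C)%C * expi t))).
Proof.
move=> hw /andP[r0 r1] t; apply: cmod_continuous.
apply: (@ccont_near_comp w (fun s => (r%:C)%C * expi s)); last exact: polar_near.
have [|d] := @analytic_cdiff w ((r%:C)%C * expi t) hw.
  by rewrite cmodM cmod_expi mulr1 cmod_real ger0_norm.
exact: cdiff_ccont.
Qed.

Lemma is_derive_continuous (F dF : R -> R) :
  (forall x : R, is_derive x 1 F (dF x)) -> continuous F.
Proof.
by move=> H x; have [/derivable1_diffP/differentiable_continuous] := H x; exact.
Qed.

Lemma ln_prodr (n : nat) (F : 'I_n -> R) : (forall i, 0 < F i) ->
  ln (\prod_i F i) = \sum_i ln (F i).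
Proof.
elim: n F => [|n IH] F F0; first by rewrite !big_ord0 ln1.
rewrite !big_ord_recr /= lnM ?posrE//; first by rewrite IH.
by apply: prodr_gt0.
Qed.

(** Jensen at a point off the centre is an integral of [l] along [mangle a], and its comparison with
    the integral of [k] needs only monotonicity: [K (mangle a t) - H t] is nondecreasing, because
    the coefficient of the positive part of [l] times the Poisson kernel is at least 1 and that of
    the negative part at most 1. The truncation at [del] keeps the logarithm continuous and only
    enlarges it. *)
Lemma jensen_integral w a r (del q : R) (k K : R -> R) :
  analytic_on_disk w -> cmod a <= q -> q < 1 -> 0 <= r < 1 -> 0 < del < 1 ->
  w ((r%:C)%C * a) != 0 ->
  let l s := ln (Num.max (cmod (w ((r%:C)%C * expi s))) del) in
  (forall s, k s = 4 / (1 - q ^+ 2) * Num.max (l s) 0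
                   - (1 - q) ^+ 2 * Num.max (- l s) 0) ->
  (forall s, Num.min (mangle a 0) 0 - 1 < s -> is_derive s 1 K (k s)) ->
  2 * pi * ln (cmod (w ((r%:C)%C * a))) <= K (2 * pi) - K 0.
Proof.
move=> hw aq q1 r01 /andP[d0 d1] wn0 l kE dK.
have a1 : cmod a < 1 by exact: le_lt_trans aq q1.
have q0 : 0 <= q by exact: le_trans (cmod_ge0 a) aq.
have p0 : 0 < 2 * pi :> R by rewrite mulr_gt0// pi_gt0.
have m0 s : 0 < Num.max (cmod (w ((r%:C)%C * expi s))) del by rewrite lt_max d0 orbT.
have cl : continuous l.
  have cm : continuous (fun s : R => Num.max (cmod (w ((r%:C)%C * expi s))) del).
    move=> s; apply: (@continuous_max _ _ (fun s : R => cmod (w ((r%:C)%C * expi s))) (fun=> del)).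
      exact: (@analytic_circle_continuous w r hw r01 s).
    exact: cvg_cst.
  by move=> s; exact: (continuous_comp (cm s) (continuous_ln (m0 s))).
have lper s : l (s + 2 * pi) = l s by rewrite /l expi_periodic.
have dth t := is_derive_mangle t a1.
have cth : continuous (mangle a) by apply: is_derive_continuous dth.
pose h t := l (mangle a t).
have ch : continuous h.
  by move=> t; exact: (continuous_comp (cth t) (cl _)).
have hper t : h (t + 2 * pi) = h t by rewrite /h mangle_periodic lper.
pose H := prim (-1) h.
have dH t : -1 < t -> is_derive t 1 H (h t) by exact: is_derive_prim.
have jen : 2 * pi * ln (cmod (w ((r%:C)%C * a))) <= H (2 * pi) - H 0.
  apply: riemann_sum_period ch hper dH _ => N.
  have [t tp Ht] := jensen_discrete N hw a1 r01; exists t => //.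
  have w0 : 0 < cmod (w ((r%:C)%C * a)) by rewrite cmod_gt0.
  rewrite mulr_natr -lnXn// -ln_prodr ?ler_ln ?posrE ?exprn_gt0//.
  - apply: le_trans Ht _; apply: ler_prod => j _.
    by rewrite cmod_ge0 /h le_max lexx.
  - by rewrite prodr_gt0.
apply: le_trans jen _.
(* [mangle a] advances by one full period and [k] is periodic, so the start of the period is
   immaterial; the base point of [K] lies to the left of both starts. *)
have -> : K (2 * pi) - K 0 = K (mangle a (2 * pi)) - K (mangle a 0).
  rewrite -[2 * pi]add0r mangle_periodic.
  apply: (@primitive_period R k K (Num.min (mangle a 0) 0 - 1) (2 * pi) 0 (mangle a 0)).
  - exact: ltW.
  - by move=> s; rewrite !kE lper.
  - have : Num.min (mangle a 0) 0 <= 0 by rewrite ge_min lexx orbT.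
    lra.
  - have : Num.min (mangle a 0) 0 <= mangle a 0 by rewrite ge_min lexx.
    lra.
pose Dif t := K (mangle a t) - H t.
have mono t : 0 <= t -> mangle a 0 <= mangle a t.
  move=> t0; rewrite -subr_ge0.
  have [c _ ->] := @MVT_le R (mangle a) (poisson a) 0 t t0 (fun x _ => dth x).
  rewrite subr0 mulr_ge0//; have := poisson_bounds c aq q1 => /andP[+ _].
  by apply: le_trans; rewrite divr_ge0// subr_ge0 expr_le1// ltW.
have dDif t : 0 <= t <= 2 * pi ->
    is_derive t 1 Dif (k (mangle a t) * poisson a t - h t).
  move=> /andP[t0 _].
  have lt_t : Num.min (mangle a 0) 0 - 1 < mangle a t.
    have := mono t t0.
    have : Num.min (mangle a 0) 0 <= mangle a 0 by rewrite ge_min lexx.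
    lra.
  have e1 := is_derive1_comp (dK _ lt_t) (dth t).
  have e2 := dH t (lt_le_trans (ltrN10 _) t0).
  exact: (is_deriveB e1 e2).
have [c _ Hc] := @MVT_le R Dif _ 0 (2 * pi) (ltW p0) dDif.
suff : 0 <= Dif (2 * pi) - Dif 0 by rewrite /Dif; lra.
rewrite Hc subr0; apply: mulr_ge0; last exact: ltW.
rewrite subr_ge0 /h kE.
have /andP[pl pu] := poisson_bounds c aq q1.
set ll := l _; have q2 : 0 < 1 - q ^+ 2 by rewrite subr_gt0 expr_lt1.
have q3 : 0 < (1 - q) ^+ 2 by rewrite exprn_gt0// subr_gt0.
have pl' : 1 <= 4 / (1 - q ^+ 2) * poisson a c.
  by rewrite mulrAC ler_pdivlMr// mul1r; move: pl; rewrite ler_pdivrMr// mulrC.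
have pu' : (1 - q) ^+ 2 * poisson a c <= 1.
  by move: pu; rewrite -[leRHS]div1r ler_pdivlMr// mulrC.
have E : ll = Num.max ll 0 - Num.max (- ll) 0.
  by case: (leP ll 0) => hl; [rewrite max_l ?oppr_ge0//|rewrite max_r ?oppr_le0 1?ltW//]; rewrite ?sub0r ?opprK ?subr0.
have x0 : 0 <= Num.max ll 0 by rewrite le_max lexx orbT.
have y0 : 0 <= Num.max (- ll) 0 by rewrite le_max lexx orbT.
rewrite {1}E mulrBl; apply: lerB.
  by rewrite mulrAC; rewrite ler_peMl.
by rewrite mulrAC ler_piMl.
Qed.

Lemma continuous_FTC2_co (f F : R -> R) (a b : R) : a < b -> continuous f ->
  (forall x, a <= x <= b -> is_derive x 1 F (f x)) ->
  (\int[mu]_(x in `[a, b[) (f x)%:E = (F b - F a)%:E)%E.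
Proof.
move=> ab cf dF.
rewrite integral_itv_bndo_bndc; last first.
  apply/measurable_EFinP; apply: measurable_funS (continuous_measurable_fun cf) => //.
have cF x : a <= x <= b -> {for x, continuous F}.
  by move=> /dF [/derivable1_diffP/differentiable_continuous].
rewrite (@continuous_FTC2 _ f F a b ab) ?EFinB//.
- exact: continuous_subspaceT.
- split.
  + by move=> x; rewrite in_itv /= => /andP[ax xb]; case: (dF x _) => //; rewrite !ltW.
  + by apply: cvg_at_right_filter; apply: cF; rewrite lexx ltW.
  + by apply: cvg_at_left_filter; apply: cF; rewrite lexx ltW.
- move=> x; rewrite in_itv /= => /andP[ax xb]; rewrite derive1E.
  by case: (dF x _) => //; rewrite !ltW.
Qed.

(** A Chebyshev bound for the negative part of ln |w|: Jensen at [z0] bounds its integral from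
    above, since the positive part is at most |w|^2 and so is controlled by the Hardy norm. Where
    |w| < [del] the truncated negative part equals - ln [del]. *)
Lemma small_values_measure w (z0 : C) : H2 w -> cmod z0 < 1 -> w z0 != 0 ->
  exists Cw r0 : R, [/\ 0 < Cw, 0 <= r0 < 1 & forall r del, r0 <= r < 1 -> 0 < del < 1 ->
    (mu ([set t | cmod (w ((r%:C)%C * expi t)) < del]%R `&` `[0%R, (2 * pi)%R[)
      <= (Cw / - ln del)%:E)%E].
Proof.
move=> [hw Hfin] z01 wz0.
have z00 := cmod_ge0 z0.
(* For r >= (1 + |z0|) / 2 the point [a = z0 / r] satisfies |a| <= [q] < 1, so the constants do not
   depend on r. *)
pose q := 2 * cmod z0 / (1 + cmod z0).
have q0 : 0 <= q by rewrite divr_ge0 ?mulr_ge0//; lra.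
have q1 : q < 1 by rewrite ltr_pdivrMr; lra.
pose A := 4 / (1 - q ^+ 2); pose Bc := (1 - q) ^+ 2.
have A0 : 0 < A by rewrite divr_gt0// subr_gt0 expr_lt1.
have B0 : 0 < Bc by rewrite exprn_gt0// subr_gt0.
have A0' := ltW A0; have B0' := ltW B0.
have mx (x : R) : 0 <= Num.max x 0 by rewrite le_max lexx orbT.
have p0 : 0 < 2 * pi :> R by rewrite mulr_gt0// pi_gt0.
pose Hw := fine (H2norm2 w).
have HwE r : 0 <= r < 1 -> (integral_mean2 w r <= Hw%:E)%E.
  move=> r01; have le : (integral_mean2 w r <= H2norm2 w)%E.
    by apply: ereal_sup_ubound; exists r => //=; rewrite in_itv.
  rewrite /Hw fineK// ge0_fin_numE//; apply: le_trans le.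
  rewrite mule_ge0 ?integral_ge0// ?lee_fin ?invr_ge0 ?ltW// => t _.
  by rewrite lee_fin sqr_ge0.
pose Cw := `|2 * pi * (A * Hw - ln (cmod (w z0)))| / Bc + 1.
have Cw0 : 0 < Cw by rewrite ltr_wpDl// divr_ge0// ltW.
exists Cw, ((1 + cmod z0) / 2); split=> //; first lra.
move=> r del /andP[rge r1] del01.
have r0 : 0 < r by lra.
have r01 : 0 <= r < 1 by rewrite r1 ltW.
pose a := z0 / (r%:C)%C.
have rC0 : (r%:C)%C != 0 :> C by rewrite -cmod_gt0 cmod_real gtr0_norm.
have aE : (r%:C)%C * a = z0 by rewrite /a mulrC divfK.
have aq : cmod a <= q.
  rewrite cmodM cmodV cmod_real (gtr0_norm r0) ler_pdivrMr// /q.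
  rewrite mulrAC ler_pdivlMr; last lra.
  by rewrite [leRHS]mulrAC -[leLHS]mulrC; have := ler_wpM2l z00 rge; lra.
pose g s := cmod (w ((r%:C)%C * expi s)).
pose l s := ln (Num.max (g s) del).
pose k s := A * Num.max (l s) 0 - Bc * Num.max (- l s) 0.
have [L LE] : exists L, L = - ln del by exists (- ln del).
have [d0 d1] := andP del01.
have L0 : 0 < L by rewrite LE oppr_gt0 ln_lt0.
have cg : continuous g by exact: analytic_circle_continuous.
have m0 s : 0 < Num.max (g s) del by rewrite lt_max d0 orbT.
have cl : continuous l.
  have cm : continuous (fun s : R => Num.max (g s) del).
    by move=> s; apply: (@continuous_max _ _ g (fun=> del)); [exact: cg|exact: cvg_cst].
  by move=> s; exact: (continuous_comp (cm s) (continuous_ln (m0 s))).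
have ck : continuous k.
  move=> s; apply: cvgB; apply: cvgM; try exact: cvg_cst.
    by apply: (@continuous_max _ _ l (fun=> 0)); [exact: cl|exact: cvg_cst].
  apply: (@continuous_max _ _ (fun s => - l s) (fun=> 0)); last exact: cvg_cst.
  by apply: cvgN; exact: cl.
pose b := Num.min (mangle a 0) 0 - 1.
pose K := prim b k.
have dK s : b < s -> is_derive s 1 K (k s) by exact: is_derive_prim.
have jen : 2 * pi * ln (cmod (w z0)) <= K (2 * pi) - K 0.
  rewrite -aE; apply: (@jensen_integral w a r del q k K hw aq q1 r01 del01) => //.
  by rewrite aE.
have b0 : b < 0.
  by rewrite /b; have : Num.min (mangle a 0) 0 <= 0 by [rewrite ge_min lexx orbT|]; lra.
set B := (_ `&` _).
have mB : measurable B.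
  apply: measurableI => //.
  have -> : [set t | cmod (w ((r%:C)%C * expi t)) < del] = g @^-1` [set x | x < del] by [].
  by apply: open_measurable; apply: open_comp => // x _; exact: cg.
have lge s : - L <= l s.
  by rewrite LE opprK ler_ln ?posrE// le_max lexx orbT.
have BL0 : 0 <= Bc * L by rewrite mulr_ge0// ltW.
have kge s : 0 <= k s + Bc * L.
  rewrite /k -addrA addr_ge0//; first by rewrite mulr_ge0.
  rewrite addrC -mulrBr mulr_ge0// subr_ge0 ge_max (ltW L0) andbT.
  by rewrite lerNl.
(* The shift by [Bc * L] makes every term nonnegative. On the bad set [k s = - Bc * L]; elsewhere
   [k] is at most [A] times the positive part of ln g, hence at most [A * g ^+ 2]. *)
have pt s : (k s + Bc * L) + Bc * L * \1_[set t | g t < del] s <= A * g s ^+ 2 + Bc * L.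
  rewrite indicE; have [gd|gd] := ltP (g s) del.
    rewrite mem_set// mulr1.
    have lE : l s = - L by rewrite /l max_r ?LE ?opprK// ltW.
    have -> : k s + Bc * L = 0.
      rewrite /k lE opprK (max_l (ltW L0)) max_r ?oppr_le0 ?ltW//.
      by rewrite mulr0 add0r addNr.
    by rewrite add0r lerDr mulr_ge0 ?sqr_ge0.
  rewrite memNset; last by move=> /=; apply/negP; rewrite -leNgt.
  rewrite mulr0 addr0 lerD2r /k; apply: le_trans (_ : A * Num.max (l s) 0 <= _).
    by rewrite gerBl mulr_ge0.
  rewrite ler_pM2l// ge_max sqr_ge0 andbT /l max_l//.
  have g0 : 0 < g s by exact: lt_le_trans gd.
  have [g1|g1] := leP (g s) 1; first by apply: le_trans (ln_le0 g1) _; rewrite sqr_ge0.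
  apply: le_trans (ltW (ln_sublinear g0)) _.
  by rewrite expr2 ler_peMl// ltW.
pose D : set R := `[0%R, (2 * pi)%R[%classic.
have mD : measurable D by exact: measurable_itv.
have muD : mu D = (2 * pi)%:E by rewrite /D lebesgue_measure_itv /= lte_fin p0 -EFinD subr0.
have i1 : (\int[mu]_(s in D) (k s + Bc * L)%:E = (K (2 * pi) - K 0 + 2 * pi * (Bc * L))%:E)%E.
  have ckB : continuous (fun s : R => k s + Bc * L).
    by move=> s; apply: cvgD; [exact: ck|exact: cvg_cst].
  have dKB (s : R) : 0 <= s <= 2 * pi ->
      is_derive s 1 (fun s : R => K s + (Bc * L) * s) (k s + Bc * L).
    move=> /andP[s0 _]; have h := dK s (lt_le_trans b0 s0).
    by apply: is_derive_eq; rewrite /GRing.scale /= mulr1.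
  by rewrite /D (continuous_FTC2_co p0 ckB dKB) mulr0 addr0; congr (_%:E); ring.
have mk : measurable_fun D (fun s => (k s + Bc * L)%:E).
  apply/measurable_EFinP; apply: measurable_funS (_ : measurable_fun setT _) => //.
  by apply: continuous_measurable_fun => s; apply: cvgD; [exact: ck|exact: cvg_cst].
have mg2 : measurable_fun D (fun s => (g s ^+ 2)%:E).
  apply/measurable_EFinP; apply: measurable_funS (_ : measurable_fun setT _) => //.
  by apply: continuous_measurable_fun => s; apply: cvgM; exact: cg.
have mE : measurable [set t | g t < del].
  have -> : [set t | g t < del] = g @^-1` [set x | x < del] by [].
  by apply: open_measurable; apply: open_comp => // x _; exact: cg.
have mi : measurable_fun D (fun s => ((Bc * L) * \1_[set t | g t < del] s)%:E).
  by apply/measurable_EFinP; apply: measurable_funM.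
have i2 : (\int[mu]_(s in D) ((Bc * L) * \1_[set t | g t < del] s)%:E = (Bc * L)%:E * mu B)%E.
  under eq_integral do rewrite EFinM.
  rewrite ge0_integralZl_EFin// ?integral_indic//.
  apply/measurable_EFinP.
  by apply: measurable_funS (_ : measurable_fun setT _) => //; exact: measurable_indic.
have i3 : (\int[mu]_(s in D) (A * g s ^+ 2 + Bc * L)%:E <=
    (A * (2 * pi * Hw) + 2 * pi * (Bc * L))%:E)%E.
  under eq_integral do rewrite EFinD.
  rewrite ge0_integralD//=; last 2 first.
  - by move=> s _; rewrite lee_fin mulr_ge0 ?sqr_ge0.
  - by apply/measurable_EFinP; apply: measurable_funM => //; apply/measurable_EFinP.
  have -> : (\int[mu]_(_ in D) (Bc * L)%:E = (2 * pi * (Bc * L))%:E)%E.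
    apply: (etrans (integral_cst mu mD (Bc * L)%:E)).
    by rewrite [RHS]EFinM [RHS]muleC; exact: (f_equal (fun x => (Bc * L)%:E * x)%E muD).
  rewrite EFinD leeD//.
  under eq_integral do rewrite EFinM.
  rewrite ge0_integralZl_EFin//; last by move=> s _; rewrite lee_fin sqr_ge0.
  rewrite [leRHS]EFinM lee_wpmul2l// ?lee_fin//.
  have := HwE r r01; rewrite /integral_mean2 -/D.
  rewrite lee_pdivrMr// -EFinM mulrC; exact.
have main : ((K (2 * pi) - K 0 + 2 * pi * (Bc * L))%:E + (Bc * L)%:E * mu B <=
   (A * (2 * pi * Hw) + 2 * pi * (Bc * L))%:E)%E.
  apply: le_trans i3; rewrite -i1 -i2 -ge0_integralD//=.
  - apply: ge0_le_integral => //=.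
    + by move=> s _; rewrite adde_ge0// lee_fin// mulr_ge0.
    + exact: emeasurable_funD.
    + apply/measurable_EFinP; apply: measurable_funD => //.
      by apply: measurable_funM => //; apply/measurable_EFinP.
    + by move=> s _; rewrite -EFinD lee_fin; exact: pt.
  - by move=> s _; rewrite lee_fin.
  - by move=> s _; rewrite lee_fin mulr_ge0.
have muBfin : (mu B \is a fin_num).
  rewrite ge0_fin_numE//; apply: le_lt_trans (_ : (mu D < +oo)%E); last by rewrite muD ltry.
  by apply: le_measure; rewrite ?inE//; exact: subIsetr.
move: main; rewrite -(fineK muBfin); set mb := fine _ => main.
have {}main : Bc * L * mb <= 2 * pi * (A * Hw - ln (cmod (w z0))).
  by move: main; rewrite -EFinM -EFinD !lee_fin; lra.
rewrite lee_fin -LE ler_pdivlMr// /Cw.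
apply: le_trans (_ : `|2 * pi * (A * Hw - ln (cmod (w z0)))| / Bc <= _); last by rewrite lerDl.
rewrite ler_pdivlMr//; apply: le_trans (ler_norm _); apply: le_trans main.
by rewrite le_eqVlt; apply/orP; left; apply/eqP; ring.
Qed.

End SmallValues.

(** * Estimates for the square-root branch *)

Section QuarterPlaneRoot.
Variable R : realType.
Local Notation C := R[i].
Local Notation Re := (@complex.Re R).
Local Notation Im := (@complex.Im R).
Implicit Types (s u v h : C).

(* The branch of [sqrt (i s)] mapping the closed right half-plane to the closed
   first quadrant: on the imaginary axis its real part vanishes for [Im s >= 0]. *)
Definition qroot s : C :=
  (Num.sqrt ((cmod s - Im s) / 2) +i* Num.sqrt ((cmod s + Im s) / 2))%C.

Lemma qroot_Re_ge0 s : 0 <= Re (qroot s). Proof. exact: sqrtr_ge0. Qed.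
Lemma qroot_Im_ge0 s : 0 <= Im (qroot s). Proof. exact: sqrtr_ge0. Qed.

Lemma Im_bounds s : - cmod s <= Im s <= cmod s.
Proof. by rewrite -ler_norml ler_Im_cmod. Qed.

Lemma qroot_sqr s : 0 <= Re s -> qroot s ^+ 2 = ('i * s)%C.
Proof.
move=> s0; have /andP[l1 l2] := Im_bounds s.
have a0 : 0 <= (cmod s - Im s) / 2 by rewrite divr_ge0// subr_ge0.
have b0 : 0 <= (cmod s + Im s) / 2 by rewrite divr_ge0//; lra.
apply: complex_eqP; rewrite expr2 ?ReM ?ImM /=.
  by rewrite -!expr2 !sqr_sqrtr//; case: s {s0 l1 l2 a0 b0} => x y /=; lra.
rewrite (mulrC (Num.sqrt ((cmod s + _) / 2))) -sqrtrM//.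
have -> : (cmod s + Im s) / 2 * ((cmod s - Im s) / 2) = (Re s / 2) ^+ 2.
  have -> : (cmod s + Im s) / 2 * ((cmod s - Im s) / 2) = (cmod s ^+ 2 - Im s ^+ 2) / 4.
    by field.
  by rewrite cmod_sqr; field.
rewrite sqrtr_sqr ger0_norm ?divr_ge0//; case: s {s0 l1 l2 a0 b0} => x y /=; lra.
Qed.

Lemma cmod_i : cmod ('i%C : C) = 1.
Proof. by rewrite /cmod /= expr0n add0r expr1n sqrtr1. Qed.

Lemma cmod_qroot_sqr s : 0 <= Re s -> cmod (qroot s) ^+ 2 = cmod s.
Proof. by move=> s0; rewrite -cmodX qroot_sqr// cmodM cmod_i mul1r. Qed.

Definition quadrant u := (0 <= Re u) && (0 <= Im u).

(** Vectors of one quadrant form an angle of at most pi / 2, so sums do not cancel. Together with (a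
    - b)(a + b) = i (s - u) for the roots a and b, this gives all the regularity of [qroot]. *)
Lemma quadrant_cmodD u v : quadrant u -> quadrant v ->
  cmod u <= cmod (u + v) /\ cmod (u - v) <= cmod (u + v).
Proof.
move=> /andP[u1 u2] /andP[v1 v2].
split; rewrite -(@ler_pXn2r _ 2) ?nnegrE ?cmod_ge0// !cmod_sqr !(ReD, ImD, ReN, ImN).
  by apply: lerD; rewrite ler_pXn2r ?nnegrE ?addr_ge0// lerDl.
rewrite -subr_ge0.
have -> : (Re u + Re v) ^+ 2 + (Im u + Im v) ^+ 2 -
   ((Re u - Re v) ^+ 2 + (Im u - Im v) ^+ 2) = 4 * (Re u * Re v + Im u * Im v) by ring.
by rewrite mulr_ge0// addr_ge0// mulr_ge0.
Qed.

Lemma qroot_quadrant s : quadrant (qroot s).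
Proof. by rewrite /quadrant qroot_Re_ge0 qroot_Im_ge0. Qed.

Lemma qroot_diff s u : 0 <= Re s -> 0 <= Re u ->
  (qroot s - qroot u) * (qroot s + qroot u) = ('i * (s - u))%C.
Proof.
by move=> s0 u0; rewrite -subr_sqr !qroot_sqr// mulrBr.
Qed.

Lemma qroot_holder s u : 0 <= Re s -> 0 <= Re u ->
  cmod (qroot s - qroot u) <= Num.sqrt (cmod (s - u)).
Proof.
move=> s0 u0; rewrite -(@ler_pXn2r _ 2) ?nnegrE ?sqrtr_ge0 ?cmod_ge0//.
have -> : Num.sqrt (cmod (s - u)) ^+ 2 = cmod (s - u) by rewrite sqr_sqrtr ?cmod_ge0.
have -> : cmod (s - u) = cmod ((qroot s - qroot u) * (qroot s + qroot u)).
  by rewrite qroot_diff// cmodM cmod_i mul1r.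
rewrite cmodM expr2 ler_wpM2l ?cmod_ge0//.
exact: (quadrant_cmodD (qroot_quadrant s) (qroot_quadrant u)).2.
Qed.

Lemma qroot_lip s u (c : R) : 0 <= Re s -> 0 <= Re u -> 0 < c -> c ^+ 2 <= cmod u ->
  cmod (qroot s - qroot u) <= cmod (s - u) / c.
Proof.
move=> s0 u0 c0 cu.
have cq : c <= cmod (qroot u).
  by rewrite -(@ler_pXn2r _ 2) ?nnegrE ?cmod_ge0 ?(ltW c0)// cmod_qroot_sqr.
rewrite ler_pdivlMr//.
have -> : cmod (s - u) = cmod (qroot s - qroot u) * cmod (qroot s + qroot u).
  by rewrite -cmodM qroot_diff// cmodM cmod_i mul1r.
rewrite ler_wpM2l ?cmod_ge0//; apply: le_trans cq _; rewrite addrC.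
exact: (quadrant_cmodD (qroot_quadrant u) (qroot_quadrant s)).1.
Qed.

(** The remainder depends on [s] only through its real part, so one bound serves all the vertical
    translates of [s]. *)
Lemma qroot_taylor s u : 0 < Re s -> 0 <= Re u ->
  cmod (qroot u - qroot s - 'i%C / (2 * qroot s) * (u - s)) <=
  cmod (u - s) * Num.sqrt (cmod (u - s)) / (2 * Re s).
Proof.
move=> s0 u0; have s0' := ltW s0.
have c0 : 0 < cmod s by apply: lt_le_trans (Re_le_cmod s).
have q0 : 0 < cmod (qroot s).
  by rewrite -(@ltr_pXn2r _ 2) ?nnegrE ?cmod_ge0// expr0n /= cmod_qroot_sqr.
have q0' : qroot s != 0 by rewrite -cmod_gt0.
have [h1 h2] := quadrant_cmodD (qroot_quadrant s) (qroot_quadrant u).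
have sum0 : 0 < cmod (qroot s + qroot u) by exact: lt_le_trans h1.
have sum0' : qroot u + qroot s != 0 by rewrite addrC -cmod_gt0.
have dE : 'i%C * (u - s) = (qroot u - qroot s) * (qroot u + qroot s) by rewrite qroot_diff.
have -> : qroot u - qroot s - 'i%C / (2 * qroot s) * (u - s) =
   - ('i%C * (u - s)) * (qroot u - qroot s) / ((qroot u + qroot s) * (2 * qroot s)).
  rewrite mulrAC dE; field.
  by rewrite q0' sum0'.
rewrite !cmodM cmodN cmodV cmodM cmod_i mul1r !cmodM.
have -> : cmod (2 : C) = 2.
  have -> : (2 : C) = ((2 : R)%:C)%C by rewrite rmorph_nat.
  by rewrite cmod_real ger0_norm.
apply: ler_pM.
- by rewrite mulr_ge0 ?cmod_ge0.
- by rewrite invr_ge0 !mulr_ge0 ?cmod_ge0.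
- by rewrite ler_wpM2l ?cmod_ge0// qroot_holder.
rewrite lef_pV2 ?posrE ?mulr_gt0//; last by rewrite addrC.
rewrite mulrCA ler_pM2l//; apply: le_trans (_ : cmod (qroot s) ^+ 2 <= _).
  by rewrite cmod_qroot_sqr// Re_le_cmod.
by rewrite expr2 ler_pM2r// addrC.
Qed.

Lemma qroot_Re_gt0 (y : R) : y < 0 -> 0 < Re (qroot (0 +i* y)%C).
Proof.
move=> y0; rewrite /= /cmod /= expr0n add0r sqrtr_sqr ltr0_norm// sqrtr_gt0; lra.
Qed.

Lemma qroot_Re_eq0 (y : R) : 0 <= y -> Re (qroot (0 +i* y)%C) = 0.
Proof.
move=> y0; rewrite /= /cmod /= expr0n add0r sqrtr_sqr ger0_norm//.
by rewrite subrr mul0r sqrtr0.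
Qed.

Lemma qroot_Im_mono (x y : R) : x <= y ->
  Im (qroot (0 +i* x)%C) <= Im (qroot (0 +i* y)%C).
Proof.
move=> xy; rewrite /= /cmod /= expr0n !add0r !sqrtr_sqr.
apply: ler_wsqrtr; rewrite ler_pM2r ?invr_gt0//.
by have := ler_normD (x - y) y; rewrite subrK (distrC x) (ger0_norm (_ : 0 <= y - x)) ?subr_ge0//; lra.
Qed.

End QuarterPlaneRoot.

(** * Series dominated by a geometric one *)

Section DominatedSeries.
Variable R : realType.
Local Notation C := R[i].
Local Notation Re := (@complex.Re R).
Local Notation Im := (@complex.Im R).
Implicit Types (u v : nat -> C) (x y : nat -> R) (K : R).

Definition half n : R := (2 ^+ n)^-1.

Lemma halfE n : half n = (2 ^+ n)^-1. Proof. by []. Qed.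

Lemma half_gt0 n : 0 < half n. Proof. by rewrite invr_gt0 exprn_gt0. Qed.

Lemma half_ge0 n : 0 <= half n. Proof. exact: ltW (half_gt0 n). Qed.

Lemma halfS n : half n.+1 = half n / 2.
Proof. by rewrite /half exprS; field; rewrite expf_neq0. Qed.

Lemma sum_half_le n : \sum_(0 <= k < n) half k <= 2.
Proof.
suff -> : \sum_(0 <= k < n) half k = 2 - 2 * half n.
  by have := half_gt0 n; lra.
elim: n => [|n IH]; first by rewrite big_nil /half expr0 invr1; lra.
by rewrite big_nat_recr//= IH halfS; lra.
Qed.

Definition rdom x K := forall k, `|x k| <= K * half k.

Lemma rdom_ge0 x K : rdom x K -> 0 <= K.
Proof.
move=> /(_ 0%N); rewrite /half expr0 invr1 mulr1; exact: le_trans.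
Qed.

Lemma rdom_cvg x K : rdom x K -> cvgn (series x).
Proof.
move=> d; have K0 := rdom_ge0 d; apply: normed_cvg; apply: nondecreasing_is_cvgn.
  by apply: nondecreasing_series => n _ _; exact: normr_ge0.
exists (K * 2) => _ [n _ <-]; rewrite /series /=.
apply: le_trans (_ : \sum_(0 <= k < n) K * half k <= _); first exact: ler_sum.
by rewrite -mulr_sumr ler_wpM2l// sum_half_le.
Qed.

Definition rsum x : R := limn (series x).

Lemma rdom_bound x K : rdom x K -> `|rsum x| <= 2 * K.
Proof.
move=> d; have K0 := rdom_ge0 d; have c := rdom_cvg d.
have pb n : `|series x n| <= 2 * K.
  rewrite /series /=; apply: le_trans (ler_norm_sum _ _ _) _.
  apply: le_trans (_ : \sum_(0 <= k < n) K * half k <= _); first exact: ler_sum.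
  by rewrite -mulr_sumr mulrC ler_wpM2r// sum_half_le.
rewrite ler_norml; apply/andP; split.
  apply: limr_ge => //; apply: nearW => n.
  by have := pb n; rewrite ler_norml => /andP[].
apply: limr_le => //; apply: nearW => n.
by have := pb n; rewrite ler_norml => /andP[].
Qed.

Lemma rsumD x y K K' : rdom x K -> rdom y K' ->
  rsum (fun k => x k + y k) = rsum x + rsum y.
Proof.
move=> /rdom_cvg cx /rdom_cvg cy; rewrite /rsum.
rewrite -(limD cx cy); congr (limn _); apply/funext => n.
by rewrite /series /= big_split.
Qed.

Lemma rsumZ x K c : rdom x K -> rsum (fun k => c * x k) = c * rsum x.
Proof.
move=> /rdom_cvg cx; apply: etrans (limZr c cx); congr (limn _); apply/funext => n.
by rewrite /series /= -mulr_sumr.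
Qed.

Lemma rsum_ge_term x K n : rdom x K -> (forall k, 0 <= x k) -> x n <= rsum x.
Proof.
move=> /rdom_cvg cx x0; apply: le_trans (_ : series x n.+1 <= _).
  by rewrite /series /= big_nat_recr//= lerDr sumr_ge0.
by apply: nondecreasing_cvgn_le => //; apply: nondecreasing_series => m _ _.
Qed.

Definition cdom u K := forall k, cmod (u k) <= K * half k.

Lemma cdomRe u K : cdom u K -> rdom (fun k => Re (u k)) K.
Proof. by move=> d k; apply: le_trans (ler_Re_cmod _) (d k). Qed.

Lemma cdomIm u K : cdom u K -> rdom (fun k => Im (u k)) K.
Proof. by move=> d k; apply: le_trans (ler_Im_cmod _) (d k). Qed.

(** Summing by components uses real limits only, at the price of a factor 2 in [csum_bound]. *)
Definition csum u : C := (rsum (fun k => Re (u k)) +i* rsum (fun k => Im (u k)))%C.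

Lemma csum_bound u K : cdom u K -> cmod (csum u) <= 4 * K.
Proof.
move=> d; apply: le_trans (cmod_le_ReIm _) _; rewrite /=.
by have := rdom_bound (cdomRe d); have := rdom_bound (cdomIm d); lra.
Qed.

Lemma csumD u v K K' : cdom u K -> cdom v K' ->
  csum (fun k => u k + v k) = csum u + csum v.
Proof.
move=> du dv; apply: complex_eqP => /=.
  rewrite -(rsumD (cdomRe du) (cdomRe dv)); congr (rsum _); apply/funext => k.
  by rewrite ReD.
rewrite -(rsumD (cdomIm du) (cdomIm dv)); congr (rsum _); apply/funext => k.
by rewrite ImD.
Qed.

Lemma csumZ u K c : cdom u K -> csum (fun k => c * u k) = c * csum u.
Proof.
move=> du; have dR := cdomRe du; have dI := cdomIm du.
have hZ x K' e : rdom x K' -> rdom (fun k => e * x k) (`|e| * K').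
  by move=> dx k; rewrite normrM -mulrA ler_wpM2l.
apply: complex_eqP => /=.
  rewrite ReM /= -(rsumZ (Re c) dR) -mulNr -(rsumZ (- Im c) dI).
  rewrite -(rsumD (hZ _ _ (Re c) dR) (hZ _ _ (- Im c) dI)).
  by congr (rsum _); apply/funext => k; rewrite ReM mulNr.
rewrite ImM /= -(rsumZ (Re c) dI) -(rsumZ (Im c) dR).
rewrite -(rsumD (hZ _ _ (Re c) dI) (hZ _ _ (Im c) dR)).
by congr (rsum _); apply/funext => k; rewrite ImM.
Qed.

Lemma csumB u v K K' : cdom u K -> cdom v K' ->
  csum (fun k => u k - v k) = csum u - csum v.
Proof.
move=> du dv.
have dv' : cdom (fun k => -1 * v k) K' by move=> k; rewrite mulN1r cmodN.
rewrite -mulN1r -(csumZ (-1) dv) -(csumD du dv'); congr (csum _).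
by apply/funext => k; rewrite mulN1r.
Qed.

End DominatedSeries.

(** * The map of the half-plane, the symbol and its radial limits *)

Section Symbol.
Variable R : realType.
Local Notation C := R[i].
Local Notation Re := (@complex.Re R).
Local Notation Im := (@complex.Im R).
Local Notation half := (@half R).
Implicit Types (s u z h : C) (k K : nat) (x y t : R).

Definition eps k : R := half (k ^ 4).

Lemma eps_gt0 k : 0 < eps k. Proof. exact: half_gt0. Qed.

Lemma eps_ge0 k : 0 <= eps k. Proof. exact: half_ge0. Qed.

Lemma half_le m n : (m <= n)%N -> half n <= half m.
Proof. by move=> mn; rewrite lef_pV2 ?posrE ?exprn_gt0// ler_weXn2l// ler1n. Qed.

Lemma halfD m n : half (m + n) = half m * half n.
Proof. by rewrite !halfE exprD invfM. Qed.

Lemma half_mul_le n : n.+1%:R * half n <= 1.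
Proof.
rewrite !halfE ler_pdivrMr ?exprn_gt0// mul1r -natrX ler_nat.
exact: ltn_expl.
Qed.

(** The factor k + 1 pays for the growth of the translate s - i k inside the k-th root. *)
Lemma eps_moment k : eps k * k.+1%:R <= 2 * half k.
Proof.
case: k => [|[|k]].
- by rewrite /eps !halfE expr0 invr1 !mul1r mulr1; lra.
- by rewrite /eps !halfE expr1; lra.
set n := k.+2; apply: le_trans (_ : half (n + n) * n.+1%:R <= _).
  rewrite ler_wpM2r// half_le// !expnS expn0 muln1.
  by rewrite /n; nia.
rewrite halfD mulrAC -mulrA; apply: le_trans (_ : 1 * half n <= _).
  by rewrite mulrA (mulrC (half n)) ler_wpM2r ?half_ge0// half_mul_le.
by have := half_gt0 R n; lra.
Qed.

Lemma eps_half k : eps k <= 2 * half k.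
Proof.
apply: le_trans (eps_moment k); by rewrite ler_peMr ?eps_ge0// ler1n.
Qed.

(** For k > K >= 1 one has k^4 >= K^4 + 2 k; one of the two factors 2^(-k) absorbs k + 1 and the
    other one keeps the series summable. *)
Lemma eps_tail K k : (0 < K)%N -> (K < k)%N -> eps k * k.+1%:R <= half (K ^ 4) * half k.
Proof.
move=> K0 Kk; apply: le_trans (_ : half (K ^ 4 + k + k) * k.+1%:R <= _).
  rewrite ler_wpM2r// half_le// !expnS !expn0 !muln1.
  have h1 : (K * (K * (K * K)) <= (k - 1) * (k * (k * k)))%N.
    by do 3!(apply: leq_mul; first by lia); lia.
  by nia.
rewrite 2!halfD -mulrA -!mulrA; rewrite !ler_pM2l ?half_gt0//.
by rewrite -[leRHS]mulr1 ler_pM2l ?half_gt0// mulrC half_mul_le.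
Qed.

Definition shift_i s k : C := s - (0 +i* k%:R)%C.

Lemma Re_shift_i s k : Re (shift_i s k) = Re s.
Proof. by rewrite ReD ReN /= subr0. Qed.

Definition term s k : C := ((eps k)%:C)%C * qroot (shift_i s k).

Lemma cmod_eps k : cmod ((eps k)%:C)%C = eps k.
Proof. by rewrite cmod_real ger0_norm// ltW// eps_gt0. Qed.

Lemma cmod_shift_i s k : cmod (shift_i s k) <= cmod s + k%:R.
Proof.
apply: le_trans (cmodB _ _) _; rewrite lerD2l /cmod /= expr0n add0r sqrtr_sqr.
by rewrite ger0_norm.
Qed.

Lemma cdom_term s : 0 <= Re s -> cdom (term s) (2 * (cmod s + 1)).
Proof.
move=> s0 k; rewrite cmodM cmod_eps.
have s0' := cmod_ge0 s.
have h : cmod (qroot (shift_i s k)) <= (cmod s + 1) * k.+1%:R.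
  have h1 : cmod (qroot (shift_i s k)) ^+ 2 <= cmod s + k%:R.
    by rewrite cmod_qroot_sqr ?Re_shift_i// cmod_shift_i.
  have h2 : cmod s + k%:R <= (cmod s + 1) * k.+1%:R.
    by rewrite -natr1 mulrDl mul1r mulrDr mulr1; have := mulr_ge0 s0' (ler0n R k); lra.
  have h3 : 1 <= (cmod s + 1) * k.+1%:R.
    by rewrite -natr1 mulrDl mul1r mulrDr mulr1; have := mulr_ge0 s0' (ler0n R k); have := ler0n R k; lra.
  rewrite -(@ler_pXn2r _ 2) ?nnegrE ?cmod_ge0//; last by lra.
  apply: le_trans h1 _; apply: le_trans h2 _.
  by rewrite expr2 ler_peMl//; lra.
apply: le_trans (_ : (cmod s + 1) * (eps k * k.+1%:R) <= _).
  by rewrite mulrCA ler_pM2l ?eps_gt0.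
have c0 : 0 <= cmod s + 1 by lra.
by apply: le_trans (ler_wpM2l c0 (eps_moment k)) _; rewrite mulrCA mulrA.
Qed.

(* [Re (gmap s) = Re s + small]: [gmap] maps the right half-plane into itself and
   the upper imaginary axis extremely close to itself near infinity, without
   ever touching it. *)
Definition gmap s : C := s + csum (term s).

Lemma term_Re_ge0 s k : 0 <= Re (term s k).
Proof. by rewrite ReM /= mul0r subr0 mulr_ge0 ?sqrtr_ge0// ltW// eps_gt0. Qed.

Lemma term_Im s k : Im (term s k) = eps k * Im (qroot (shift_i s k)).
Proof. by rewrite ImM /= mul0r addr0. Qed.

Lemma term_Re s k : Re (term s k) = eps k * Re (qroot (shift_i s k)).
Proof. by rewrite ReM /= mul0r subr0. Qed.

Lemma gmap_Re_ge s k : 0 <= Re s -> Re s + Re (term s k) <= Re (gmap s).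
Proof.
move=> s0; rewrite ReD lerD2l /=.
by apply: (rsum_ge_term k (cdomRe (cdom_term s0))) => n; exact: term_Re_ge0.
Qed.

Lemma gmap_Re_gt0 s : 0 <= Re s -> 0 < Re (gmap s).
Proof.
rewrite le_eqVlt => /predU1P[s0|s0]; last first.
  by apply: lt_le_trans (gmap_Re_ge 0 (ltW s0)); rewrite ltr_pwDl// term_Re_ge0.
pose k := `|Num.ceil (Im s)|%N.+1.
have kIm : Im s < k%:R.
  rewrite /k -natr1; apply: le_lt_trans (_ : `|Num.ceil (Im s)|%:R < _); last by rewrite ltrDl.
  apply: le_trans (ceil_ge _) _; rewrite -[leRHS]/((Posz `|Num.ceil (Im s)|%N)%:~R).
  by rewrite ler_int lez_abs.
have s0' : 0 <= Re s by rewrite -s0.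
apply: lt_le_trans (gmap_Re_ge k s0'); rewrite -s0 add0r term_Re mulr_gt0 ?eps_gt0//.
have -> : shift_i s k = (0 +i* (Im s - k%:R))%C.
  by apply: complex_eqP; rewrite ?Re_shift_i// /shift_i ImD ImN.
by apply: qroot_Re_gt0; lra.
Qed.

Lemma gmap_diff s u : 0 <= Re s -> 0 <= Re u ->
  gmap s - gmap u = (s - u) + csum (fun k => term s k - term u k).
Proof.
by move=> s0 u0; rewrite (csumB (cdom_term s0) (cdom_term u0)) /gmap; ring.
Qed.

Lemma termB s u k : term s k - term u k =
  ((eps k)%:C)%C * (qroot (shift_i s k) - qroot (shift_i u k)).
Proof. by rewrite mulrBr. Qed.

Lemma shift_iB s u k : shift_i s k - shift_i u k = s - u.
Proof. by rewrite /shift_i; ring. Qed.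

(** Continuity up to the imaginary axis, where the branch points i k lie; the radial limits of the
    symbol are read off there. *)
Lemma gmap_holder s u : 0 <= Re s -> 0 <= Re u ->
  cmod (gmap s - gmap u) <= cmod (s - u) + 8 * Num.sqrt (cmod (s - u)).
Proof.
move=> s0 u0; rewrite gmap_diff//; apply: le_trans (cmodD _ _) _; rewrite lerD2l.
apply: le_trans (_ : 4 * (2 * Num.sqrt (cmod (s - u))) <= _); last by lra.
apply: csum_bound => k; rewrite termB cmodM cmod_eps.
rewrite mulrAC; apply: ler_pM; rewrite ?cmod_ge0 ?eps_ge0 ?eps_half//.
by rewrite -(shift_iB s u k) qroot_holder ?Re_shift_i.
Qed.

(** Termwise differentiation is legitimate because the remainder in [qroot_taylor] is the same for
    all the translates. *)
Lemma gmap_cdiff s : 0 < Re s -> exists d, cdiff gmap s d.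
Proof.
move=> s0; have s0' := ltW s0.
pose D k : C := ((eps k)%:C)%C * ('i%C / (2 * qroot (shift_i s k))).
pose sg := Re s.
have qlow k : sg <= cmod (qroot (shift_i s k)) ^+ 2.
  by rewrite /sg -(Re_shift_i s k) cmod_qroot_sqr ?Re_le_cmod// Re_shift_i.
have q0 k : 0 < cmod (qroot (shift_i s k)).
  have := lt_le_trans s0 (qlow k); rewrite lt_def exprn_ge0 ?cmod_ge0// andbT.
  by rewrite sqrf_eq0 lt_def cmod_ge0 andbT.
have c2 : cmod (2 : C) = 2.
  have -> : (2 : C) = ((2 : R)%:C)%C by rewrite rmorph_nat.
  by rewrite cmod_real ger0_norm.
pose M := (sg + 1) / sg.
have M0 : 0 < M by rewrite divr_gt0//; rewrite /sg; lra.
have dD : cdom D (2 * M).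
  move=> k; rewrite cmodM cmod_eps cmodM cmod_i mul1r cmodV cmodM c2.
  rewrite mulrAC; apply: ler_pM; rewrite ?invr_ge0 ?mulr_ge0 ?cmod_ge0 ?eps_ge0 ?eps_half//.
  rewrite -[leLHS]div1r ler_pdivrMr ?mulr_gt0// /M mulrAC ler_pdivlMr// mul1r.
  set Q := cmod _; have Q0 : 0 < Q by exact: q0.
  have : sg <= Q ^+ 2 by exact: qlow.
  have [Q1|Q1] := leP 1 Q; rewrite expr2 => hQ; rewrite /sg in hQ *; nra.
exists (1 + csum D) => e e0.
(* The first bound keeps s + h in the half-plane; the second one gives 4 sqrt |h| / sg <= e, where 4
   comes from [csum_bound]. *)
pose r := Num.min (sg / 2) ((e * sg / 4) ^+ 2).
have r0 : 0 < r by rewrite lt_min exprn_gt0 ?andbT ?divr_gt0// ?mulr_gt0.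
exists r => // h hr.
have hsg : cmod h < sg / 2 by apply: lt_le_trans hr _; rewrite ge_min lexx.
have he : Num.sqrt (cmod h) <= e * sg / 4.
  have : cmod h <= (e * sg / 4) ^+ 2.
    by apply: ltW; apply: lt_le_trans hr _; rewrite ge_min lexx orbT.
  move=> /ler_wsqrtr; rewrite sqrtr_sqr ger0_norm//.
  by rewrite divr_ge0// mulr_ge0// ltW.
have sh0 : 0 <= Re (s + h).
  rewrite ReD; have := ler_Re_cmod h; rewrite ler_norml => /andP[+ _].
  by rewrite -/sg; lra.
have dDh : cdom (fun k => h * D k) (cmod h * (2 * M)).
  by move=> k; rewrite cmodM -mulrA ler_wpM2l ?cmod_ge0// dD.
have dT : cdom (fun k => term (s + h) k - term s k)
    (2 * (cmod (s + h) + 1) + 2 * (cmod s + 1)).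
  move=> k; apply: le_trans (cmodB _ _) _; rewrite mulrDl.
  by apply: lerD; [exact: (cdom_term sh0)|exact: (cdom_term s0')].
have -> : gmap (s + h) - gmap s - (1 + csum D) * h =
    csum (fun k => (term (s + h) k - term s k) - h * D k).
  rewrite (csumB dT dDh) (csumZ _ dD) gmap_diff//; ring.
apply: le_trans (_ : 4 * (cmod h * Num.sqrt (cmod h) / sg) <= _); last first.
  rewrite mulrA ler_pdivrMr// mulrCA mulrA -mulrA [leRHS]mulrAC [leRHS]mulrC.
  by rewrite ler_wpM2l ?cmod_ge0//; lra.
apply: csum_bound => k.
have -> : term (s + h) k - term s k - h * D k = ((eps k)%:C)%C *
   (qroot (shift_i (s + h) k) - qroot (shift_i s k) -
     'i%C / (2 * qroot (shift_i s k)) * (shift_i (s + h) k - shift_i s k)).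
  by rewrite shift_iB termB /D; ring.
rewrite cmodM cmod_eps.
have := @qroot_taylor R (shift_i s k) (shift_i (s + h) k).
rewrite !Re_shift_i => /(_ s0 sh0); rewrite shift_iB.
have -> : s + h - s = h by ring.
set X := cmod (_ - _ - _) => hX.
apply: le_trans (_ : 2 * half k * (cmod h * Num.sqrt (cmod h) / (2 * sg)) <= _).
  by apply: ler_pM; rewrite ?cmod_ge0 ?eps_ge0 ?eps_half.
rewrite le_eqVlt; apply/orP; left; apply/eqP; field.
by rewrite gt_eqF.
Qed.

Definition cayley z : C := (1 + z) / (1 - z).

Definition symbol z : C := (gmap (cayley z) - 1) / (gmap (cayley z) + 1).

Lemma cayley_Re z : z != 1 -> Re (cayley z) = (1 - cmod z ^+ 2) / cmod (1 - z) ^+ 2.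
Proof.
move=> z1; have n0 : 1 - z != 0 by rewrite subr_eq0 eq_sym.
have -> : cayley z = (1 + z) * (1 - z)^*%C / (((cmod (1 - z)) ^+ 2)%:C)%C.
  have n1 : (1 - z)^*%C != 0 by rewrite conjc_eq0.
  rewrite -conjcM_cmod /cayley; move: (1 - z)^*%C n1 => q n1; field.
  by rewrite n0 n1.
have c0 : cmod (1 - z) ^+ 2 != 0 by rewrite expf_neq0// cmod_eq0.
rewrite -[X in X = _]mulr1 -[in LHS](divff c0) mulrA.
have h (w : C) (c : R) : c != 0 -> Re (w / (c%:C)%C) * c = Re w.
  move=> cn0; have -> : Re w = Re ((w / (c%:C)%C) * (c%:C)%C).
    by rewrite divfK// -cmod_gt0 cmod_real normr_gt0.
  by rewrite [in RHS]ReM /= mulr0 subr0.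
rewrite h//; congr (_ / _); rewrite cmod_sqr.
by case: z {z1 n0 c0} => x y /=; ring.
Qed.

Lemma cmod_lt1_neq1 z : cmod z < 1 -> z != 1.
Proof. by move=> h; apply/eqP => z1; rewrite z1 cmod1 ltxx in h. Qed.

Lemma cayley_Re_gt0 z : cmod z < 1 -> 0 < Re (cayley z).
Proof.
move=> z1; rewrite cayley_Re ?cmod_lt1_neq1// divr_gt0//.
  by rewrite subr_gt0 expr_lt1// cmod_ge0.
by rewrite exprn_gt0// cmod_gt0 subr_eq0 eq_sym cmod_lt1_neq1.
Qed.

Lemma cayley_inv_neq0 u : 0 <= Re u -> u + 1 != 0.
Proof.
move=> u0; apply/eqP => u1; have : Re (u + 1) = 0 by rewrite u1.
by rewrite ReD /=; lra.
Qed.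

Lemma cayley_inv_lt1 u : 0 < Re u -> cmod ((u - 1) / (u + 1)) < 1.
Proof.
move=> u0; have n0 := cayley_inv_neq0 (ltW u0).
rewrite cmodM cmodV ltr_pdivrMr ?cmod_gt0// mul1r.
rewrite -(@ltr_pXn2r _ 2) ?nnegrE ?cmod_ge0// !cmod_sqr.
rewrite !(ReD, ImD, ReN, ImN) /= subr0 addr0 ltrD2r -subr_gt0.
have -> : (Re u + 1) ^+ 2 - (Re u - 1) ^+ 2 = 4 * Re u by ring.
by rewrite mulr_gt0.
Qed.

Lemma cdiff_cayley z : z != 1 -> exists d, cdiff cayley z d.
Proof.
move=> z1; have n0 : 1 + -1 * z != 0 by rewrite mulN1r subr_eq0 eq_sym.
have d1 := cdiffD (cdiff_cst 1 z) (cdiff_id z).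
have d2 := cdiffD (cdiff_cst 1 z) (cdiffM (cdiff_cst (-1) z) (cdiff_id z)).
have d3 := cdiffM d1 (cdiff_comp d2 (cdiffV n0)).
by eexists; apply: cdiff_eq d3 => x; rewrite /cayley mulN1r.
Qed.

Lemma cdiff_cayley_inv u : 0 <= Re u ->
  exists d, cdiff (fun u : C => (u - 1) / (u + 1)) u d.
Proof.
move=> u0; have n0 := cayley_inv_neq0 u0.
have d1 := cdiffD (cdiff_id u) (cdiff_cst (-1) u).
have d2 := cdiffD (cdiff_id u) (cdiff_cst 1 u).
by eexists; exact: (cdiffM d1 (cdiff_comp d2 (cdiffV n0))).
Qed.

Lemma symbol_analytic_selfmap : analytic_selfmap symbol.
Proof.
split=> z z1.
  apply/derivable_cdiff; have s0 := cayley_Re_gt0 z1.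
  have [d1 H1] := cdiff_cayley (cmod_lt1_neq1 z1).
  have [d2 H2] := gmap_cdiff s0.
  have [d3 H3] := cdiff_cayley_inv (ltW (gmap_Re_gt0 (ltW s0))).
  by eexists; exact: (cdiff_comp (cdiff_comp H1 H2) H3).
by apply: cayley_inv_lt1; apply: gmap_Re_gt0; apply: ltW; exact: cayley_Re_gt0.
Qed.

Lemma expi_neq1 t : 0 < t < 2 * pi -> expi t != 1.
Proof.
move=> /andP[t0 t2]; apply/eqP => /(congr1 Re) /= c1.
have s0 : 0 < sin (t / 2) by apply: sin_gt0_pi; lra.
have tE : t = (t / 2) *+ 2 by rewrite -mulr_natr; field.
have cE : cos t = 1 - 2 * sin (t / 2) ^+ 2.
  by rewrite {1}tE cos_mulr2n cos2sin2; ring.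
by have := exprn_gt0 2 s0; rewrite cE in c1; lra.
Qed.

(** For e^(it) <> 1 the Cayley image is a finite point of the imaginary axis, at which [gmap] is
    continuous and has positive real part. The values along the radius therefore approach a point
    [zeta] of the open disk. *)
Lemma symbol_radial_limit t (l : C) : 0 < t < 2 * pi -> radial_limit symbol t l ->
  cmod l < 1.
Proof.
move=> t0 Hl.
have z1 := expi_neq1 t0; set z0 := expi t in z1.
have sRe0 : 0 <= Re (cayley z0).
  by rewrite cayley_Re// cmod_expi expr1n subrr mul0r.
set s0 := cayley z0 in sRe0.
have G0 := gmap_Re_gt0 sRe0.
set zeta := (gmap s0 - 1) / (gmap s0 + 1).
have zeta1 : cmod zeta < 1 by exact: cayley_inv_lt1.
pose e := (1 - cmod zeta) / 2.
have e0 : 0 < e by rewrite divr_gt0// subr_gt0.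
have [d3 H3] := cdiff_cayley_inv (ltW G0).
have [e1 e10 He1] := cdiff_ccont H3 e0.
(* Through [gmap_holder] this leaves e1 / 2 + 8 e1 / 32 < e1. *)
pose e2 := Num.min (e1 / 2) ((e1 / 32) ^+ 2).
have e20 : 0 < e2 by rewrite lt_min exprn_gt0 ?andbT ?divr_gt0.
have [d1 H1] := cdiff_cayley z1.
have [e3 e30 He3] := cdiff_ccont H1 e20.
have Hs (r : R) : 1 - e3 < r < 1 -> 0 <= r -> cmod (symbol ((r +i* 0)%C * z0) - zeta) < e.
  move=> /andP[re r1] r0; set z := (_ * _).
  have zz : cmod (z - z0) < e3.
    have hz (u : C) : (r +i* 0)%C * u - u = ((r - 1)%:C)%C * u.
      by case: u => a b; apply: complex_eqP => /=; ring.
    by rewrite hz cmodM cmod_expi mulr1 cmod_real ltr_norml; lra.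
  have := He3 _ zz; rewrite (addrC z0) subrK -/s0 => hs.
  have zlt : cmod z < 1 by rewrite cmod_polar.
  have sge := ltW (cayley_Re_gt0 zlt).
  have hG : cmod (gmap (cayley z) - gmap s0) < e1.
    apply: le_lt_trans (gmap_holder sge sRe0) _.
    have a1 : cmod (cayley z - s0) < e1 / 2.
      by apply: lt_le_trans hs _; rewrite ge_min lexx.
    have a2 : Num.sqrt (cmod (cayley z - s0)) <= e1 / 32.
      have : cmod (cayley z - s0) <= (e1 / 32) ^+ 2.
        by apply: ltW; apply: lt_le_trans hs _; rewrite ge_min lexx orbT.
      by move=> /ler_wsqrtr; rewrite sqrtr_sqr ger0_norm// divr_ge0// ltW.
    lra.
  by have := He1 _ hG; rewrite (addrC (gmap s0)) subrK.
have eC : (0 : C) < ((e%:C)%C : C) by rewrite ltcR.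
have /cvgrPdist_lt/(_ _ eC) Hn := Hl.
have [r [r1 r2 r3]] : exists r : R, [/\ 1 - e3 < r < 1, 0 <= r &
    cmod (l - symbol ((r +i* 0)%C * z0)) < e].
  near (1 : R)^'- => r; exists r; split.
  - apply/andP; split; near: r; first by apply: nbhs_left_gt; lra.
    exact: nbhs_left_lt.
  - by near: r; apply: nbhs_left_ge; lra.
  - by rewrite -normr_lt_cmod; near: r; exact: Hn.
have r4 := Hs r r1 r2.
have -> : l = (l - symbol ((r +i* 0)%C * z0)) + (symbol ((r +i* 0)%C * z0) - zeta) + zeta.
  by ring.
apply: le_lt_trans (cmodD _ _) _.
apply: le_lt_trans (lerD (cmodD _ _) (lexx _)) _.
by rewrite /e in r3 r4; lra.
Unshelve. all: by end_near.
Qed.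

Lemma symbol_unimodular_negligible :
  (@lebesgue_measure R).-negligible (unimodular_boundary_set symbol).
Proof.
have sub : unimodular_boundary_set symbol `<=` [set (0 : R)].
  move=> t [/andP[t0 t1] [l [rl l1]]] /=; apply/eqP; apply: contraTT isT => tn0.
  have t0' : 0 < t < 2 * pi by rewrite t1 lt_def tn0 t0.
  by have := symbol_radial_limit t0' rl; rewrite l1 ltxx.
by exists [set (0 : R)]; split => //; exact: lebesgue_measure_set1.
Qed.

End Symbol.

(** * Lower bounds for singular numbers and failure of the Schatten condition *)

Section SingularNumbers.
Variable R : realType.
Local Notation C := R[i].
Local Notation mu := (@lebesgue_measure R).
Implicit Types (f g : C -> C) (T F : Op R).

Lemma cmod_sqr_circle_measurable f (r : R) (D : set R) : analytic_on_disk f -> 0 <= r < 1 ->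
  measurable_fun D (fun t : R => ((cmod (f ((r +i* 0)%C * expi t))) ^+ 2)%:E).
Proof.
move=> hf r01; apply/measurable_EFinP.
apply: measurable_funS (_ : measurable_fun setT _) => //.
apply: continuous_measurable_fun => t; apply: cvgM; exact: analytic_circle_continuous.
Qed.

Lemma circle_measure : mu `[0%R, (2 * pi)%R[%classic = (2 * pi)%:E.
Proof.
have p0 : 0 < 2 * pi :> R by rewrite mulr_gt0// pi_gt0.
by rewrite lebesgue_measure_itv /= lte_fin p0 -EFinD subr0.
Qed.

Lemma integral_mean2_le f (r c : R) : analytic_on_disk f -> 0 <= r < 1 ->
  (\int[mu]_(t in `[0%R, (2 * pi)%R[)
     ((cmod (f ((r +i* 0)%C * expi t))) ^+ 2)%:E <= (2 * pi * c)%:E)%E ->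
  (integral_mean2 f r <= c%:E)%E.
Proof.
move=> hf r01 h; have p0 : 0 < 2 * pi :> R by rewrite mulr_gt0// pi_gt0.
rewrite /integral_mean2 lee_pdivrMr//; apply: le_trans h _.
by rewrite -EFinM (mulrC c).
Qed.

Lemma bounded_H2 f (M : R) : analytic_on_disk f ->
  (forall z, cmod z < 1 -> cmod (f z) <= M) -> H2 f.
Proof.
move=> hf fM; split=> //; apply: (@le_lt_trans _ _ (M ^+ 2)%:E); last exact: ltry.
apply: ge_ereal_sup => _ [r r01 <-].
have {}r01 : 0 <= r < 1 by move: r01; rewrite /= in_itv.
apply: integral_mean2_le => //.
have M0 : 0 <= M.
  by apply: le_trans (cmod_ge0 _) (fM 0 _); rewrite cmod0.
apply: (@le_trans _ _ (\int[mu]_(t in `[0%R, (2 * pi)%R[) (M ^+ 2)%:E)%E).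
  apply: ge0_le_integral => //=.
  - by move=> t _; rewrite lee_fin sqr_ge0.
  - exact: cmod_sqr_circle_measurable.
  - move=> t _; rewrite lee_fin ler_pXn2r ?nnegrE ?cmod_ge0// fM//.
    by case/andP: r01 => r0 r1; rewrite cmod_polar.
rewrite [leLHS](integral_cst mu (measurable_itv _)) [X in (_ * X)%E]circle_measure.
by rewrite -EFinM mulrC.
Qed.

Lemma analytic_sum n (f : 'I_n -> C -> C) (a : 'I_n -> C) :
  (forall i, analytic_on_disk (f i)) ->
  analytic_on_disk (fun z => \sum_(i < n) a i * f i z).
Proof.
move=> hf z z1; apply/derivable_cdiff.
apply: (@cdiff_sum _ _ (fun i z => a i * f i z)) => i.
have [d Hd] := analytic_cdiff (hf i) z1.
by eexists; exact: (cdiffM (cdiff_cst (a i) z) Hd).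
Qed.

(** [linear_rank_le] grants linearity on [H2] only, so each partial sum must first be placed in
    [H2]; the uniform bound [M] does this. *)
Lemma linear_comb_op n (f : 'I_n -> C -> C) (a : 'I_n -> C) F k (M : R) :
  linear_rank_le F k ->
  (forall i, analytic_on_disk (f i)) ->
  (forall i z, cmod z < 1 -> cmod (f i z) <= M) ->
  F (fun z => \sum_(i < n) a i * f i z) = (fun z => \sum_(i < n) a i * F (f i) z).
Proof.
move=> [Fadd [Fscale _]] hf fM.
have H2f i : H2 (f i) by apply: (bounded_H2 (hf i)); exact: fM.
elim: n f a hf fM H2f => [|n IH] f a hf fM H2f.
  have -> : (fun z => \sum_(i < 0) a i * f i z) = (fun z => 0 * (fun=> 0) z).
    by apply/funext => z; rewrite big_ord0 mul0r.
  rewrite Fscale.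
    by apply/funext => z; rewrite big_ord0 mul0r.
  apply: (@bounded_H2 _ 0) => [z _|z _]; last by rewrite cmod0.
  by apply/derivable_cdiff; exists 0; exact: cdiff_cst.
have -> : (fun z => \sum_(i < n.+1) a i * f i z) =
  (fun z => (fun z => \sum_(i < n) a (widen_ord (leqnSn n) i) * f (widen_ord (leqnSn n) i) z) z
            + (fun z => a ord_max * f ord_max z) z).
  by apply/funext => z; rewrite big_ord_recr.
rewrite Fadd.
- rewrite (IH (fun i => f (widen_ord (leqnSn n) i)) (fun i => a (widen_ord (leqnSn n) i)))//; last by move=> i z; exact: fM.
  by rewrite Fscale//; apply/funext => z; rewrite big_ord_recr.
- apply: (@bounded_H2 _ (\sum_(i < n) cmod (a (widen_ord (leqnSn n) i)) * M)).
    by apply: (@analytic_sum n (fun i => f (widen_ord (leqnSn n) i))) => i.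
  move=> z z1; apply: le_trans (cmod_sum _ _) _; apply: ler_sum => i _.
  by rewrite cmodM ler_wpM2l ?cmod_ge0// fM.
- apply: (@bounded_H2 _ (cmod (a ord_max) * M)).
    move=> z z1; apply/derivable_cdiff; have [d Hd] := analytic_cdiff (hf ord_max) z1.
    by eexists; exact: (cdiffM (cdiff_cst (a ord_max) z) Hd).
  by move=> z z1; rewrite cmodM ler_wpM2l ?cmod_ge0// fM.
Qed.

Lemma left_kernel_exists n k (c : 'I_n -> 'I_k -> C) : (k < n)%N ->
  exists a : 'I_n -> C, (exists i, a i != 0) /\
    forall i, \sum_(j < n) a j * c j i = 0.
Proof.
move=> kn; pose c' : 'M[C]_(n, k) := \matrix_(j, i) c j i.
have : kermx c' != 0.
  rewrite kermx_eq0 /row_free; apply/eqP => h.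
  by have := rank_leq_col c'; rewrite h leqNgt kn.
move=> /rowV0Pn[v /sub_kermxP vc vn0].
exists (fun j => v ord0 j); split.
  apply: contrapT => /forallNP h; move/eqP: vn0; apply; apply/rowP => j.
  by rewrite mxE; have /negP := h j; rewrite negbK => /eqP.
move=> i; have /matrixP/(_ ord0 i) := vc; rewrite !mxE => h.
by rewrite -[RHS]h; apply: eq_bigr => j _; rewrite mxE.
Qed.

(* Bernstein-type lower bound: an operator of rank [k] kills some nonzero vector
   of any space of dimension larger than [k]. *)
Lemma sing_num2_ge T n (f : 'I_n -> C -> C) (M A B : R) : 0 < A ->
  (forall i, analytic_on_disk (f i)) ->
  (forall i z, cmod z < 1 -> cmod (f i z) <= M) ->
  (forall a : 'I_n -> C, (H2norm2 (fun z => (\sum_(i < n) a i * f i z)%R)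
     <= (A * \sum_(i < n) cmod (a i) ^+ 2)%:E)%E) ->
  (forall a : 'I_n -> C, ((B * \sum_(i < n) cmod (a i) ^+ 2)%:E
     <= H2norm2 (T (fun z => (\sum_(i < n) a i * f i z)%R)))%E) ->
  forall k, (k < n)%N -> ((B / A)%:E <= sing_num2 T k)%E.
Proof.
move=> A0 hf fM up lo k kn; apply: le_ereal_inf_tmp => _ [F FL <-].
have [Fadd [Fscale [v [Hv Frk]]]] := FL.
have H2f i : H2 (f i) by apply: (bounded_H2 (hf i)); exact: fM.
have [c Hc] := choice (fun i => Frk (f i) (H2f i)).
have [a [[i0 ai0] ka]] := left_kernel_exists c kn.
pose S := \sum_(i < n) cmod (a i) ^+ 2.
have S0 : 0 < S.
  rewrite /S (bigD1 i0)//= ltr_pwDl ?exprn_gt0 ?cmod_gt0// sumr_ge0// => i _.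
  by rewrite exprn_ge0// cmod_ge0.
(* This scaling makes the squared coefficients sum to 1 / A: the combination enters the unit ball,
   and its image under T has squared norm at least B / A. *)
pose q := (Num.sqrt (A * S))^-1.
have AS0 : 0 < A * S by rewrite mulr_gt0.
have q2 : q ^+ 2 = (A * S)^-1 by rewrite exprVn sqr_sqrtr// ltW.
pose b i : C := (q%:C)%C * a i.
have Sb : \sum_(i < n) cmod (b i) ^+ 2 = A^-1.
  rewrite (eq_bigr (fun i => q ^+ 2 * cmod (a i) ^+ 2)).
    by rewrite -mulr_sumr -/S q2; field; rewrite !gt_eqF.
  by move=> i _; rewrite /b cmodM exprMn cmod_real real_normK ?num_real.
pose g := fun z => \sum_(i < n) b i * f i z.
have Fg : F g = fun=> 0.
  rewrite /g (linear_comb_op b FL hf fM); apply/funext => z.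
  transitivity (\sum_(i < n) \sum_(j < k) (q%:C)%C * (a i * c i j) * v j z).
    by apply: eq_bigr => i _; rewrite Hc mulr_sumr; apply: eq_bigr => j _; rewrite /b; ring.
  rewrite exchange_big /= big1// => j _.
  by rewrite -mulr_suml -mulr_sumr ka mulr0 mul0r.
apply: (@le_trans _ _ (H2norm2 (fun z => T g z - F g z))).
  have -> : (fun z => T g z - F g z) = T g by apply/funext => z; rewrite Fg subr0.
  by apply: le_trans (lo b); rewrite Sb.
apply: ereal_sup_ubound; exists g => //=.
have upg : (H2norm2 g <= 1)%E by apply: le_trans (up b) _; rewrite Sb mulfV// gt_eqF.
split=> //; split; first exact: analytic_sum.
by apply: le_lt_trans upg _; rewrite ltry.
Qed.

Lemma not_schatten_of_lower_bound T (p : R) : 0 < p ->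
  (forall B : R, exists (n : nat) (x : R), [/\ 0 < x, B < n%:R * x `^ (p / 2) &
     forall k, (k < n)%N -> (x%:E <= sing_num2 T k)%E]) ->
  ~ schatten p T.
Proof.
move=> p0 H; rewrite /schatten => fin.
have nn k : (0 <= (sing_num2 T k) `^ (p / 2))%E by exact: poweR_ge0.
set S := (\sum_(0 <= k <oo) _)%E in fin.
have S0 : (0 <= S)%E by apply: nneseries_ge0.
have Sfin : S \is a fin_num by rewrite ge0_fin_numE.
have [n [x [x0 Bn Hx]]] := H (fine S).
have : ((n%:R * x `^ (p / 2))%:E <= S)%E.
  apply: (@le_trans _ _ (\sum_(0 <= k < n) (sing_num2 T k) `^ (p / 2))%E); last first.
    exact: nneseries_lim_ge.
  rewrite mulr_natl -[X in (X <= _)%E]/((x `^ (p / 2) *+ n)%:E).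
  rewrite -[n in X in (X <= _)%E]subn0 -sumr_const_nat -sumEFin big_mkord big_mkord.
  apply: lee_sum => i _; rewrite -poweR_EFin.
  apply: gt0_ler_poweR; rewrite ?in_itv /= ?lee_fin ?leey ?andbT//.
  - by rewrite divr_ge0// ltW.
  - exact: ltW.
  - by apply: le_trans (Hx i (ltn_ord i)); rewrite lee_fin ltW.
  - exact: Hx.
rewrite -(fineK Sfin) lee_fin => h.
by have := lt_le_trans Bn h; rewrite ltxx.
Qed.

End SingularNumbers.

(** * Geometry of the cells in the window of index K *)

Section Window.
Variable R : realType.
Local Notation C := R[i].
Local Notation Re := (@complex.Re R).
Local Notation Im := (@complex.Im R).
Local Notation half := (@half R).
Implicit Types (s u z : C) (K l m M : nat) (r t x y tau : R).

Lemma sin_lower x : `|x| <= 1 / 2 -> `|x| / 2 <= `|sin x|.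
Proof.
wlog x0 : x / 0 <= x.
  move=> W; have [/W//|/ltW x0 hx] := leP 0 x.
  by have := W (- x); rewrite oppr_ge0 sinN !normrN; exact.
move=> hx; have [xi /andP[xi0 xix] E] := @MVT_le R sin cos 0 x x0 (fun y _ => is_derive_sin y).
move: E; rewrite sin0 !subr0 => ->; rewrite normrM mulrC ler_wpM2r//.
have hc := @lip_of_derive_sym R cos (fun y => - sin y) 1 (@is_derive_cos R).
have : `|cos xi - cos 0| <= 1 * `|xi - 0| by apply: hc => y; rewrite normrN sin_max.
rewrite cos0 subr0 mul1r (ger0_norm xi0) ler_norml => /andP[h _].
rewrite (ger0_norm x0) in hx.
by apply: le_trans (ler_norm _); lra.
Qed.

Lemma expi_lower (s t : R) : `|s - t| <= 1 / 2 -> `|s - t| / 2 <= cmod (expi s - expi t).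
Proof.
move=> h; have -> : expi s - expi t = expi t * (expi (s - t) - 1).
  by rewrite mulrBr mulr1 -expiD (addrC t) subrK.
rewrite cmodM cmod_expi mul1r; apply: le_trans (sin_lower h) _.
by apply: le_trans (ler_Im_cmod _); rewrite ImD ImN /= subr0.
Qed.

Lemma cayleyB z u : z != 1 -> u != 1 ->
  cayley z - cayley u = 2 * (z - u) / ((1 - z) * (1 - u)).
Proof.
move=> z1 u1; rewrite /cayley; field.
by rewrite !subr_eq0 ![1 == _]eq_sym z1 u1.
Qed.

Lemma cmod_two : cmod (2 : C) = 2.
Proof.
have -> : (2 : C) = ((2 : R)%:C)%C by rewrite rmorph_nat.
by rewrite cmod_real ger0_norm.
Qed.

Lemma cayley_lower z u : cmod z <= 1 -> cmod u <= 1 -> z != 1 -> u != 1 ->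
  cmod (z - u) / 2 <= cmod (cayley z - cayley u).
Proof.
move=> z1 u1 zn un; rewrite cayleyB// !cmodM cmodV cmodM cmod_two.
have b w : cmod w <= 1 -> cmod (1 - w) <= 2.
  by move=> w1; apply: le_trans (cmodB _ _) _; rewrite cmod1; lra.
have p w : w != 1 -> 0 < cmod (1 - w) by move=> wn; rewrite cmod_gt0 subr_eq0 eq_sym.
rewrite ler_pdivlMr ?mulr_gt0 ?p//.
have : cmod (1 - z) * cmod (1 - u) <= 2 * 2 by apply: ler_pM; rewrite ?cmod_ge0 ?b.
have := cmod_ge0 (z - u); set a := cmod (z - u); set c := _ * _ => a0 c4.
by have := ler_wpM2l a0 c4; lra.
Qed.

(** Since cayley (e^(it)) = i cot (t / 2), this angle goes to i (K + 1/2), halfway between two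
    branch points. *)
Definition tcenter K : R := 2 * atan (K%:R + 1 / 2)^-1.

(** The size of the Cayley derivative 2 / (1 - z)^2 in the window, up to the factor 2: from 1 +
    cayley z = 2 / (1 - z) the centre has |1 - z| >= 2 / (K + 2), and half of this survives
    nearby. *)
Definition kappa K : R := (K.+2%:R) ^+ 2.

Lemma tcenter_bounds K : 0 <= tcenter K /\ tcenter K <= pi.
Proof.
have q0 : 0 < (K%:R + 1 / 2)^-1 :> R by rewrite invr_gt0; have := ler0n R K; lra.
split.
  by rewrite mulr_ge0// -(@atan0 R) le_atan// ltW.
by have := @atan_ltpi2 R (K%:R + 1 / 2)^-1; rewrite /tcenter; lra.
Qed.

Lemma cayley_center K : cayley (expi (tcenter K)) = (0 +i* (K%:R + 1 / 2))%C.
Proof.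
have y0 : 0 < K%:R + 1 / 2 :> R by have := ler0n R K; lra.
rewrite /tcenter expi_2atan; move: (K%:R + 1 / 2) y0 => y y0.
have y1 : 1 + y ^+ 2 != 0 by rewrite gt_eqF// ltr_pwDl// sqr_ge0.
have y2 : y ^+ 2 + 1 != 0 by rewrite addrC.
have yn0 : y != 0 by rewrite gt_eqF.
set z := (_ +i* _)%C.
have zE : 1 - z = (2 / (1 + y ^+ 2) +i* (- (2 * y) / (1 + y ^+ 2)))%C.
  by apply: complex_eqP; rewrite /z /=; field; rewrite ?yn0 ?y1 ?y2.
have n0 : 1 - z != 0.
  apply/eqP => /(congr1 Re); rewrite zE /= => /eqP.
  by rewrite mulf_eq0 invr_eq0 (negbTE y1) pnatr_eq0.
rewrite /cayley; apply: (mulIf n0); rewrite divfK// zE.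
by apply: complex_eqP; rewrite /z /=; field; rewrite ?yn0 ?y1 ?y2.
Qed.

Lemma kappa_gt0 K : 0 < kappa K.
Proof. by rewrite exprn_gt0. Qed.

Lemma kappa_ge4 K : 4 <= kappa K.
Proof.
have -> : 4 = 2 ^+ 2 :> R by ring.
by rewrite ler_pXn2r ?nnegrE// ler_nat.
Qed.

Lemma center_dist K : 2 / K.+2%:R <= cmod (1 - expi (tcenter K)).
Proof.
set z := expi _; have z1 : z != 1.
  apply/eqP => z1; have := cayley_center K; rewrite -/z z1 /cayley subrr invr0 mulr0.
  by move=> /(congr1 Im) /=; have := ler0n R K; lra.
have p : 0 < cmod (1 - z) by rewrite cmod_gt0 subr_eq0 eq_sym.
have E : 1 + cayley z = 2 / (1 - z).
  by rewrite /cayley; field; rewrite subr_eq0 eq_sym.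
have : cmod (1 + cayley z) <= K.+2%:R.
  rewrite cayley_center; apply: le_trans (cmod_le_ReIm _) _ => /=.
  rewrite addr0 add0r normr1 ger0_norm; last by have := ler0n R K; lra.
  have -> : K.+2%:R = K%:R + 2 :> R by rewrite -addn2 natrD.
  lra.
rewrite E cmodM cmodV cmod_two ler_pdivrMr// => h.
by rewrite ler_pdivrMr// mulrC.
Qed.

Lemma near_center K z : cmod (z - expi (tcenter K)) <= 1 / (4 * kappa K) ->
  (K.+2%:R)^-1 <= cmod (1 - z) /\ z != 1.
Proof.
move=> hz; have k0 : 0 < K.+2%:R :> R by [].
have h : (K.+2%:R)^-1 <= cmod (1 - z).
  have c := center_dist K.
  have -> : 1 - z = (1 - expi (tcenter K)) - (z - expi (tcenter K)) by ring.
  apply: le_trans (cmod_subl _ _); apply: le_trans (lerB c hz).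
  have k1 : 1 <= K.+2%:R :> R by rewrite ler1n.
  have i1 : (K.+2%:R)^-1 <= 1 :> R by rewrite invf_le1.
  have i0 : 0 < (K.+2%:R)^-1 :> R by rewrite invr_gt0.
  have -> : 1 / (4 * kappa K) = (K.+2%:R)^-1 * (K.+2%:R)^-1 / 4 :> R.
    by rewrite /kappa; field; rewrite gt_eqF.
  have := ler_wpM2l (ltW i0) i1; rewrite mulr1.
  set a := (K.+2%:R)^-1 in i0 i1 *; lra.
split=> //; apply/eqP => z1; move: h; rewrite z1 subrr cmod0.
by apply/negP; rewrite -ltNge invr_gt0.
Qed.

Lemma cayley_window_lip K z u :
  cmod (z - expi (tcenter K)) <= 1 / (4 * kappa K) ->
  cmod (u - expi (tcenter K)) <= 1 / (4 * kappa K) ->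
  cmod (cayley z - cayley u) <= 2 * kappa K * cmod (z - u).
Proof.
move=> /near_center[z1 zn] /near_center[u1 un].
have k0 : 0 < (K.+2%:R)^-1 :> R by rewrite invr_gt0.
rewrite cayleyB// !cmodM cmodV cmodM cmod_two -mulrA -[leRHS]mulrA ler_pM2l//.
rewrite [leRHS]mulrC ler_wpM2l ?cmod_ge0//.
have -> : kappa K = ((K.+2%:R)^-1 * (K.+2%:R)^-1)^-1.
  by rewrite /kappa; field.
rewrite lef_pV2 ?posrE ?mulr_gt0//; first by apply: ler_pM => //; exact: ltW.
- exact: lt_le_trans z1.
- exact: lt_le_trans u1.
Qed.

(** For k <= K the point i y is at distance at least 1/4 from the branch point i k, so the root is
    Lipschitz with constant 2 and purely imaginary at i y; the terms with k > K fall under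
    [eps_tail]. The constants are 17 = 1 + 4 * 4 and 6 = 4 + 2. *)
Lemma gmap_window K s y : (0 < K)%N -> K%:R + 1 / 4 <= y <= K%:R + 3 / 4 -> 0 <= Re s ->
  cmod (s - (0 +i* y)%C) <= 1 ->
  cmod (gmap s - (0 +i* Im (gmap (0 +i* y)%C))%C) <=
    17 * cmod (s - (0 +i* y)%C) + 6 * half (K ^ 4).
Proof.
move=> K0 /andP[y1 y2] s0; set u := (0 +i* y)%C => su1.
have u0 : 0 <= Re u by [].
have shE k : shift_i u k = (0 +i* (y - k%:R))%C.
  by apply: complex_eqP; rewrite /shift_i ?ReD ?ImD ?ReN ?ImN /=; ring.
set d := cmod (s - u); have d0 : 0 <= d by exact: cmod_ge0.
have hK := half_ge0 R (K ^ 4).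
have h1 : cmod (gmap s - gmap u) <= 17 * d + 4 * half (K ^ 4).
  rewrite gmap_diff//; apply: le_trans (cmodD _ _) _; rewrite -/d.
  have : cmod (csum (fun k => term s k - term u k)) <= 4 * (4 * d + half (K ^ 4)).
    apply: csum_bound => k; rewrite termB cmodM cmod_eps mulrDl.
    have [kK|Kk] := leqP k K.
      apply: le_trans (_ : 4 * d * half k <= _); last by rewrite lerDl mulr_ge0 ?half_ge0.
      have kK' : k%:R <= K%:R :> R by rewrite ler_nat.
      have := @qroot_lip R (shift_i s k) (shift_i u k) (1 / 2).
      rewrite !Re_shift_i shift_iB -/d => /(_ s0 u0) hq.
      have {}hq : cmod (qroot (shift_i s k) - qroot (shift_i u k)) <= d / (1 / 2).
        apply: hq; first by lra.
        rewrite shE /cmod /= expr0n add0r sqrtr_sqr ger0_norm; last by lra.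
        by rewrite expr2; lra.
      apply: le_trans (_ : 2 * half k * (d / (1 / 2)) <= _).
        by apply: ler_pM; rewrite ?eps_ge0 ?cmod_ge0 ?eps_half.
      by rewrite le_eqVlt; apply/orP; left; apply/eqP; field.
    apply: le_trans (_ : half (K ^ 4) * half k <= _); last first.
      by rewrite lerDr !mulr_ge0 ?half_ge0.
    apply: le_trans (eps_tail R K0 Kk); rewrite ler_wpM2l ?eps_ge0//.
    apply: le_trans (_ : 1 <= _); last by rewrite ler1n.
    have := @qroot_holder R (shift_i s k) (shift_i u k).
    rewrite !Re_shift_i shift_iB => /(_ s0 u0) hq; apply: le_trans hq _.
    by rewrite -sqrtr1 ler_wsqrtr.
  lra.
have h2 : cmod (gmap u - (0 +i* Im (gmap u))%C) <= 2 * half (K ^ 4).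
  have -> : gmap u - (0 +i* Im (gmap u))%C = ((Re (gmap u))%:C)%C.
    by apply: complex_eqP; rewrite ?ReD ?ImD ?ReN ?ImN /=; ring.
  rewrite cmod_real ReD -[Re u]/0 add0r.
  apply: (@rdom_bound R (fun k => Re (term u k))) => k; rewrite term_Re.
  have [kK|Kk] := leqP k K.
    have kK' : k%:R <= K%:R :> R by rewrite ler_nat.
    rewrite shE qroot_Re_eq0; last by lra.
    by rewrite mulr0 normr0 mulr_ge0 ?half_ge0.
  apply: le_trans (eps_tail R K0 Kk); rewrite normrM ger0_norm ?eps_ge0//.
  rewrite ler_wpM2l ?eps_ge0//; apply: le_trans (ler_Re_cmod _) _.
  have kK' : K%:R + 1 <= k%:R :> R by rewrite natr1 ler_nat.
  have k0 : 0 <= k%:R :> R by [].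
  have : cmod (qroot (shift_i u k)) ^+ 2 <= k%:R.
    rewrite cmod_qroot_sqr ?Re_shift_i// shE /cmod /= expr0n add0r sqrtr_sqr.
    by rewrite ler_norml; have := ler0n R K; lra.
  move=> hk; rewrite -(@ler_pXn2r _ 2) ?nnegrE ?cmod_ge0//.
  by apply: le_trans hk _; rewrite -natr1 sqrrD1; have := sqr_ge0 (k%:R : R); lra.
have -> : gmap s - (0 +i* Im (gmap u))%C = (gmap s - gmap u) + (gmap u - (0 +i* Im (gmap u))%C).
  by ring.
by apply: le_trans (cmodD _ _) _; lra.
Qed.

(** Each term has nondecreasing imaginary part along the axis, so the perturbation can only push
    heights further apart and the separation of the cells survives. *)
Lemma gmap_Im_mono x y : x <= y ->
  y - x <= Im (gmap (0 +i* y)%C) - Im (gmap (0 +i* x)%C).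
Proof.
move=> xy; set u := (0 +i* y)%C; set s := (0 +i* x)%C.
have u0 : 0 <= Re u by []; have s0 : 0 <= Re s by [].
rewrite -ImN -ImD gmap_diff// ImD lerDl /=.
have shE (w : R) k : shift_i (0 +i* w)%C k = (0 +i* (w - k%:R))%C.
  by apply: complex_eqP; rewrite /shift_i ?ReD ?ImD ?ReN ?ImN /=; ring.
have nn k : 0 <= Im (term u k - term s k).
  rewrite ImD ImN !term_Im -mulrBr mulr_ge0 ?eps_ge0// subr_ge0 !shE.
  by apply: qroot_Im_mono; rewrite lerD2r.
have dm : cdom (fun k => term u k - term s k) (2 * (cmod u + 1) + 2 * (cmod s + 1)).
  move=> k; apply: le_trans (cmodB _ _) _; rewrite mulrDl.
  by apply: lerD; [exact: (cdom_term u0)|exact: (cdom_term s0)].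
by apply: le_trans (rsum_ge_term 0 (cdomIm dm) nn); exact: nn.
Qed.

Lemma gmap_Im_expand x y :
  `|y - x| <= `|Im (gmap (0 +i* y)%C) - Im (gmap (0 +i* x)%C)|.
Proof.
wlog xy : x y / x <= y.
  move=> W; have [/W//|/ltW/W] := leP x y.
  by rewrite distrC (distrC (Im _)).
rewrite (ger0_norm (_ : 0 <= y - x)) ?subr_ge0//.
exact: le_trans (gmap_Im_mono xy) (ler_norm _).
Qed.

Lemma cayley_expi t : expi t != 1 -> cayley (expi t) = (0 +i* Im (cayley (expi t)))%C.
Proof.
move=> t1; apply: complex_eqP => //.
by rewrite cayley_Re// cmod_expi expr1n subrr mul0r.
Qed.

Definition cell_node K tau l : R := tcenter K + l%:R * tau.
Definition cell_height K tau l : R := Im (gmap (cayley (expi (cell_node K tau l)))).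

(** A point over a cell is within 3 tau of its node, so its Cayley image is within 6 kappa tau of
    the image of the node; [gmap_window] turns this into 17 * 6 + 6 = 108 times kappa tau. The
    separation loses 1/2 in [expi_lower], 1/2 in [cayley_lower] and nothing in [gmap]. *)
Lemma window_geometry K tau M r : (0 < K)%N -> (2 <= M)%N -> 0 < tau ->
  M%:R * tau <= 1 / (16 * kappa K) -> 1 - tau <= r < 1 -> half (K ^ 4) <= kappa K * tau ->
  (forall l t, (l < M)%N -> cell_node K tau l <= t <= cell_node K tau l + tau ->
     cmod (gmap (cayley ((r%:C)%C * expi t)) - (0 +i* cell_height K tau l)%C) <=
     108 * kappa K * tau) /\
  (forall l m, (l < M)%N -> (m < M)%N ->
     `|l%:R - m%:R| * tau / 4 <= `|cell_height K tau l - cell_height K tau m|).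
Proof.
move=> K0 M2 tau0 MW /andP[r1 r2] hd.
have k4 := kappa_ge4 K; have k0 := kappa_gt0 K.
set k := kappa K in MW hd k4 k0 *.
have ik0 : 0 < 1 / k by rewrite divr_gt0.
have MW' : M%:R * tau <= (1 / k) / 16.
  by apply: le_trans MW _; rewrite le_eqVlt; apply/orP; left; apply/eqP; field; rewrite gt_eqF.
have q4 : 1 / (4 * k) = (1 / k) / 4 by field; rewrite gt_eqF.
have ik4 : 1 / k <= 1 / 4 by rewrite ler_pM2l// lef_pV2 ?posrE.
have tauM : 2 * tau <= M%:R * tau by rewrite ler_pM2r// (ler_nat R 2).
have r0 : 0 <= r by lra.
have lM l : (l < M)%N -> 0 <= l%:R * tau /\ l%:R * tau + tau <= M%:R * tau.
  move=> lm; split; first by rewrite mulr_ge0// ltW.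
  by rewrite -[X in _ + X]mul1r -mulrDl natr1 ler_pM2r// ler_nat.
have nodeC l : (l < M)%N -> cmod (expi (cell_node K tau l) - expi (tcenter K)) <= 1 / (4 * k).
  move=> /lM[l0 l1]; apply: le_trans (expi_lip _ _) _.
  have -> : cell_node K tau l - tcenter K = l%:R * tau by rewrite /cell_node; ring.
  by rewrite (ger0_norm l0) q4; lra.
have nodeN l (lm : (l < M)%N) : expi (cell_node K tau l) != 1 by have [] := near_center (nodeC l lm).
pose y l := Im (cayley (expi (cell_node K tau l))).
have yE l : (l < M)%N -> cayley (expi (cell_node K tau l)) = (0 +i* y l)%C.
  by move=> lm; rewrite [LHS]cayley_expi ?nodeN.
split.
  move=> l t lm /andP[t1 t2]; have [l0 l1] := lM l lm.
  set z := (r%:C)%C * expi t.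
  have zexp (v : R) : cmod (z - expi v) <= tau + 2 * `|t - v|.
    have -> : z - expi v = ((r - 1)%:C)%C * expi t + (expi t - expi v).
      by rewrite /z rmorphB /= mulrBl mul1r; ring.
    apply: le_trans (cmodD _ _) _; apply: lerD; last exact: expi_lip.
    by rewrite cmodM cmod_expi mulr1 cmod_real ler_norml; lra.
  have zc : cmod (z - expi (tcenter K)) <= 1 / (4 * k).
    apply: le_trans (zexp _) _; rewrite /cell_node in t1 t2.
    by rewrite ger0_norm ?q4; lra.
  have zl : cmod (z - expi (cell_node K tau l)) <= 3 * tau.
    by apply: le_trans (zexp _) _; rewrite ger0_norm; lra.
  have [_ zn1] := near_center zc.
  have zlt : cmod z < 1 by rewrite /z cmodM cmod_expi mulr1 cmod_real ger0_norm.
  have sz0 := ltW (cayley_Re_gt0 zlt).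
  have dS : cmod (cayley z - (0 +i* y l)%C) <= 6 * k * tau.
    rewrite -(yE l lm); apply: le_trans (cayley_window_lip zc (nodeC l lm)) _.
    by have := ler_wpM2l (ltW k0) zl; rewrite -/k; lra.
  have ktau : k * tau <= 1 / 32.
    have : k * (2 * tau) <= k * ((1 / k) / 16).
      by rewrite ler_pM2l//; apply: le_trans tauM MW'.
    have -> : k * ((1 / k) / 16) = 1 / 16 by field; rewrite gt_eqF.
    lra.
  (* The length 1 / (16 kappa) of the window is chosen so that the Cayley images of the nodes stay
     within 1/4 of i (K + 1/2). *)
  have yl : K%:R + 1 / 4 <= y l <= K%:R + 3 / 4.
    have cc : cmod (expi (tcenter K) - expi (tcenter K)) <= 1 / (4 * k).
      by rewrite subrr cmod0 q4; lra.
    have := cayley_window_lip (nodeC l lm) cc; rewrite cayley_center yE// -/k.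
    have -> : (0 +i* y l)%C - (0 +i* (K%:R + 1 / 2))%C = (0 +i* (y l - (K%:R + 1 / 2)))%C :> C.
      by apply: complex_eqP; rewrite ?ReD ?ImD ?ReN ?ImN /=; ring.
    rewrite {1}/cmod /= expr0n add0r sqrtr_sqr => hy.
    have hb : 2 * k * cmod (expi (cell_node K tau l) - expi (tcenter K)) <= 1 / 4.
      apply: le_trans (_ : 2 * k * (2 * (1 / k / 16)) <= _).
        rewrite ler_wpM2l//; first by rewrite mulr_ge0// ltW.
        apply: le_trans (expi_lip _ _) _; rewrite ler_pM2l//.
        have -> : cell_node K tau l - tcenter K = l%:R * tau by rewrite /cell_node; ring.
        by rewrite (ger0_norm l0); lra.
      by rewrite le_eqVlt; apply/orP; left; apply/eqP; field; rewrite gt_eqF.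
    have := le_trans hy hb; rewrite ler_norml; lra.
  have dS1 : cmod (cayley z - (0 +i* y l)%C) <= 1 by lra.
  have := gmap_window K0 yl sz0 dS1; rewrite -(yE l lm) -/(cell_height K tau l) => hg.
  apply: le_trans hg _; rewrite (yE l lm); lra.
move=> l m lm mm; rewrite /cell_height !yE//.
apply: le_trans (gmap_Im_expand _ _).
have cy : cmod (cayley (expi (cell_node K tau l)) - cayley (expi (cell_node K tau m))) = `|y l - y m|.
  rewrite !yE//; have -> : (0 +i* y l)%C - (0 +i* y m)%C = (0 +i* (y l - y m))%C :> C.
    by apply: complex_eqP; rewrite ?ReD ?ImD ?ReN ?ImN /=; ring.
  by rewrite /cmod /= expr0n add0r sqrtr_sqr.
rewrite -cy; apply: le_trans (cayley_lower _ _ (nodeN l lm) (nodeN m mm)); rewrite ?cmod_expi//.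
have nE : cell_node K tau l - cell_node K tau m = (l%:R - m%:R) * tau by rewrite /cell_node; ring.
have nN : `|cell_node K tau l - cell_node K tau m| = `|l%:R - m%:R| * tau.
  by rewrite nE normrM (gtr0_norm tau0).
have := @expi_lower (cell_node K tau l) (cell_node K tau m); rewrite nN => hx.
suff : `|l%:R - m%:R| * tau <= 1 / 2 by move=> /hx; lra.
have [l0 l1] := lM l lm; have [m0 m1] := lM m mm.
by rewrite -nN nE mulrBl ler_norml; lra.
Qed.

End Window.

(** * Almost orthogonality of the test functions and of their images *)

Section TestFunctions.
Variable R : realType.
Local Notation C := R[i].
Local Notation Re := (@complex.Re R).
Local Notation Im := (@complex.Im R).
Local Notation mu := (@lebesgue_measure R).
Implicit Types (s u z : C) (r t v eta : R) (w : C -> C).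

(** The square makes the modulus itself comparable to a Poisson kernel, whose integral is explicit,
    and gives quadratic decay away from height v. The pole lies at distance [eta] outside the
    half-plane. *)
Definition testf eta v u : C :=
  ((eta%:C)%C / (cayley u + (eta +i* (- v))%C)) ^+ 2.

Lemma pole_dist eta v s : 0 <= Re s -> 0 < eta ->
  eta <= cmod (s + (eta +i* (- v))%C) /\ `|Im s - v| <= cmod (s + (eta +i* (- v))%C).
Proof.
move=> s0 e0; split.
  apply: le_trans (Re_le_cmod _); rewrite ReD /=; lra.
by apply: le_trans (ler_Im_cmod _); rewrite ImD /=.
Qed.

Lemma cmod_testf eta v u : 0 < eta ->
  cmod (testf eta v u) = eta ^+ 2 / cmod (cayley u + (eta +i* (- v))%C) ^+ 2.
Proof.
by move=> e0; rewrite cmodX cmodM cmodV cmod_real (gtr0_norm e0) exprMn exprVn.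
Qed.

Lemma testf_analytic eta v : 0 < eta -> analytic_on_disk (testf eta v).
Proof.
move=> e0 u u1; apply/derivable_cdiff.
have s0 := ltW (cayley_Re_gt0 u1).
have n0 : cayley u + (eta +i* (- v))%C != 0.
  by rewrite -cmod_gt0; apply: lt_le_trans (pole_dist v s0 e0).1.
have [d Hd] := cdiff_cayley (cmod_lt1_neq1 u1).
have h1 := cdiff_comp (cdiffD Hd (cdiff_cst (eta +i* (- v))%C u)) (cdiffV n0).
have h2 := cdiffM (cdiff_cst (eta%:C)%C u) h1.
by eexists; exact: (cdiffM h2 h2).
Qed.

Lemma testf_le eta v u (d : R) : 0 < eta -> cmod u < 1 -> 0 < d ->
  d <= cmod (cayley u + (eta +i* (- v))%C) -> cmod (testf eta v u) <= (eta / d) ^+ 2.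
Proof.
move=> e0 u1 d0 dl; rewrite cmod_testf// expr_div_n ler_wpM2l ?sqr_ge0//.
rewrite lef_pV2 ?posrE ?exprn_gt0//; last exact: lt_le_trans dl.
by rewrite ler_pXn2r// nnegrE ?cmod_ge0// ltW.
Qed.

Lemma testf_le1 eta v u : 0 < eta -> cmod u < 1 -> cmod (testf eta v u) <= 1.
Proof.
move=> e0 u1; have s0 := ltW (cayley_Re_gt0 u1).
by have := testf_le e0 u1 e0 (pole_dist v s0 e0).1; rewrite divff ?gt_eqF// expr1n.
Qed.

Lemma poisson_continuous (a : C) : cmod a < 1 -> continuous (poisson a).
Proof.
move=> a1 t; apply: cvgM; first exact: cvg_cst.
have cm : {for t, continuous (fun t => cmod (mden a t))}.
  apply: cmod_continuous; apply: (@lip_near _ _ _ (cmod a * 2)).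
    by rewrite mulr_ge0 ?cmod_ge0.
  move=> s; have -> : mden a s - mden a t = a^*%C * (expi s - expi t).
    by rewrite /mden; ring.
  by rewrite cmodM cmod_conjc -mulrA ler_wpM2l ?cmod_ge0// expi_lip.
apply: cvgV; last by apply: cvgM; exact: cm.
by rewrite expf_neq0// cmod_eq0 mden_neq0.
Qed.

Lemma integral_poisson (a : C) : cmod a < 1 ->
  (\int[mu]_(t in `[0%R, (2 * pi)%R[) (poisson a t)%:E = (2 * pi)%:E)%E.
Proof.
move=> a1; have p0 : 0 < 2 * pi :> R by rewrite mulr_gt0// pi_gt0.
rewrite (continuous_FTC2_co p0 (poisson_continuous a1) (fun t _ => is_derive_mangle t a1)).
by have := mangle_periodic a 0; rewrite add0r => ->; congr (_%:E); ring.
Qed.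

(** With c = eta - i v one has cayley u + c = (1 + c) (1 + (1 - c) / (1 + c) u) / (1 - u), whose
    middle factor is an [mden] on the circle of radius r. The identity |1 + c|^2 - |1 - c|^2 = 4 eta
    and |1 - u| <= 2 give the constant. *)
Lemma testf_poisson eta v r : 0 < eta -> 0 <= r < 1 -> exists2 a : C, cmod a < 1 &
  forall t, cmod (testf eta v ((r +i* 0)%C * expi t)) <= eta * poisson a t.
Proof.
move=> e0 /andP[r0 r1].
pose c : C := (eta +i* (- v))%C.
have c1 : 0 < cmod (1 + c).
  by apply: lt_le_trans (Re_le_cmod _); rewrite ReD /=; lra.
have cc : cmod (1 + c) ^+ 2 - cmod (1 - c) ^+ 2 = 4 * eta.
  by rewrite !cmod_sqr !(ReD, ImD, ReN, ImN) /=; ring.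
have n1 : 1 + c != 0 by rewrite -cmod_gt0.
pose b : C := (r%:C)%C * (1 - c) / (1 + c).
have bE : cmod b = r * cmod (1 - c) / cmod (1 + c).
  by rewrite !cmodM cmodV cmod_real (ger0_norm r0).
have b1 : cmod b ^+ 2 * cmod (1 + c) ^+ 2 <= cmod (1 - c) ^+ 2.
  rewrite bE -exprMn divfK ?gt_eqF// exprMn ler_piMl ?sqr_ge0// expr_le1// ltW//.
have key : 4 * eta <= cmod (1 + c) ^+ 2 * (1 - cmod b ^+ 2) by lra.
have b2 : 0 < 1 - cmod b ^+ 2.
  by rewrite -(pmulr_rgt0 _ (exprn_gt0 2 c1)); lra.
exists b^*%C.
  rewrite cmod_conjc -(@ltr_pXn2r _ 2) ?nnegrE ?cmod_ge0// expr1n; lra.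
move=> t; set u := (r +i* 0)%C * expi t.
have u1 : cmod u < 1 by rewrite cmod_polar.
have un : 1 - u != 0 by rewrite subr_eq0 eq_sym cmod_lt1_neq1.
have E : cayley u + c = (1 + c) * mden b^*%C t / (1 - u).
  rewrite /mden conjcK /cayley /b.
  have -> : (r%:C)%C = (r +i* 0)%C by [].
  have -> : (r +i* 0)%C * (1 - c) / (1 + c) * expi t = (1 - c) / (1 + c) * u.
    by rewrite /u; ring.
  by field; rewrite n1 un.
have m0 : 0 < cmod (mden b^*%C t).
  by rewrite cmod_gt0 mden_neq0// cmod_conjc -(@ltr_pXn2r _ 2) ?nnegrE ?cmod_ge0// expr1n; lra.
rewrite cmod_testf// -/c E !cmodM cmodV /poisson cmod_conjc.
have u2 : cmod (1 - u) ^+ 2 <= 4.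
  have -> : 4 = 2 ^+ 2 :> R by ring.
  rewrite ler_pXn2r ?nnegrE ?cmod_ge0//.
  by apply: le_trans (cmodB _ _) _; rewrite cmod1; lra.
have un' : 0 < cmod (1 - u) by rewrite cmod_gt0.
move: (cmod (1 - u)) (cmod (mden _ _)) (cmod (1 + c)) (cmod b) un' m0 c1 b2 key u2.
move=> x y p q x0 y0 p0 q0 key x4.
have -> : eta ^+ 2 / (p * y / x) ^+ 2 = (eta ^+ 2 * x ^+ 2 / p ^+ 2) / y ^+ 2.
  by field; rewrite !gt_eqF.
rewrite [leRHS]mulrA ler_pM2r ?invr_gt0 ?exprn_gt0// ler_pdivrMr ?exprn_gt0//.
have h1 : eta ^+ 2 * x ^+ 2 <= eta ^+ 2 * 4 by rewrite ler_wpM2l ?sqr_ge0.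
have h2 := ler_wpM2l (ltW e0) key.
by rewrite expr2 in h1 *; lra.
Qed.

Lemma weighted_cauchy_schwarz (I : finType) (x p : I -> R) : (forall i, 0 <= p i) ->
  (\sum_i x i * p i) ^+ 2 <= (\sum_i x i ^+ 2 * p i) * \sum_i p i.
Proof.
move=> p0; set B := \sum_i p i; set S := \sum_i x i * p i.
set Q := \sum_i x i ^+ 2 * p i.
have B0 : 0 <= B by apply: sumr_ge0.
(* This is the sum of p_i (B x_i - S)^2; when B = 0 all the weights vanish and both sides are 0. *)
have h : 0 <= B * (Q * B - S ^+ 2).
  have -> : B * (Q * B - S ^+ 2) = \sum_i p i * (B * x i - S) ^+ 2.
    transitivity (\sum_i (B ^+ 2 * (x i ^+ 2 * p i) - 2 * B * S * (x i * p i) + S ^+ 2 * p i)).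
      rewrite !big_split /= sumrN -!mulr_sumr -/B -/S -/Q; ring.
    by apply: eq_bigr => i _; ring.
  by apply: sumr_ge0 => i _; rewrite mulr_ge0 ?sqr_ge0.
have [B1|B1] := ltP 0 B; first by move: h; rewrite pmulr_rge0// subr_ge0.
have BE : B = 0 by apply/eqP; rewrite eq_le B0 B1.
have pE i : p i = 0.
  apply/eqP; rewrite eq_le p0 andbT -BE /B (bigD1 i)//= lerDl sumr_ge0//.
rewrite /S big1 ?expr0n ?BE ?mulr0//= => i _; by rewrite pE mulr0.
Qed.

(** At most one v_j is within d / 2 of the height of the point; its function is at most 1, and the
    others, at most (2 eta / d)^2 each, add up to at most 1. *)
Lemma sum_testf_le2 n (v : 'I_n -> R) eta (d : R) u : 0 < eta -> 0 < d ->
  4 * n%:R * eta ^+ 2 <= d ^+ 2 ->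
  (forall i j, i != j -> d <= `|v i - v j|) -> cmod u < 1 ->
  \sum_i cmod (testf eta (v i) u) <= 2.
Proof.
move=> e0 d0 nd sep u1; have s0 := ltW (cayley_Re_gt0 u1).
pose q := (eta / (d / 2)) ^+ 2.
have q0 : 0 <= q by rewrite sqr_ge0.
have nq : n%:R * q <= 1.
  have -> : n%:R * q = 4 * n%:R * eta ^+ 2 / d ^+ 2 by rewrite /q; field; rewrite gt_eqF.
  by rewrite ler_pdivrMr ?exprn_gt0// mul1r.
have far i : d / 2 <= `|Im (cayley u) - v i| -> cmod (testf eta (v i) u) <= q.
  move=> h; apply: testf_le => //; first by rewrite divr_gt0.
  exact: le_trans h (pole_dist (v i) s0 e0).2.
have sumq (P : pred 'I_n) : \sum_(i | P i) q <= 1.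
  rewrite sumr_const -mulr_natl; apply: le_trans nq; rewrite ler_wpM2r// ler_nat.
  by rewrite -[X in (_ <= X)%N]card_ord max_card.
have [[j0 hj]|none] := pselect (exists j, `|Im (cayley u) - v j| < d / 2); last first.
  apply: le_trans (_ : \sum_(i < n) q <= _); last by have := sumq predT; lra.
  apply: ler_sum => i _; apply: far; rewrite leNgt; apply/negP => hi.
  by apply: none; exists i.
rewrite (bigD1 j0)//= (_ : 2 = 1 + 1)//; apply: lerD; first exact: testf_le1.
apply: le_trans (sumq (fun i => i != j0)); apply: ler_sum => i ij; apply: far.
have := ler_distD (Im (cayley u)) (v i) (v j0); rewrite (distrC (v i) (Im (cayley u))).
by have := sep i j0 ij; lra.
Qed.

(** A Schur test: Cauchy-Schwarz with the moduli of the test functions as weights costs the factor 2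
    of [sum_testf_le2], and each weight is then integrated as [eta] times a Poisson kernel. *)
Lemma test_upper n (v : 'I_n -> R) eta (d : R) (a : 'I_n -> C) : 0 < eta -> 0 < d ->
  4 * n%:R * eta ^+ 2 <= d ^+ 2 ->
  (forall i j, i != j -> d <= `|v i - v j|) ->
  (H2norm2 (fun z => (\sum_(i < n) a i * testf eta (v i) z)%R) <=
    (2 * eta * \sum_(i < n) cmod (a i) ^+ 2)%:E)%E.
Proof.
move=> e0 d0 nd sep; apply: ge_ereal_sup => _ [r r01 <-].
have {}r01 : 0 <= r < 1 by move: r01; rewrite /= in_itv.
have [r0 r1] := andP r01.
have han : analytic_on_disk (fun z => \sum_(i < n) a i * testf eta (v i) z).
  by apply: analytic_sum => i; exact: testf_analytic.
apply: integral_mean2_le => //.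
have [b Hb] := choice (fun i : 'I_n => let: ex_intro2 x h1 h2 := testf_poisson (v i) e0 r01 in
  ex_intro (fun x : C => cmod x < 1 /\ forall t, cmod (testf eta (v i) ((r +i* 0)%C * expi t))
     <= eta * poisson x t) x (conj h1 h2)).
have b1 i : cmod (b i) < 1 by have [] := Hb i.
have pp i t : 0 <= poisson (b i) t.
  have /andP[+ _] := poisson_bounds t (lexx (cmod (b i))) (b1 i).
  by apply: le_trans; rewrite divr_ge0// subr_ge0 expr_le1 ?cmod_ge0// ltW.
have c0 i : 0 <= 2 * eta * cmod (a i) ^+ 2.
  by rewrite mulr_ge0 ?sqr_ge0// mulr_ge0// ltW.
pose D : set R := `[0%R, (2 * pi)%R[%classic.
have mD : measurable D by exact: measurable_itv.
have mp i : measurable_fun D (fun t => (poisson (b i) t)%:E).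
  apply/measurable_EFinP; apply: measurable_funS (_ : measurable_fun setT _) => //.
  exact: continuous_measurable_fun (poisson_continuous (b1 i)).
apply: (@le_trans _ _ (\int[mu]_(t in D)
   \sum_(i < n) ((2 * eta * cmod (a i) ^+ 2)%:E * (poisson (b i) t)%:E))%E).
  apply: ge0_le_integral => //=.
  - by move=> t _; rewrite lee_fin sqr_ge0.
  - exact: (@cmod_sqr_circle_measurable R _ r _ han r01).
  - by apply: emeasurable_sum => i; apply: measurable_funeM; exact: mp.
  move=> t _.
  have -> : (\sum_(i < n) ((2 * eta * cmod (a i) ^+ 2)%:E * (poisson (b i) t)%:E) =
      (\sum_(i < n) (2 * eta * cmod (a i) ^+ 2 * poisson (b i) t)%R)%:E)%E.
    by rewrite -sumEFin; apply: eq_bigr => i _; rewrite EFinM.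
  rewrite lee_fin; set u := _ * expi t.
  have u1 : cmod u < 1 by rewrite cmod_polar.
  apply: le_trans (_ : (\sum_i cmod (a i) * cmod (testf eta (v i) u)) ^+ 2 <= _).
    rewrite ler_pXn2r ?nnegrE ?cmod_ge0//; last first.
      by apply: sumr_ge0 => i _; rewrite mulr_ge0 ?cmod_ge0.
    by apply: le_trans (cmod_sum _ _) _; apply: ler_sum => i _; rewrite cmodM.
  apply: le_trans (weighted_cauchy_schwarz _ _) _; first by move=> i; exact: cmod_ge0.
  apply: le_trans (_ : (\sum_i cmod (a i) ^+ 2 * cmod (testf eta (v i) u)) * 2 <= _).
    rewrite ler_wpM2l//; last exact: (sum_testf_le2 e0 d0 nd sep u1).
    by apply: sumr_ge0 => i _; rewrite mulr_ge0 ?sqr_ge0 ?cmod_ge0.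
  rewrite mulr_suml; apply: ler_sum => i _.
  have := (Hb i).2 t; rewrite -/u => h.
  by have := ler_wpM2l (sqr_ge0 (cmod (a i))) h; lra.
rewrite ge0_integral_sum//.
- rewrite (eq_bigr (fun i => (2 * eta * cmod (a i) ^+ 2 * (2 * pi))%:E)).
    by rewrite sumEFin lee_fin -mulr_suml -mulr_sumr mulrC.
  move=> i _; rewrite ge0_integralZl_EFin//.
  + by rewrite integral_poisson// -EFinM.
  + by move=> t _; rewrite lee_fin.
  + exact: mp.
- by move=> i; apply: measurable_funeM; exact: mp.
- by move=> i t _; rewrite mule_ge0// lee_fin.
Qed.

Lemma cayley_symbol z : cmod z < 1 -> cayley (symbol z) = gmap (cayley z).
Proof.
move=> z1; have g0 := gmap_Re_gt0 (ltW (cayley_Re_gt0 z1)).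
have n0 := cayley_inv_neq0 (ltW g0).
rewrite /symbol; move: (gmap _) n0 => g n0.
have h : 1 - (g - 1) / (g + 1) = 2 / (g + 1) by field.
have h' : 1 + (g - 1) / (g + 1) = 2 * g / (g + 1) by field.
by rewrite /cayley h h'; field.
Qed.

(** On [E i] the symbol lands near the peak of the i-th function, which is at least 1/4 there, while
    each other one is at most X^-2. As the sets are disjoint, the contributions add up to at least S
    / 32 - S / 64 times del^2 tau / 2, and division by 2 pi gives 1 / (256 pi). *)
Lemma test_lower w n (v : 'I_n -> R) (E : 'I_n -> set R) eta tau r del (X : R) (a : 'I_n -> C) :
  analytic_on_disk w -> 0 < eta -> 0 <= tau -> 0 <= r < 1 -> 0 <= del -> 0 < X ->
  64 * n%:R ^+ 2 <= X ^+ 4 ->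
  (forall i, measurable (E i)) -> (forall i, E i `<=` `[0%R, (2 * pi)%R[%classic) ->
  (forall i j t, E i t -> E j t -> i = j) ->
  (forall i, ((tau / 2)%:E <= mu (E i))%E) ->
  (forall i t, E i t -> del <= cmod (w ((r%:C)%C * expi t))) ->
  (forall i t, E i t ->
     cmod (gmap (cayley ((r%:C)%C * expi t)) - (0 +i* v i)%C) <= eta) ->
  (forall i j, i != j -> (X + 1) * eta <= `|v i - v j|) ->
  ((tau * del ^+ 2 / (256 * pi) * \sum_(i < n) cmod (a i) ^+ 2)%:E <=
    H2norm2 (wcomp w (@symbol R) (fun z => (\sum_(i < n) a i * testf eta (v i) z)%R)))%E.
Proof.
move=> hw e0 tau0 r01 del0 X0 nX mE ED Edisj Emu Ew Eg sep.
have [r0 r1] := andP r01.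
pose f := fun z => \sum_(i < n) a i * testf eta (v i) z.
pose S := \sum_(i < n) cmod (a i) ^+ 2.
have S0 : 0 <= S by apply: sumr_ge0 => i _; exact: sqr_ge0.
have hf : analytic_on_disk f by apply: analytic_sum => i; exact: testf_analytic.
have [phan phlt] := @symbol_analytic_selfmap R.
have hT : analytic_on_disk (wcomp w (@symbol R) f).
  move=> z z1; apply/derivable_cdiff.
  have [d1 H1] := analytic_cdiff hw z1.
  have [d2 H2] := analytic_cdiff phan z1.
  have [d3 H3] := analytic_cdiff hf (phlt z z1).
  by eexists; exact: (cdiffM H1 (cdiff_comp H2 H3)).
apply: (@le_trans _ _ (integral_mean2 (wcomp w (@symbol R) f) r)); last first.
  by apply: ereal_sup_ubound; exists r => //=; rewrite in_itv.
have p0 : 0 < 2 * pi :> R by rewrite mulr_gt0// pi_gt0.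
have pi0 : 0 < pi :> R by exact: pi_gt0.
(* From |A1|^2 <= 2 (|A1 + A2|^2 + |A2|^2) with |A1| >= |a_i| / 4: half of 1/16 is 1/32, and the
   second term bounds |A2|^2. *)
pose e i := del ^+ 2 * (cmod (a i) ^+ 2 / 32 - S * n%:R / X ^+ 4).
have lower i t : E i t -> e i <= cmod (wcomp w (@symbol R) f ((r +i* 0)%C * expi t)) ^+ 2.
  move=> Eit; set z := (_ * _).
  have z1 : cmod z < 1 by rewrite cmod_polar.
  have u1 := phlt z z1; set u := symbol z in u1.
  have hg : cmod (cayley u - (0 +i* v i)%C) <= eta by rewrite cayley_symbol//; exact: Eg Eit.
  have own : 1 / 4 <= cmod (testf eta (v i) u).
    rewrite cmod_testf// mul1r.
    have -> : cayley u + (eta +i* - v i)%C = (cayley u - (0 +i* v i)%C) + (eta%:C)%C.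
      by apply: complex_eqP; rewrite !(ReD, ImD, ReN, ImN) /=; ring.
    set g := cmod (_ + _).
    have g2 : g <= 2 * eta.
      by apply: le_trans (cmodD _ _) _; rewrite cmod_real (gtr0_norm e0); lra.
    have g0 : 0 < g.
      apply: (lt_le_trans e0); apply: (le_trans (pole_dist (v i) (ltW (cayley_Re_gt0 u1)) e0).1).
      rewrite /g le_eqVlt; apply/orP; left; apply/eqP; congr cmod.
      by apply: complex_eqP; rewrite !(ReD, ImD, ReN, ImN) /=; ring.
    rewrite ler_pdivlMr ?exprn_gt0//.
    have : g ^+ 2 <= (2 * eta) ^+ 2 by rewrite ler_pXn2r ?nnegrE ?(ltW g0) ?mulr_ge0 ?(ltW e0).
    by rewrite exprMn; lra.
  have other j : j != i -> cmod (testf eta (v j) u) <= (X ^+ 2)^-1.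
    move=> ji; have Xe : 0 < X * eta by rewrite mulr_gt0.
    have : cmod (testf eta (v j) u) <= (eta / (X * eta)) ^+ 2.
      apply: testf_le => //; apply: le_trans (pole_dist (v j) (ltW (cayley_Re_gt0 u1)) e0).2.
      have h1 : `|Im (cayley u) - v i| <= eta.
        apply: le_trans hg; apply: le_trans (ler_Im_cmod _).
        by rewrite ImD ImN.
      have := sep j i ji; have := ler_distD (Im (cayley u)) (v j) (v i).
      rewrite (distrC (v j) (Im _)); lra.
    move/le_trans; apply; rewrite le_eqVlt; apply/orP; left; apply/eqP.
    by field; rewrite !gt_eqF.
  have Ew' := Ew i t Eit.
  rewrite /wcomp -/u cmodM exprMn /e; apply: (@le_trans _ _ (del ^+ 2 * cmod (f u) ^+ 2)).
    rewrite ler_wpM2l ?sqr_ge0//.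
    rewrite /f (bigD1 i)//=; set A1 := a i * _; set A2 := \sum_(_ | _) _.
    have A1l : cmod (a i) / 4 <= cmod A1.
      by rewrite cmodM ler_wpM2l ?cmod_ge0//; move: own; rewrite mul1r.
    have A2u : cmod A2 ^+ 2 <= S * n%:R / X ^+ 4.
      have h : cmod A2 <= (X ^+ 2)^-1 * \sum_(j < n) cmod (a j) * 1.
        apply: le_trans (cmod_sum _ _) _; rewrite mulr_sumr.
        apply: (@le_trans _ _ (\sum_(j < n | j != i) (X ^+ 2)^-1 * (cmod (a j) * 1))).
          apply: ler_sum => j ji; rewrite cmodM mulr1 mulrC ler_wpM2r ?cmod_ge0//.
          exact: other.
        rewrite [leRHS](bigD1 i)//= lerDr !mulr_ge0 ?cmod_ge0//.
        by rewrite invr_ge0 sqr_ge0.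
      have h' : cmod A2 ^+ 2 <= ((X ^+ 2)^-1 * \sum_(j < n) cmod (a j) * 1) ^+ 2.
        rewrite ler_pXn2r ?nnegrE ?cmod_ge0//.
        by apply: le_trans h; exact: cmod_ge0.
      apply: le_trans h' _; rewrite exprMn.
      have cs := @weighted_cauchy_schwarz _ (fun j : 'I_n => cmod (a j)) (fun=> 1) (fun=> ler01).
      apply: le_trans (ler_wpM2l (sqr_ge0 _) cs) _.
      rewrite sumr_const card_ord; under [X in _ * (X * _)]eq_bigr do rewrite mulr1.
      rewrite -/S le_eqVlt; apply/orP; left; apply/eqP; field.
      by rewrite gt_eqF.
    have A1l2 : (cmod (a i) / 4) ^+ 2 <= cmod A1 ^+ 2.
      by rewrite ler_pXn2r ?nnegrE ?cmod_ge0// divr_ge0 ?cmod_ge0.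
    have tri : cmod A1 ^+ 2 <= 2 * (cmod (A1 + A2) ^+ 2 + cmod A2 ^+ 2).
      have : cmod A1 <= cmod (A1 + A2) + cmod A2.
        have := cmod_subl A1 (- A2); rewrite opprK cmodN; lra.
      set x := cmod A1; set y := cmod (A1 + A2); set q := cmod A2 => hx.
      have x0 : 0 <= x by exact: cmod_ge0.
      have : x ^+ 2 <= (y + q) ^+ 2 by rewrite ler_pXn2r ?nnegrE ?addr_ge0 ?cmod_ge0.
      have := sqr_ge0 (y - q); rewrite sqrrB sqrrD; lra.
    move: A1l2; rewrite expr_div_n (_ : 4 ^+ 2 = 16); last by ring.
    lra.
  by rewrite ler_wpM2r ?sqr_ge0// ler_pXn2r ?nnegrE ?cmod_ge0.
(* [e i] may be negative; the positive part keeps the step function nonnegative, as the integral of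
   a sum requires, and still dominates [e i]. *)
pose ep i := Num.max (e i) 0.
have ep0 i : 0 <= ep i by rewrite le_max lexx orbT.
pose D : set R := `[0%R, (2 * pi)%R[%classic.
have mD : measurable D by exact: measurable_itv.
have mind i : measurable_fun D (fun t => (\1_(E i) t : R)%:E).
  by apply/measurable_EFinP; exact: measurable_indic.
have step1 : (\int[mu]_(t in D) \sum_(i < n) ((ep i)%:E * (\1_(E i) t)%:E) <=
   \int[mu]_(t in D) ((cmod (wcomp w (@symbol R) f ((r +i* 0)%C * expi t))) ^+ 2)%:E)%E.
  apply: ge0_le_integral => //=.
  - by move=> t _; apply: sume_ge0 => i _; rewrite mule_ge0// lee_fin.
  - by apply: emeasurable_sum => i; apply: measurable_funeM; exact: mind.
  - exact: (@cmod_sqr_circle_measurable R _ r _ hT r01).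
  move=> t _; have [[i Eit]|none] := pselect (exists i, E i t); last first.
    rewrite big1 ?lee_fin ?sqr_ge0// => i _.
    rewrite indicE memNset ?mule0// => Eit; apply: none; by exists i.
  rewrite (bigD1 i)//= big1 ?adde0; last first.
    move=> j ji; rewrite indicE memNset ?mule0// => Ejt.
    by move/eqP: ji; apply; exact: Edisj Ejt Eit.
  rewrite indicE mem_set// mule1 lee_fin ge_max sqr_ge0 andbT; exact: lower.
have step2 : (\sum_(i < n) (e i * (tau / 2))%:E <=
    \int[mu]_(t in D) \sum_(i < n) ((ep i)%:E * (\1_(E i) t)%:E))%E.
  rewrite ge0_integral_sum//.
  - apply: lee_sum => i _; rewrite ge0_integralZl_EFin//.
    + have -> : (\int[mu]_(x in D) (\1_(E i) x)%:E = mu (E i))%E.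
        apply: (etrans (@integral_indic _ _ _ mu D mD (E i) (mE i))).
        by congr (mu _); apply: setIidl; exact: ED.
      apply: (@le_trans _ _ ((ep i)%:E * (tau / 2)%:E)%E).
        rewrite -EFinM lee_fin ler_wpM2r ?divr_ge0//.
        by rewrite /ep le_max lexx.
      by apply: lee_wpmul2l => //; rewrite lee_fin.
    + exact: mind.
  - by move=> i; apply: measurable_funeM; exact: mind.
  - by move=> i t _; rewrite mule_ge0// lee_fin.
rewrite /integral_mean2 lee_pdivlMr//; apply: le_trans step1; apply: le_trans step2.
rewrite sumEFin -EFinM lee_fin -mulr_suml.
have -> : \sum_(i < n) e i = del ^+ 2 * (S / 32 - n%:R * (S * n%:R / X ^+ 4)).
  rewrite -mulr_sumr big_split /= -mulr_suml; congr (_ * (_ + _)).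
  by rewrite sumr_const card_ord -[RHS]mulrN mulr_natl.
rewrite -/S.
have h64 : n%:R * (S * n%:R / X ^+ 4) <= S / 64.
  have X4 : 0 < X ^+ 4 by rewrite exprn_gt0.
  have -> : n%:R * (S * n%:R / X ^+ 4) = S * n%:R ^+ 2 / X ^+ 4 by field; rewrite gt_eqF.
  rewrite ler_pdivrMr//; have := ler_wpM2l S0 nX; lra.
have eqc (x d y q : R) : q != 0 ->
    y * d ^+ 2 / (256 * q) * x * (2 * q) = d ^+ 2 * (x / 64) * (y / 2).
  by move=> q0; field.
rewrite eqc ?gt_eqF//.
rewrite ler_wpM2r ?divr_ge0// ler_wpM2l ?sqr_ge0//; lra.
Qed.

End TestFunctions.

(** * Choice of separated cells on which w is not small *)

Section Selection.
Variable R : realType.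
Local Notation mu := (@lebesgue_measure R).
Implicit Types (Bad : set R) (a tau : R).

Definition cell a tau (l : nat) : set R :=
  `[(a + l%:R * tau)%R, (a + l%:R * tau + tau)%R[%classic.

Lemma cell_measurable a tau l : measurable (cell a tau l).
Proof. exact: measurable_itv. Qed.

Lemma cell_measure a tau l : 0 < tau -> mu (cell a tau l) = tau%:E.
Proof.
move=> tau0; rewrite /cell lebesgue_measure_itv /= lte_fin ltrDl tau0 -EFinD.
by congr (_%:E); ring.
Qed.

Lemma cell_cover a tau (k : nat) : 0 < tau ->
  `[a, (a + k.+1%:R * tau)%R[%classic = `[a, (a + k%:R * tau)%R[%classic `|` cell a tau k.
Proof.
move=> tau0; have k0 : 0 <= k%:R * tau by rewrite mulr_ge0// ltW.
have E : a + k.+1%:R * tau = a + k%:R * tau + tau by rewrite -natr1; ring.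
rewrite E /cell; apply/seteqP; split => x; rewrite /= !in_itv /=.
  by move=> /andP[x1 x2]; have [h|h] := ltP x (a + k%:R * tau); [left|right]; rewrite ?x1 ?x2 ?h.
by case=> /andP[x1 x2]; apply/andP; split; lra.
Qed.

Lemma sum_cells_le a tau Bad (k : nat) : 0 < tau -> measurable Bad ->
  (\sum_(0 <= l < k) mu (cell a tau l `&` Bad) <= mu Bad)%E.
Proof.
move=> tau0 mB.
have -> : (\sum_(0 <= l < k) mu (cell a tau l `&` Bad) =
    mu (`[a, (a + k%:R * tau)%R[%classic `&` Bad))%E.
  elim: k => [|k IH].
    rewrite big_nil mul0r addr0 set_itvco0 set0I measure0//.
  rewrite big_nat_recr//= IH cell_cover// setIUl measureU//.
  - by apply: measurableI => //; exact: measurable_itv.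
  - by apply: measurableI => //; exact: cell_measurable.
  - apply/seteqP; split => // x [[+ _] [+ _]]; rewrite /cell /= !in_itv /=.
    by move=> /andP[_ h1] /andP[h2 _]; have := lt_le_trans h1 h2; rewrite ltxx.
apply: le_measure; rewrite ?inE//.
by apply: measurableI => //; exact: measurable_itv.
Qed.

Lemma sum_nat_mul (F : nat -> R) (Q N : nat) :
  \sum_(0 <= l < N * Q) F l = \sum_(0 <= q < Q) \sum_(0 <= j < N) F (j * Q + q)%N.
Proof.
rewrite exchange_big /=; elim: N => [|N IH]; first by rewrite mul0n !big_nil.
rewrite big_nat_recr//= -IH mulSnr (big_cat_nat (n := N * Q))//= ?leq_addr//.
congr (_ + _); rewrite -{1}[(N * Q)%N]add0n big_addn addKn.
by apply: eq_bigr => q _; rewrite addnC.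
Qed.

(** Pigeonhole over the Q residue classes of cell indices: one class meets [Bad] in measure at most
    N tau / 4, so at most half of its N cells lose more than tau / 2. Staying in one class separates
    the indices by Q. *)
Lemma select_cells a tau Bad (Q N : nat) : (0 < Q)%N -> 0 < tau -> measurable Bad ->
  (mu Bad <= ((N * Q)%:R * tau / 4)%:E)%E ->
  exists q : nat, (q < Q)%N /\ exists A : {set 'I_N}, (N <= 2 * #|A|)%N /\
    forall j, j \in A -> ((tau / 2)%:E <= mu (cell a tau (j * Q + q) `\` Bad))%E.
Proof.
move=> Q0 tau0 mB Bsmall.
have mc l : measurable (cell a tau l : set R) by exact: cell_measurable.
have mcB l : measurable (cell a tau l `&` Bad : set R) by exact: measurableI.
have finc l : mu (cell a tau l `&` Bad) \is a fin_num.
  rewrite ge0_fin_numE//; apply: le_lt_trans (_ : (tau%:E < +oo)%E); last exact: ltry.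
  rewrite -(cell_measure a l tau0); apply: le_measure; rewrite ?inE;
    [exact: mcB|exact: mc|exact: subIsetl].
pose m l := fine (mu (cell a tau l `&` Bad)).
have m0 l : 0 <= m l by exact: fine_ge0.
have tot : \sum_(0 <= l < N * Q) m l <= (N * Q)%:R * tau / 4.
  rewrite -lee_fin; apply: le_trans Bsmall; apply: le_trans (sum_cells_le a (N * Q) tau0 mB).
  by rewrite -sumEFin; apply: lee_sum => l _; rewrite fineK.
have [q [qQ Hq]] : exists q, (q < Q)%N /\ \sum_(0 <= j < N) m (j * Q + q)%N <= N%:R * tau / 4.
  apply: contrapT => /forallNP none.
  have lt (q : 'I_Q) : N%:R * tau / 4 < \sum_(0 <= j < N) m (j * Q + q)%N.
    by rewrite ltNge; apply/negP => h; apply: (none q); split.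
  move: tot; rewrite sum_nat_mul big_mkord; apply/negP; rewrite -ltNge.
  have -> : (N * Q)%:R * tau / 4 = \sum_(q < Q) (N%:R * tau / 4).
    by rewrite sumr_const card_ord -mulr_natl natrM; ring.
  apply: ltr_sum; first by apply/hasP; exists (Ordinal Q0); rewrite ?mem_index_enum.
  by move=> q _; exact: lt.
pose A : {set 'I_N} := [set j : 'I_N | m (j * Q + q)%N <= tau / 2]%SET.
exists q; split => //; exists A; split.
  pose B := (~: A)%SET; have cAC : (#|A| + #|B| = N)%N by rewrite cardsC card_ord.
  suff : (2 * #|B| <= N)%N by lia.
  rewrite -(ler_nat R) natrM.
  have : #|B|%:R * (tau / 2) <= N%:R * tau / 4.
    apply: le_trans Hq; rewrite big_mkord (bigID (mem B)) /=.
    apply: le_trans (_ : \sum_(j in B) (tau / 2) <= _).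
      by rewrite sumr_const mulr_natl.
    apply: le_trans (_ : \sum_(j in B) m (j * Q + q)%N <= _).
      by apply: ler_sum => j; rewrite !inE -ltNge => /ltW.
    by rewrite lerDl sumr_ge0.
  move=> h; rewrite -(ler_pM2r (_ : 0 < tau / 4)); last by rewrite divr_gt0.
  by lra.
move=> j; rewrite inE => hj; set l := (j * Q + q)%N in hj *.
have mD : measurable (cell a tau l `\` Bad).
  exact: measurableD.
have split_mu : (tau%:E = (m l)%:E + mu (cell a tau l `\` Bad))%E.
  have disj : (cell a tau l `&` Bad) `&` (cell a tau l `\` Bad) = set0.
    by apply/seteqP; split => // x [[_ ?] [_ ?]].
  rewrite -(cell_measure a l tau0) /m fineK//.
  have {1}-> : cell a tau l = (cell a tau l `&` Bad) `|` (cell a tau l `\` Bad).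
    by rewrite setUIDK.
  exact: (measureU mu (mcB l) mD disj).
have fD : mu (cell a tau l `\` Bad) \is a fin_num.
  rewrite ge0_fin_numE//; apply: le_lt_trans (_ : (tau%:E < +oo)%E); last exact: ltry.
  rewrite -(cell_measure a l tau0); apply: le_measure; rewrite ?inE;
    [exact: mD|exact: mc|exact: subDsetl].
have h : tau = m l + fine (mu (cell a tau l `\` Bad)).
  by apply: EFin_inj; rewrite EFinD (fineK fD).
by rewrite -(fineK fD) lee_fin; lra.
Qed.

End Selection.

(** * Choice of the parameters and conclusion *)

Section Conclusion.
Variable R : realType.
Local Notation C := R[i].
Local Notation mu := (@lebesgue_measure R).
Local Notation half := (@half R).

(** The left side is 16 times the total number of cells. Since 432 * 9 <= 2^12 and (K + 2)^2 <= 2^(2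
    (K + 1)), it is at most 2 to the power 4 + 12 + 2 (K + 1) + 2 K^3, and K >= 4 makes this
    exponent at most 4 K^3 <= K^4. *)
Lemma parameter_bound (K : nat) : (4 <= K)%N ->
  (16 * (2 ^ (K ^ 3) * (432 * K.+2 ^ 2 * (8 * 2 ^ (K ^ 3) + 1))) <= 2 ^ (K ^ 4))%N.
Proof.
move=> K4; set N0 := (2 ^ (K ^ 3))%N.
have N1 : (1 <= N0)%N by rewrite expn_gt0.
have k2 : (K.+2 ^ 2 <= 2 ^ (2 * K.+1))%N.
  by rewrite mulnC expnM leq_exp2r// ltn_expl.
apply: (@leq_trans (2 ^ 4 * (2 ^ 12 * 2 ^ (2 * K.+1) * (N0 * N0)))).
  rewrite leq_mul//; apply: (@leq_trans (N0 * (432 * 2 ^ (2 * K.+1) * (9 * N0)))).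
    by rewrite leq_mul//; apply: leq_mul; [rewrite leq_mul2l k2 orbT|lia].
  have -> : (N0 * (432 * 2 ^ (2 * K.+1) * (9 * N0)) =
      432 * 9 * (2 ^ (2 * K.+1) * (N0 * N0)))%N by ring.
  by rewrite -[leqRHS]mulnA leq_mul.
rewrite /N0 -!expnD leq_exp2l//.
have h : (K ^ 4 = K * K ^ 3)%N by rewrite expnS.
have h3 : (K ^ 3 = K * (K * K))%N by rewrite !expnS expn0 muln1.
rewrite h; have : (4 * K ^ 3 <= K * K ^ 3)%N by rewrite leq_mul2r K4 orbT.
have : (16 * K <= K ^ 3)%N.
  by rewrite h3 mulnC leq_mul2l; apply/orP; right; apply: (@leq_trans (4 * 4)%N) => //; exact: leq_mul.
lia.
Qed.

Lemma growth_bound (D' Bd : R) : 0 <= D' -> exists K : nat, (4 <= K)%N /\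
  Bd < expR (K%:R ^+ 3 * ln 2 - D' * K.+2%:R ^+ 2) / 2.
Proof.
move=> D0; have l2 : 0 < ln 2 :> R by rewrite ln_gt0// ltr1n.
(* The middle term gives k ln 2 >= 4 D' + 1, and (k + 2)^2 <= 4 k^2, so the exponent is at least k^2
   >= k; the last term lets e^k / 2 exceed [Bd]. *)
pose Y : R := 4 + (4 * D' + 1) / ln 2 + 2 * `|Bd|.
have [K YK] : exists K : nat, Y <= K%:R.
  exists `|Num.ceil Y|%N; apply: le_trans (ceil_ge _) _.
  rewrite -[leRHS]/((Posz `|Num.ceil Y|%N)%:~R).
  by rewrite ler_int lez_abs.
have q0 : 0 <= (4 * D' + 1) / ln 2 by rewrite divr_ge0 ?(ltW l2)//; lra.
have b0 : 0 <= `|Bd| by [].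
exists K; split.
  by rewrite -(ler_nat R); apply: le_trans YK; rewrite /Y; lra.
set k : R := K%:R in YK.
have k4 : 4 <= k by rewrite /Y in YK; lra.
have kl : 4 * D' + 1 <= k * ln 2.
  by rewrite -ler_pdivrMr//; rewrite /Y in YK; lra.
have kS : K.+2%:R = k + 2 :> R by rewrite -addn2 natrD.
have ex : k <= k ^+ 3 * ln 2 - D' * K.+2%:R ^+ 2.
  rewrite kS.
  have h1 : k ^+ 2 * (4 * D' + 1) <= k ^+ 3 * ln 2.
    by rewrite (exprSr k 2) -mulrA ler_wpM2l// sqr_ge0.
  have h2 : D' * (k + 2) ^+ 2 <= D' * (4 * k ^+ 2).
    rewrite ler_wpM2l//.
    have -> : 4 * k ^+ 2 = (2 * k) ^+ 2 by ring.
    by rewrite ler_pXn2r ?nnegrE//; lra.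
  have h3 : k <= k ^+ 2 by rewrite expr2 ler_peMl//; lra.
  lra.
rewrite ltr_pdivlMr//; apply: lt_le_trans (_ : expR k <= _); last by rewrite ler_expR.
apply: lt_le_trans (expR_ge1Dx k).
by have := ler_norm Bd; rewrite /Y in YK; lra.
Qed.

(** [Q] solves (X + 1) eta = Q tau / 4 with X = 8 N and eta = 108 kappa tau, the separation needed
    by the test functions; the last bound says that the curve follows the axis at the scale of the
    cells. *)
Lemma window_parameters (K : nat) : (4 <= K)%N ->
  exists N Q : nat, [/\ N = (2 ^ (K ^ 3))%N, (1 <= N)%N, (2 <= N * Q)%N,
    Q%:R = 432 * kappa R K * (8 * N%:R + 1) &
    half (K ^ 4) <= (16 * (N * Q)%:R)^-1].
Proof.
move=> K4; set N0 := (2 ^ (K ^ 3))%N.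
have N1 : (1 <= N0)%N by rewrite expn_gt0.
have Q2 : (2 <= 432 * K.+2 ^ 2 * (8 * N0 + 1))%N.
  by rewrite -mulnA -[X in (X <= _)%N]muln1 leq_mul// muln_gt0 expn_gt0 addn1.
have QE : (432 * K.+2 ^ 2 * (8 * N0 + 1))%:R = 432 * kappa R K * (8 * N0%:R + 1).
  by rewrite !natrM natrD natrM /kappa natrX.
have := parameter_bound K4; rewrite -/N0.
move: (432 * K.+2 ^ 2 * (8 * N0 + 1))%N Q2 QE => Q Q2 QE bnd.
have NQ2 : (2 <= N0 * Q)%N by rewrite -[X in (X <= _)%N]mul1n leq_mul.
exists N0, Q; split => //; move: (N0 * Q)%N NQ2 bnd => M M2 bnd.
rewrite halfE lef_pV2 ?posrE ?exprn_gt0//.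
  by rewrite -natrX -natrM ler_nat.
by rewrite mulr_gt0// ltr0n (leq_trans _ M2).
Qed.

(** The quotient of the lower constant tau del^2 / (256 pi) by the upper one 2 eta = 216 kappa tau
    no longer contains [tau]: the bound is insensitive to the number of cells. *)
Lemma symbol_sing_num2_ge (w : C -> C) (Cw r0 : R) (K : nat) :
  analytic_on_disk w -> 0 < Cw -> 0 <= r0 < 1 ->
  (forall r del, r0 <= r < 1 -> 0 < del < 1 ->
    (mu ([set t | cmod (w ((r%:C)%C * expi t)) < del]%R `&` `[0%R, (2 * pi)%R[)
      <= (Cw / - ln del)%:E)%E) ->
  (4 <= K)%N ->
  exists n : nat, (2 ^ (K ^ 3) <= 2 * n)%N /\ forall k, (k < n)%N ->
   ((expR (- (128 * kappa R K * Cw)) / (128 * 432 * pi * kappa R K))%:E <=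
     sing_num2 (wcomp w (@symbol R)) k)%E.
Proof.
move=> hw Cw0 /andP[r00 r01] Hsmall K4.
have K0 : (0 < K)%N by exact: leq_trans K4.
have pi0 : 0 < pi :> R by exact: pi_gt0.
have p2 : 1 <= pi / 2 :> R by exact: pihalf_ge1.
have k0 := kappa_gt0 R K; have k4 := kappa_ge4 R K.
set kap := kappa R K in k0 k4 *.
have [N0 [Q [<- N01 M2 QE hh]]] := window_parameters K4.
have Q0 : (0 < Q)%N by move: M2; case: Q {QE hh} => //; rewrite muln0.
(* Since n <= N0, this ensures both 64 n^2 <= X^4, required by [test_lower], and 4 n <= (X + 1)^2,
   required by [test_upper]. *)
pose X : R := 8 * N0%:R; pose M := (N0 * Q)%N.
have M0 : 0 < M%:R :> R by rewrite ltr0n; exact: leq_trans M2.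
pose tau : R := (16 * kap * M%:R)^-1.
have tau0 : 0 < tau by rewrite invr_gt0 !mulr_gt0.
have Mtau : M%:R * tau = 1 / (16 * kap) by rewrite /tau; field; rewrite !gt_eqF.
have ktau : kap * tau = (16 * M%:R)^-1 by rewrite /tau; field; rewrite !gt_eqF.
have hhalf : half (K ^ 4) <= kap * tau.
  by rewrite ktau.
pose eta := 108 * kap * tau.
have eta0 : 0 < eta by rewrite !mulr_gt0.
pose r := Num.max r0 (1 - tau).
have r1 : r < 1 by rewrite gt_max r01; lra.
have rr0 : r0 <= r by rewrite le_max lexx.
have rt : 1 - tau <= r by rewrite le_max lexx orbT.
have rge0 : 0 <= r by exact: le_trans rr0.
(* Then Cw / L = 1 / (64 kap), a quarter of the window length M tau = 1 / (16 kap), as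
   [select_cells] requires. *)
pose L := 64 * kap * Cw.
have L0 : 0 < L by rewrite !mulr_gt0.
pose del := expR (- L).
have del0 : 0 < del by exact: expR_gt0.
have del1 : del < 1 by rewrite -expR0 ltr_expR oppr_lt0.
pose Bad := [set t | cmod (w ((r%:C)%C * expi t)) < del] `&` `[0%R, (2 * pi)%R[%classic.
have mBad : measurable Bad.
  apply: measurableI; last exact: measurable_itv.
  have -> : [set t | cmod (w ((r%:C)%C * expi t)) < del] =
     (fun t => cmod (w ((r%:C)%C * expi t))) @^-1` [set x | x < del] by [].
  apply: open_measurable; apply: open_comp => // x _.
  by apply: analytic_circle_continuous; rewrite ?rge0.
have Bsmall : (mu Bad <= ((N0 * Q)%:R * tau / 4)%:E)%E.
  apply: le_trans (Hsmall r del _ _) _; rewrite ?rr0 ?r1 ?del0 ?del1//.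
  rewrite lee_fin /del expRK opprK -/M Mtau /L le_eqVlt; apply/orP; left; apply/eqP.
  by field; rewrite !gt_eqF.
have [q [qQ [A [NA HA]]]] := select_cells (tcenter R K) Q0 tau0 mBad Bsmall.
pose n := #|A|; exists n; split => //.
pose idx (i : 'I_n) : nat := (enum_val i * Q + q)%N.
have idxM i : (idx i < M)%N.
  rewrite /idx /M; have := ltn_ord (enum_val i).
  move=> h; apply: (@leq_trans ((enum_val i).+1 * Q)); last by rewrite leq_mul2r h orbT.
  by rewrite mulSnr ltn_add2l.
have idxsep i j : i != j -> Q%:R <= `|(idx i)%:R - (idx j)%:R| :> R.
  move=> ij; have : (enum_val i : nat) != enum_val j.
    by rewrite val_eqE (inj_eq enum_val_inj).
  rewrite /idx !natrD !natrM.
  move: (enum_val i) (enum_val j) => x y xy.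
  have -> : x%:R * Q%:R + q%:R - (y%:R * Q%:R + q%:R) = (x%:R - y%:R) * Q%:R :> R by ring.
  rewrite normrM (ger0_norm (ler0n _ _)) ler_peMl//.
  move: xy; rewrite neq_ltn => /orP[h|h].
    rewrite distrC; apply: le_trans (ler_norm _).
    by rewrite lerBrDl natr1 ler_nat.
  by apply: le_trans (ler_norm _); rewrite lerBrDl natr1 ler_nat.
have rint : 1 - tau <= r < 1 by rewrite rt r1.
have MW : M%:R * tau <= 1 / (16 * kap) by rewrite Mtau.
have [geo1 geo2] := window_geometry K0 M2 tau0 MW rint hhalf.
pose v i := cell_height K tau (idx i).
pose E i := cell (tcenter R K) tau (idx i) `\` Bad.
have sep i j : i != j -> (X + 1) * eta <= `|v i - v j|.
  move=> ij; apply: le_trans (geo2 _ _ (idxM i) (idxM j)).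
  apply: le_trans (_ : Q%:R * tau / 4 <= _); last first.
    by rewrite ler_pM2r// ler_pM2r// idxsep.
  rewrite /eta QE -/X -/kap le_eqVlt; apply/orP; left; apply/eqP; by field.
have cellsub i : cell (tcenter R K) tau (idx i) `<=` `[0%R, (2 * pi)%R[%classic.
  move=> t; rewrite /cell /= !in_itv /= => /andP[t1 t2].
  have [tc0 tc1] := tcenter_bounds R K.
  have i1 : (idx i)%:R * tau + tau <= 1 / (16 * kap).
    apply: le_trans MW; rewrite -[X in _ + X]mul1r -mulrDl natr1 ler_pM2r// ler_nat.
    exact: idxM.
  have i0 : 0 <= (idx i)%:R * tau by rewrite mulr_ge0// ltW.
  have : 1 / (16 * kap) <= 1.
    by rewrite mul1r invf_le1 ?mulr_gt0//; lra.
  by move=> hk; apply/andP; split; lra.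
have n0 : (n <= N0)%N by rewrite /n -[X in (_ <= X)%N]card_ord max_card.
have nN : n%:R <= N0%:R :> R by rewrite ler_nat.
have N1R : 1 <= N0%:R :> R by rewrite ler1n.
have XE : X = 8 * N0%:R by [].
have nn0 : 0 <= n%:R :> R by [].
have A0 : 0 < 2 * eta by rewrite mulr_gt0.
have d0 : 0 < (X + 1) * eta by rewrite mulr_gt0// ltr_wpDl// mulr_ge0.
have han i : analytic_on_disk (testf eta (v i)) by exact: testf_analytic.
have hb i z : cmod z < 1 -> cmod (testf eta (v i) z) <= 1 by exact: testf_le1.
have cond : 4 * n%:R * eta ^+ 2 <= ((X + 1) * eta) ^+ 2.
  have -> : ((X + 1) * eta) ^+ 2 = (X + 1) ^+ 2 * eta ^+ 2 by ring.
  rewrite ler_wpM2r ?sqr_ge0// XE.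
  have := sqr_ge0 (N0%:R : R); rewrite sqrrD1 exprMn => h.
  by rewrite (_ : 8 ^+ 2 = 64); [lra|ring].
have up (a : 'I_n -> C) := @test_upper R n v eta _ a eta0 d0 cond sep.
have lo (a : 'I_n -> C) : ((tau * del ^+ 2 / (256 * pi) * \sum_(i < n) cmod (a i) ^+ 2)%:E <=
    H2norm2 (wcomp w (@symbol R) (fun z => (\sum_(i < n) a i * testf eta (v i) z)%R)))%E.
  apply: (@test_lower R w n v E eta tau r del X a hw eta0 (ltW tau0)) => //.
  - by rewrite rge0.
  - exact: ltW.
  - by rewrite XE mulr_gt0//; lra.
  - rewrite XE exprMn.
    have h1 : n%:R ^+ 2 <= N0%:R ^+ 2 :> R by rewrite ler_pXn2r ?nnegrE.
    have h2 : N0%:R ^+ 2 <= N0%:R ^+ 4 :> R by rewrite ler_weXn2l.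
    have h3 : 0 <= N0%:R ^+ 4 :> R by rewrite exprn_ge0.
    by rewrite (_ : 8 ^+ 4 = 4096); [lra|ring].
  - by move=> i; apply: measurableD => //; exact: cell_measurable.
  - by move=> i t [/cellsub].
  - move=> i j t [ci _] [cj _]; apply/eqP; apply: contraT => ij.
    move: ci cj; rewrite /cell /= !in_itv /= => /andP[i1 i2] /andP[j1 j2].
    have Q1 : 1 <= Q%:R :> R by rewrite ler1n.
    have := le_trans Q1 (idxsep i j ij).
    rewrite -(ler_pM2r tau0) -{2}(gtr0_norm tau0) -normrM mul1r mulrBl.
    by rewrite leNgt ltr_norml => /negP h; exfalso; apply: h; apply/andP; split; lra.
  - by move=> i; apply: HA; exact: enum_valP.
  - move=> i t [/cellsub tD nB]; rewrite leNgt; apply/negP => h; apply: nB.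
    by split.
  - move=> i t [ct _]; apply: geo1; first exact: idxM.
    by move: ct; rewrite /cell /= in_itv /= => /andP[h1 h2]; rewrite h1 ltW.
move=> k kn; apply: le_trans (sing_num2_ge A0 han hb up lo kn).
rewrite lee_fin le_eqVlt; apply/orP; left; apply/eqP.
have -> : expR (- (128 * kap * Cw)) = del ^+ 2.
  by rewrite /del expr2 -expRD; congr expR; rewrite /L; ring.
have eqc (d u k' y : R) : 0 < u -> 0 < k' -> 0 < y ->
    d ^+ 2 / (128 * 432 * u * k') = y * d ^+ 2 / (256 * u) / (2 * (108 * k' * y)).
  by move=> u0 k'0 y0; field; rewrite !gt_eqF.
exact: eqc.
Qed.

End Conclusion.
Theorem theorem4p7 (R : realType) :
  exists phi : R[i] -> R[i],
    analytic_selfmap phi /\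
    (@lebesgue_measure R).-negligible (unimodular_boundary_set phi) /\
    forall w : R[i] -> R[i],
      H2 w -> (exists z, cmod z < 1 /\ w z != 0) ->
      bounded_on_H2 (wcomp w phi) ->
      forall p : R, 0 < p -> ~ schatten p (wcomp w phi).
Proof.
exists (@symbol R); split; first exact: symbol_analytic_selfmap.
split; first exact: symbol_unimodular_negligible.
move=> w hw [z [z1 wz]] _ p p0.
have [Cw [r0 [Cw0 r01 Hs]]] := small_values_measure hw z1 wz.
apply: not_schatten_of_lower_bound => // B.
have pi0 : 0 < pi :> R by exact: pi_gt0.
have Hsing K := @symbol_sing_num2_ge R w Cw r0 K (proj1 hw) Cw0 r01 Hs.
have c0 : 0 < 128 * 432 :> R by lra.
move: (128 * 432) c0 Hsing => c c0 Hsing.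
(* Since 1 / y >= exp (- y), the denominator c pi kappa can be moved into the exponent, so that x >=
   exp (- D kappa). *)
pose D := 128 * Cw + c * pi.
have D0 : 0 <= D by rewrite addr_ge0 ?mulr_ge0 ?(ltW Cw0) ?(ltW c0) ?(ltW pi0).
have [K [K4 HK]] := growth_bound B (mulr_ge0 D0 (ltW (divr_gt0 p0 (ltr0Sn R 1)))).
have [n [Nn Hn]] := Hsing K K4.
have k0 := kappa_gt0 R K.
set x := (expR _ / _) in Hn.
have y0 : 0 < c * pi * kappa R K by exact: mulr_gt0 (mulr_gt0 c0 pi0) k0.
have xD : expR (- (D * kappa R K)) <= x.
  have -> : - (D * kappa R K) = - (128 * kappa R K * Cw) - c * pi * kappa R K.
    by rewrite /D; ring.
  rewrite expRD (expRN (c * pi * kappa R K)) /x ler_pM2l ?expR_gt0// lef_pV2 ?posrE ?expR_gt0//.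
  by apply: le_trans (expR_ge1Dx _); rewrite lerDr.
have x0 : 0 < x by rewrite divr_gt0 ?expR_gt0.
exists n, x; split => //.
apply: lt_le_trans HK _.
apply: le_trans (_ : n%:R * (expR (- (D * kappa R K)) `^ (p / 2)) <= _); last first.
  by rewrite ler_wpM2l// ge0_ler_powR// ?nnegrE ?expR_ge0 ?(ltW x0)// divr_ge0// ltW.
(* The exponent splits into the count 2^(K^3), at most twice n, and the power p / 2 of the lower
   bound for x; p / 2 occurs because [sing_num2] is a squared singular number. *)
have -> : K%:R ^+ 3 * ln 2 - D * (p / 2) * K.+2%:R ^+ 2 =
    (K ^ 3)%:R * ln 2 + - (D * kappa R K) * (p / 2) :> R.
  by rewrite /kappa natrX; ring.
rewrite -expRM expRD mulrAC ler_wpM2r ?expR_ge0// expRM_natl lnK ?posrE// -natrX.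
by rewrite ler_pdivrMr// -natrM ler_nat mulnC.
Qed.
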